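(* Let $\mathcal{H}_\varepsilon$ be the hybrid system and $\mathcal{H}_2^{\mathrm{ave}}$ its second-order average hybrid system, both defined in the context, and suppose that the basic assumption (A) and the regularity assumption (B) stated in the context hold. Let $\mathcal{A}\subset\mathbb{R}^n$ be a compact set. If $\mathcal{A}$ is uniformly asymptotically stable (UAS) with basin of attraction $\mathcal{B}_{\mathcal{A}}$ for $\mathcal{H}_2^{\mathrm{ave}}$, then $\mathcal{A}$ is semi-globally practically asymptotically stable (SGPAS) as $\varepsilon\to0^+$ with respect to the basin of attraction $\mathcal{B}_{\mathcal{A}}$ for $\mathcal{H}_\varepsilon$.
   Context: **Hybrid systems.** A hybrid dynamical system (HDS) with data $(C,F,D,G)$ is written $y\in C,\ \dot y\in F(y)$; $y\in D,\ y^+\in G(y)$, with $F,G$ set-valued. A compact hybrid time domain is a set $E=\bigcup_{j=0}^{J-1}([t_j,t_{j+1}],j)\subset\mathbb{R}_{\ge0}\times\mathbb{Z}_{\ge0}$ for a finite sequence $0=t_0\le t_1\le\dots\le t_J$; $E$ is a hybrid time domain if $E\cap([0,T]\times\{0,\dots,J\})$ is a compact hybrid time domain for all $(T,J)\in E$. A hybrid arc is a function $y:\mathrm{dom}(y)\to\mathbb{R}^m$ on a hybrid time domain such that $y(\cdot,j)$ is locally absolutely continuous for each $j$ for which $I_j=\{t:(t,j)\in\mathrm{dom}(y)\}$ has nonempty interior. It is a solution of the HDS if $y(0,0)\in C\cup D$; for every $j$ such that $I_j$ has nonempty interior, $y(t,j)\in C$ for all $t\in I_j$ and $\dot y(t,j)\in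 F(y(t,j))$ for almost all $t\in I_j$; and for all $(t,j)\in\mathrm{dom}(y)$ with $(t,j+1)\in\mathrm{dom}(y)$, $y(t,j)\in D$ and $y(t,j+1)\in G(y(t,j))$. **Set-valued maps.** $M:\mathbb{R}^p\rightrightarrows\mathbb{R}^m$ is outer semicontinuous (OSC) at $z$ if whenever $(z_i,s_i)\to(z,s)$ with $s_i\in M(z_i)$, then $s\in M(z)$; it is locally bounded (LB) at $z$ if $M(N_z)$ is bounded for some neighborhood $N_z$ of $z$. $M$ is OSC and LB relative to a set $K$ if it is OSC at every $z\in K$ and $M(K)=\bigcup_{z\in K}M(z)$ is bounded. **The system $\mathcal{H}_\varepsilon$.** Let $n=n_1+n_2$, $C,D\subset\mathbb{R}^n$, $\theta=(x,z)$ with $x\in\mathbb{R}^{n_1}$, $z\in\mathbb{R}^{n_2}$, $\tau=(\tau_1,\tau_2)\in\mathbb{R}_{\ge0}^2$, $\varepsilon>0$. The system $\mathcal{H}_\varepsilon$ has state $(\theta,\tau)$, flows for $(\theta,\tau)\in C\times\mathbb{R}^2_{\ge0}$ according to $$\dot\theta\in\{f_\varepsilon(x,z,\tau_1,\tau_2)\}\times\Phi(z),\quad \dot\tau_1=\varepsilon^{-1},\quad \dot\tau_2=\varepsilon^{-2},\qquad f_\varepsilon=\sum_{k=1}^2\varepsilon^{k-2}\phi_k(x,z,\tau_1,\tau_2)=\varepsilon^{-1}\phi_1+\phi_2,$$ with $f_\varepsilon$ continuous, and jumps for $(\theta,\tau)\in D\times\mathbb{R}^2_{\ge0}$ according to $\theta^+\in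 G(\theta)$, $\tau^+=\tau$. Here $\Phi:\mathbb{R}^{n_2}\rightrightarrows\mathbb{R}^{n_2}$ and $G:\mathbb{R}^n\rightrightarrows\mathbb{R}^n$. For $\delta\ge0$, $C_\delta=\{\theta\in\mathbb{R}^n:(\{\theta\}+\delta\mathbb{B})\cap C\neq\emptyset\}$, $\mathbb{B}$ the closed unit ball. ''Of class $\mathcal{C}^k$'' means that the $k$th derivative is locally Lipschitz continuous (so $\mathcal{C}^0$ means locally Lipschitz). **Assumption (A).** $C$ and $D$ are closed. $\Phi$ (viewed as $(x,z)\mapsto\Phi(z)$) is OSC, LB and convex-valued relative to $C$; $G$ is OSC and LB relative to $D$; $\Phi(z)\ne\emptyset$ for all $(x,z)\in C$; $G(x,z)\neq\emptyset$ for all $(x,z)\in D$. **Assumption (B).** There exist $\delta^*>0$ and $T_1,T_2>0$ such that for all $\delta\in[0,\delta^*]$: (a) for $k\in\{1,2\}$, $\phi_k:C_\delta\times\mathbb{R}^2_{\ge0}\to\mathbb{R}^{n_1}$ is $\mathcal{C}^{2-k}$ with respect to $(x,\tau_1)$, $\mathcal{C}^0$ with respect to $z$, and continuous in $\tau_2$; (b) for $k\in\{1,2\}$, $\phi_k$ is $T_1$-periodic in $\tau_1$ and $T_2$-periodic in $\tau_2$ on $C_\delta\times\mathbb{R}^2_{\ge0}$; (c) $\int_0^{T_2}\phi_1(x,z,\tau_1,s_2)\,ds_2=0$ for all $((x,z),\tau)\in C_\delta\times\mathbb{R}^2_{\ge0}$. **The average system $\mathcal{H}_2^{\mathrm{ave}}$.**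 Let $u_1(x,z,\tau)=\int_0^{\tau_2}\phi_1(x,z,\tau_1,s_2)\,ds_2$, $[u_1,\phi_1]_x=\partial_x\phi_1\cdot u_1-\partial_xu_1\cdot\phi_1$, and $$\bar f(\theta)=\frac1{T_1T_2}\int_0^{T_1}\!\!\int_0^{T_2}\Big(\phi_2(\theta,\tau)+\tfrac12[u_1,\phi_1]_x(\theta,\tau)\Big)d\tau_2\,d\tau_1 .$$ $\mathcal{H}_2^{\mathrm{ave}}$ has state $\bar\theta=(\bar x,\bar z)\in\mathbb{R}^n$ and is $\bar\theta\in C$: $\dot{\bar\theta}\in\{\bar f(\bar\theta)\}\times\Phi(\bar z)$; $\bar\theta\in D$: $\bar\theta^+\in G(\bar\theta)$. **Stability notions.** $\beta:\mathbb{R}_{\ge0}\times\mathbb{R}_{\ge0}\to\mathbb{R}_{\ge0}$ is of class $\mathcal{KL}$ if it is nondecreasing in its first argument, nonincreasing in its second, $\lim_{r\to0^+}\beta(r,s)=0$ for each $s$ and $\lim_{s\to\infty}\beta(r,s)=0$ for each $r$. For a compact set $\mathcal{A}$ contained in an open set $\mathcal{B}_{\mathcal{A}}$, a function $\omega:\mathcal{B}_{\mathcal{A}}\to\mathbb{R}_{\ge0}$ is a proper indicator for $\mathcal{A}$ on $\mathcal{B}_{\mathcal{A}}$ if it is continuous, $\omega(x)=0$ iff $x\in\mathcal{A}$, and $\{\omega(x_i)\}$ is unbounded whenever the sequence $\{x_i\}\subset\mathcal{B}_{\mathcal{A}}$ approaches the boundary of $\mathcal{B}_{\mathcal{A}}$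 or is unbounded. *UAS:* a compact set $\mathcal{A}$ contained in an open set $\mathcal{B}_{\mathcal{A}}$ is UAS with basin of attraction $\mathcal{B}_{\mathcal{A}}$ for an HDS if for every proper indicator $\omega$ for $\mathcal{A}$ on $\mathcal{B}_{\mathcal{A}}$ there is $\beta\in\mathcal{KL}$ such that every solution $y$ starting in $\mathcal{B}_{\mathcal{A}}$ satisfies $\omega(y(t,j))\le\beta(\omega(y(0,0)),t+j)$ for all $(t,j)\in\mathrm{dom}(y)$. *SGPAS:* $\mathcal{A}$ is SGPAS as $\varepsilon\to0^+$ with respect to $\mathcal{B}_{\mathcal{A}}$ for $\mathcal{H}_\varepsilon$ if for each proper indicator $\omega$ for $\mathcal{A}$ on $\mathcal{B}_{\mathcal{A}}$ there is $\beta\in\mathcal{KL}$ such that for each compact $K\subset\mathcal{B}_{\mathcal{A}}$ and each $\nu>0$ there is $\varepsilon^*>0$ such that for all $\varepsilon\in(0,\varepsilon^*]$ and all solutions $(\theta,\tau)$ of $\mathcal{H}_\varepsilon$ with $\theta(0,0)\in K$, $\omega(\theta(t,j))\le\beta(\omega(\theta(0,0)),t+j)+\nu$ for all $(t,j)\in\mathrm{dom}(\theta,\tau)$. *)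

(* Defs.v *)
From HB Require Import structures.
From mathcomp Require Import all_boot all_order all_algebra.
From mathcomp Require Import all_classical all_reals all_analysis.

Set Implicit Arguments.
Unset Strict Implicit.
Unset Printing Implicit Defensive.

Import Order.TTheory GRing.Theory Num.Theory.
Import numFieldNormedType.Exports.

Local Open Scope classical_set_scope.
Local Open Scope ring_scope.

Record hybrid_system (R : realType) (m : nat) := HybridSystem {
  flow_set : set 'rV[R]_m ;
  flow_map : 'rV[R]_m -> set 'rV[R]_m ;
  jump_set : set 'rV[R]_m ;
  jump_map : 'rV[R]_m -> set 'rV[R]_m
}.

Definition compact_hybrid_time_domain (R : realType) (E : set (R * nat)) : Prop :=
  exists (J : nat) (t : nat -> R),
    [/\ t 0%N = 0,
        forall j, (j < J)%N -> t j <= t j.+1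
      & E = [set p | (p.2 < J)%N /\ t p.2 <= p.1 <= t p.2.+1]].

Definition hybrid_time_domain (R : realType) (E : set (R * nat)) : Prop :=
  E `<=` [set p | 0 <= p.1] /\
  forall (T : R) (J : nat), E (T, J) ->
    compact_hybrid_time_domain (E `&` [set p | 0 <= p.1 <= T /\ (p.2 <= J)%N]).

Definition abs_continuous_on (R : realType) (V : normedModType R)
    (f : R -> V) (a b : R) : Prop :=
  forall e : R, 0 < e -> exists2 d : R, 0 < d &
    forall (N : nat) (u v : 'I_N -> R),
      (forall k, a <= u k /\ u k <= v k /\ v k <= b) ->
      trivIset [set: 'I_N] (fun k => `]u k, v k[%classic) ->
      \sum_(k < N) (v k - u k) < d ->
      \sum_(k < N) `|f (v k) - f (u k)| < e.

Definition locally_abs_continuous (R : realType) (V : normedModType R)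
    (f : R -> V) (I : set R) : Prop :=
  forall a b : R, `[a, b]%classic `<=` I -> abs_continuous_on f a b.

Definition time_slice (R : realType) (E : set (R * nat)) (j : nat) : set R :=
  [set t | E (t, j)].

(* A hybrid arc is a pair (E, y); the values of y outside E are never used:
   derivatives are only constrained almost everywhere on an interval. *)
Definition hybrid_arc (R : realType) (m : nat)
    (E : set (R * nat)) (y : R -> nat -> 'rV[R]_m) : Prop :=
  hybrid_time_domain E /\
  forall j, (time_slice E j)° !=set0 ->
    locally_abs_continuous (y^~ j) (time_slice E j).

Definition hybrid_solution (R : realType) (m : nat) (H : hybrid_system R m)
    (E : set (R * nat)) (y : R -> nat -> 'rV[R]_m) : Prop :=
  [/\ hybrid_arc E y,
      E (0, 0%N) /\ (flow_set H `|` jump_set H) (y 0 0%N),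
      forall j, (time_slice E j)° !=set0 ->
        (forall t, E (t, j) -> flow_set H (y t j)) /\
        {ae (@lebesgue_measure R), forall t, E (t, j) ->
          derivable (y^~ j) t 1 /\ flow_map H (y t j) ('D_1 (y^~ j) t)}
    & forall t j, E (t, j) -> E (t, j.+1) ->
        jump_set H (y t j) /\ jump_map H (y t j) (y t j.+1)].

Definition osc_at (R : realType) (p m : nat)
    (M : 'rV[R]_p -> set 'rV[R]_m) (z : 'rV[R]_p) : Prop :=
  forall (zs : nat -> 'rV[R]_p) (ss : nat -> 'rV[R]_m) (s : 'rV[R]_m),
    zs @ \oo --> z -> ss @ \oo --> s -> (forall i, M (zs i) (ss i)) -> M z s.

Definition osc_lb_relative (R : realType) (p m : nat)
    (M : 'rV[R]_p -> set 'rV[R]_m) (K : set 'rV[R]_p) : Prop :=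
  (forall z, K z -> osc_at M z) /\ bounded_set (\bigcup_(z in K) M z).

(* Local Lipschitz continuity with respect to the first variable: the constant
   is uniform for the second variable in a neighbourhood. *)
Definition class_C0_wrt (R : realType) (V W U : normedModType R)
    (S : set (V * W)) (f : V -> W -> U) : Prop :=
  forall v w, S (v, w) ->
    exists (A : set V) (B : set W) (k : R), [/\ nbhs v A, nbhs w B &
      forall w', B w' ->
        k.-lipschitz_(A `&` [set v' | S (v', w')]) (f^~ w')].

(* [Df v w] is a Frechet derivative at [v], relative to the slice of [S] at [w],
   of [f^~ w].  It is relative because the domains of interest are not open
   (they contain the points with tau1 = 0). *)
Definition has_derivative_wrt (R : realType) (V W U : normedModType R)
    (S : set (V * W)) (f : V -> W -> U) (Df : V -> W -> {linear V -> U}) : Prop :=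
  forall v w, S (v, w) ->
    continuous (Df v w) /\
    forall e : R, 0 < e -> \forall v' \near v, S (v', w) ->
      `|f v' w - f v w - Df v w (v' - v)| <= e * `|v' - v|.

(* The Lipschitz bound on the derivative is in operator norm. *)
Definition class_C1_wrt (R : realType) (V W U : normedModType R)
    (S : set (V * W)) (f : V -> W -> U) : Prop :=
  exists Df : V -> W -> {linear V -> U},
    has_derivative_wrt S f Df /\
    forall v w, S (v, w) ->
      exists (A : set V) (B : set W) (k : R), [/\ nbhs v A, nbhs w B &
        forall w', B w' -> forall h : V,
          (k * `|h|).-lipschitz_(A `&` [set v' | S (v', w')])
            (fun v' => Df v' w' h)].

Definition xpart (R : realType) (n1 n2 : nat) (theta : 'rV[R]_(n1 + n2))
  : 'rV[R]_n1 := lsubmx theta.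
Definition zpart (R : realType) (n1 n2 : nat) (theta : 'rV[R]_(n1 + n2))
  : 'rV[R]_n2 := rsubmx theta.

Definition theta_part (R : realType) (n : nat) (y : 'rV[R]_(n + 2))
  : 'rV[R]_n := lsubmx y.
Definition tau1_part (R : realType) (n : nat) (y : 'rV[R]_(n + 2)) : R :=
  rsubmx y 0 0.
Definition tau2_part (R : realType) (n : nat) (y : 'rV[R]_(n + 2)) : R :=
  rsubmx y 0 1.

(* phi x z tau1 tau2; only the values on the inflation of C, with tau1 and tau2
   nonnegative, are constrained. *)
Definition vfield (R : realType) (n1 n2 : nat) : Type :=
  'rV[R]_n1 -> 'rV[R]_n2 -> R -> R -> 'rV[R]_n1.

Definition f_eps (R : realType) (n1 n2 : nat) (phi1 phi2 : vfield R n1 n2)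
    (eps : R) : vfield R n1 n2 :=
  fun x z tau1 tau2 => eps^-1 *: phi1 x z tau1 tau2 + phi2 x z tau1 tau2.

Definition tau_nonneg (R : realType) (n : nat) (S : set 'rV[R]_n)
  : set 'rV[R]_(n + 2) :=
  [set y | [/\ S (theta_part y), 0 <= tau1_part y & 0 <= tau2_part y]].

Definition H_eps (R : realType) (n1 n2 : nat)
    (C D : set 'rV[R]_(n1 + n2)) (phi1 phi2 : vfield R n1 n2)
    (Phi : 'rV[R]_n2 -> set 'rV[R]_n2)
    (G : 'rV[R]_(n1 + n2) -> set 'rV[R]_(n1 + n2)) (eps : R)
  : hybrid_system R (n1 + n2 + 2) :=
  {| flow_set := tau_nonneg C ;
     flow_map := fun y => [set v |
       [/\ xpart (theta_part v) =
             f_eps phi1 phi2 eps (xpart (theta_part y)) (zpart (theta_part y))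
               (tau1_part y) (tau2_part y),
           Phi (zpart (theta_part y)) (zpart (theta_part v)),
           tau1_part v = eps^-1
         & tau2_part v = eps ^- 2]] ;
     jump_set := tau_nonneg D ;
     jump_map := fun y => [set y' |
       [/\ G (theta_part y) (theta_part y'),
           tau1_part y' = tau1_part y
         & tau2_part y' = tau2_part y]] |}.

Definition vint (R : realType) (n : nat) (a b : R) (f : R -> 'rV[R]_n)
  : 'rV[R]_n :=
  \row_i (\int[@lebesgue_measure R]_(s in `[a, b]) (f s 0 i))%R.

Definition u1_of (R : realType) (n1 n2 : nat) (phi1 : vfield R n1 n2)
  : vfield R n1 n2 :=
  fun x z tau1 tau2 => vint 0 tau2 (fun s2 => phi1 x z tau1 s2).

(* [u, phi]_x = (partial_x phi) u - (partial_x u) phi *)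
Definition lie_bracket_x (R : realType) (n1 n2 : nat) (u phi : vfield R n1 n2)
  : vfield R n1 n2 :=
  fun x z tau1 tau2 =>
    'd (fun x' => phi x' z tau1 tau2) x (u x z tau1 tau2)
    - 'd (fun x' => u x' z tau1 tau2) x (phi x z tau1 tau2).

Definition f_bar (R : realType) (n1 n2 : nat) (phi1 phi2 : vfield R n1 n2)
    (T1 T2 : R) (theta : 'rV[R]_(n1 + n2)) : 'rV[R]_n1 :=
  (T1 * T2)^-1 *:
    vint 0 T1 (fun tau1 => vint 0 T2 (fun tau2 =>
      phi2 (xpart theta) (zpart theta) tau1 tau2
      + 2^-1 *: lie_bracket_x (u1_of phi1) phi1
                  (xpart theta) (zpart theta) tau1 tau2)).

Definition H_ave (R : realType) (n1 n2 : nat)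
    (C D : set 'rV[R]_(n1 + n2)) (phi1 phi2 : vfield R n1 n2)
    (Phi : 'rV[R]_n2 -> set 'rV[R]_n2)
    (G : 'rV[R]_(n1 + n2) -> set 'rV[R]_(n1 + n2)) (T1 T2 : R)
  : hybrid_system R (n1 + n2) :=
  {| flow_set := C ;
     flow_map := fun theta => [set v |
       xpart v = f_bar phi1 phi2 T1 T2 theta /\ Phi (zpart theta) (zpart v)] ;
     jump_set := D ;
     jump_map := G |}.

Definition basic_assumption (R : realType) (n1 n2 : nat)
    (C D : set 'rV[R]_(n1 + n2)) (Phi : 'rV[R]_n2 -> set 'rV[R]_n2)
    (G : 'rV[R]_(n1 + n2) -> set 'rV[R]_(n1 + n2)) : Prop :=
  [/\ closed C /\ closed D,
      osc_lb_relative (fun theta : 'rV[R]_(n1 + n2) => Phi (zpart theta)) C /\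
        (forall theta, C theta ->
           convex_set (Phi (zpart theta) : set (convex_lmodType 'rV[R]_n2))),
      osc_lb_relative G D,
      forall theta, C theta -> Phi (zpart theta) !=set0
    & forall theta, D theta -> G theta !=set0].

Definition euclidean_norm (R : realType) (n : nat) (v : 'rV[R]_n) : R :=
  Num.sqrt (\sum_i v 0 i ^+ 2).

(* The norm of the library on row vectors is the sup norm, whereas the unit ball
   is Euclidean. *)
Definition inflation (R : realType) (n : nat) (C : set 'rV[R]_n) (delta : R)
  : set 'rV[R]_n :=
  [set theta | exists2 c, C c & euclidean_norm (c - theta) <= delta].

Definition regular_on (R : realType) (n1 n2 : nat) (S : set 'rV[R]_(n1 + n2))
    (phi1 phi2 : vfield R n1 n2) (T1 T2 : R) : Prop :=
  let dom x z tau1 tau2 := [/\ S (row_mx x z), 0 <= tau1 & 0 <= tau2] in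
  (* splittings of the variables as ((x, tau1), (z, tau2)) and
     (z, (x, tau1, tau2)) *)
  let dom_xt := [set p : ('rV[R]_n1 * R) * ('rV[R]_n2 * R) |
                  dom p.1.1 p.2.1 p.1.2 p.2.2] in
  let dom_z := [set p : 'rV[R]_n2 * ('rV[R]_n1 * R * R) |
                  dom p.2.1.1 p.1 p.2.1.2 p.2.2] in
  let wrt_xt (phi : vfield R n1 n2) :=
    fun (v : 'rV[R]_n1 * R) (w : 'rV[R]_n2 * R) => phi v.1 w.1 v.2 w.2 in
  let wrt_z (phi : vfield R n1 n2) :=
    fun (z : 'rV[R]_n2) (w : 'rV[R]_n1 * R * R) => phi w.1.1 z w.1.2 w.2 in
  [/\ class_C1_wrt dom_xt (wrt_xt phi1) /\ class_C0_wrt dom_xt (wrt_xt phi2),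
      class_C0_wrt dom_z (wrt_z phi1) /\ class_C0_wrt dom_z (wrt_z phi2),
      forall x z tau1, S (row_mx x z) -> 0 <= tau1 ->
        {within `[0, +oo[, continuous (phi1 x z tau1)} /\
        {within `[0, +oo[, continuous (phi2 x z tau1)},
      forall x z tau1 tau2, dom x z tau1 tau2 ->
        [/\ phi1 x z (tau1 + T1) tau2 = phi1 x z tau1 tau2,
            phi1 x z tau1 (tau2 + T2) = phi1 x z tau1 tau2,
            phi2 x z (tau1 + T1) tau2 = phi2 x z tau1 tau2
          & phi2 x z tau1 (tau2 + T2) = phi2 x z tau1 tau2]
    & forall x z tau1 tau2, dom x z tau1 tau2 ->
        vint 0 T2 (fun s2 => phi1 x z tau1 s2) = 0].

Definition regularity_assumption (R : realType) (n1 n2 : nat)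
    (C : set 'rV[R]_(n1 + n2)) (phi1 phi2 : vfield R n1 n2) (T1 T2 : R) : Prop :=
  exists2 delta_star : R, 0 < delta_star &
    forall delta, 0 <= delta <= delta_star ->
      regular_on (inflation C delta) phi1 phi2 T1 T2.

(* Only the values at nonnegative arguments are relevant. *)
Definition class_KL (R : realType) (beta : R -> R -> R) : Prop :=
  [/\ forall r s, 0 <= r -> 0 <= s -> 0 <= beta r s,
      forall r r' s, 0 <= r -> r <= r' -> 0 <= s -> beta r s <= beta r' s,
      forall r s s', 0 <= r -> 0 <= s -> s <= s' -> beta r s' <= beta r s,
      forall s, 0 <= s -> beta r s @[r --> 0^'+] --> (0 : R)
    & forall r, 0 <= r -> beta r s @[s --> +oo] --> (0 : R)].

Definition approaches_boundary (R : realType) (n : nat) (B : set 'rV[R]_n)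
    (xs : nat -> 'rV[R]_n) : Prop :=
  forall e : R, 0 < e ->
    \forall i \near \oo, exists2 b, (closure B `\` B°) b & `|xs i - b| < e.

Definition proper_indicator (R : realType) (n : nat) (A B : set 'rV[R]_n)
    (omega : 'rV[R]_n -> R) : Prop :=
  [/\ forall x, B x -> 0 <= omega x,
      {within B, continuous omega},
      forall x, B x -> (omega x = 0 <-> A x)
    & forall xs : nat -> 'rV[R]_n, (forall i, B (xs i)) ->
        approaches_boundary B xs \/ ~ bounded_set (range xs) ->
        ~ bounded_set (range (fun i => omega (xs i)))].

(* An indicator is only defined on B, so that the bounds on
   omega (y t j) below include y t j being in B. *)
Definition UAS (R : realType) (n : nat) (H : hybrid_system R n)
    (A B : set 'rV[R]_n) : Prop :=
  [/\ compact A, open B, A `<=` B &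
    forall omega, proper_indicator A B omega ->
      exists2 beta, class_KL beta &
        forall (E : set (R * nat)) (y : R -> nat -> 'rV[R]_n),
          hybrid_solution H E y -> B (y 0 0%N) ->
          forall t j, E (t, j) ->
            B (y t j) /\ omega (y t j) <= beta (omega (y 0 0%N)) (t + j%:R)].

Definition SGPAS (R : realType) (n : nat) (H : R -> hybrid_system R (n + 2))
    (A B : set 'rV[R]_n) : Prop :=
  forall omega, proper_indicator A B omega ->
    exists2 beta, class_KL beta &
      forall (K : set 'rV[R]_n) (nu : R), compact K -> K `<=` B -> 0 < nu ->
        exists2 eps_star : R, 0 < eps_star &
          forall eps, 0 < eps <= eps_star ->
          forall (E : set (R * nat)) (y : R -> nat -> 'rV[R]_(n + 2)),
            hybrid_solution (H eps) E y -> K (theta_part (y 0 0%N)) ->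
            forall t j, E (t, j) ->
              B (theta_part (y t j)) /\
              omega (theta_part (y t j)) <=
                beta (omega (theta_part (y 0 0%N))) (t + j%:R) + nu.

(* Main.v *)
Require Import Defs.
From HB Require Import structures.
From mathcomp Require Import all_boot all_order all_algebra.
From mathcomp Require Import all_classical all_reals all_analysis.
From mathcomp Require Import ring lra.

(** The proof compares trajectories with small eps to trajectories of the average
    system by a limiting argument, and transfers the estimate on omega.

    Averaging (averaged_window).  Near a point (x0, z0) let u be the primitive of
    phi_1 in the fast time tau_2, which is periodic because phi_1 has zero mean.  The
    derivative of x - eps u has no term of order 1 / eps; its term of order 1 is the
    drift phi_2 - Du (phi_1, 1), with Du the derivative of u in (x, tau_1).  The drift
    frozen at (x0, z0) oscillates in both times; the primitives sig2 and sig1 of its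
    oscillation, of size eps^2 and eps, remove it in the same way.  The averages of the
    drift and of the integrand of the average field agree (avg_f_bar): they differ by
    derivatives of periodic functions.  As the correction is of size eps, the increment
    of x over an interval of length h is h times the average field at (x0, z0), up to
    eta h + c eps, as long as the trajectory stays close to (x0, z0).  All fields are
    only Lipschitz in z, so that the corrected variable is differentiable up to an error
    on the slope (apd), which is harmless: mean_value_convex is a mean value inequality
    for absolutely continuous functions with approximate derivatives.  The same
    inequality, with convexity and upper semicontinuity of Phi, treats z (window).
    The fields are only given at nonnegative times, with local bounds: periodicity
    reduces the times to a compact box away from the boundary
    (regular_field_exists).

    Limits (limit_run).  By compactness the estimate gives a common Lipschitz bound, up to
    eps, on flows in a compact set (speed).  Along an ultrafilter, trajectories
    over a bounded horizon then converge pointwise; the limit is Lipschitz, and the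
    estimate above identifies its derivative almost everywhere, so that it is a
    trajectory of the average system.  An ultrafilter makes the number of jumps, the
    jump times, the flows and the jumps converge at once.

    Stability.  Suppose that the estimate with the bound beta of the average
    system, slightly relaxed, fails over a horizon T for arbitrarily small eps.  Stopping
    the trajectories soon after the estimate fails for the first time keeps them in a
    compact set (first_violation), and their limit contradicts the estimate for the
    average system (finite_horizon).  Over a long horizon the bound beta becomes smaller
    than nu, and the trajectory, which is then in a small sublevel set of omega,
    can be restarted from there (infinite_horizon). *)

Set Implicit Arguments.
Unset Strict Implicit.
Unset Printing Implicit Defensive.

Import Order.TTheory GRing.Theory Num.Theory.
Import numFieldNormedType.Exports.

Local Open Scope classical_set_scope.
Local Open Scope ring_scope.

(** * Almost everywhere differentiability of Lipschitz functions *)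

Lemma ae_imply (R : realType) (P Q : R -> Prop) :
  (forall x, P x -> Q x) ->
  {ae (@lebesgue_measure R), forall x, P x} ->
  {ae (@lebesgue_measure R), forall x, Q x}.
Proof.
move=> PQ; apply: filterS PQ.
exact: (ae_filter_ringOfSetsType (@lebesgue_measure R)).
Qed.

Section LipschitzDerivable.
Variables (R : realType) (h : R -> R) (L : R).
Hypothesis h_nd : {homo h : x y / x <= y}.
Hypothesis h_lip : forall x y, x <= y -> h y - h x <= L * (y - x).
Hypothesis L0 : 0 <= L.

Let mu := @lebesgue_measure R.

Let h_rc : right_continuous h.
Proof.
apply: right_continuousW => x; apply/cvgrPdist_le => e e0.
near=> t; rewrite (@le_trans _ _ (L * `|x - t|))//.
  have [xt|/ltW tx] := leP x t.
    rewrite distrC ger0_norm ?subr_ge0 ?h_nd// distrC ger0_norm ?subr_ge0//.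
    exact: h_lip.
  by rewrite ger0_norm ?subr_ge0 ?h_nd// ger0_norm ?subr_ge0//; exact: h_lip.
rewrite (@le_trans _ _ ((L + 1) * `|x - t|))//.
  by rewrite ler_wpM2r// lerDl.
rewrite mulrC -ler_pdivlMr ?ltr_wpDl//.
near: t; apply: (@cvgr_dist_le _ _ _ (nbhs x) _ id x); first exact: cvg_id.
by rewrite divr_gt0// ltr_wpDl.
Unshelve. all: by end_near. Qed.

HB.instance Definition _ := isCumulative.Build R _ R h h_nd h_rc.

Let nu := lebesgue_stieltjes_measure h.

Let nu_dom : nu `<< mu.
Proof.
apply/null_content_dominatesP => A mA A0.
apply/eqP; rewrite eq_le measure_ge0 andbT.
apply/lee_addgt0Pr => e e0; rewrite add0e.
have d0 : 0 < e / (L + 1) by rewrite divr_gt0// ltr_wpDl.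
have : (mu A \is a fin_num)%E by rewrite (_ : mu A = 0%E).
move/lb_ereal_inf_adherent => /(_ _ d0)[_ [F cF <-]].
rewrite [X in (_ < X + _)%E](_ : _ = 0%E)// add0e => Fe.
apply: (@le_trans _ _ (\sum_(k <oo) wlength h (F k))%E).
  by apply: ereal_inf_lbound; exists F.
apply: (@le_trans _ _ (\sum_(k <oo) L%:E * wlength idfun (F k))%E).
  apply: lee_nneseries => [k _ _|k _]; first exact: (wlength_ge0 h).
  case: cF => /(_ k)[[a b] _ <-] _ /=.
  have [ba|/ltW ab] := leP b a.
    by rewrite set_itv_ge ?bnd_simp -?leNgt// !wlength0 mule0.
  by rewrite !wlength_itv_bnd//= -EFinM lee_fin h_lip.
rewrite nneseriesZl => [|k _]; last exact: (wlength_ge0 idfun).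
apply: (@le_trans _ _ (L%:E * (e / (L + 1))%:E)%E).
  by apply: lee_wpmul2l; rewrite ?lee_fin// ltW.
rewrite -EFinM lee_fin mulrCA ler_piMr ?(ltW e0)// ler_pdivrMr ?ltr_wpDl//.
by rewrite mul1r lerDl.
Qed.

(** The Stieltjes measure of [h] is dominated by the Lebesgue measure, because
    [h] is Lipschitz; its Radon-Nikodym density is integrated by [h], and
    differentiates it almost everywhere by the Lebesgue differentiation theorem. *)
Lemma monotone_lipschitz_derivable (a b : R) :
  {ae mu, forall t, a < t < b -> derivable h t 1}.
Proof.
have [ba|ab] := leP b a.
  by apply: aeW => t /andP[at_ /(lt_trans at_)]; rewrite ltNge ba.
have mab : measurable (`]a, b]%classic : set (measurableTypeR R)).
  exact: measurable_itv.
have nuE c d : c <= d -> nu `]c, d]%classic = (h d - h c)%:E.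
  move=> cd; rewrite /nu /lebesgue_stieltjes_measure /measure_extension.
  rewrite measurable_mu_extE/=; last exact: is_ocitv.
  by rewrite wlength_itv_bnd.
have nuoo : (nu `]a, b]%classic < +oo)%E by rewrite nuE ?ltW// ltry.
pose nu' : {finite_measure set (measurableTypeR R) -> \bar R} :=
  mfrestr mab nuoo.
have dom' : nu' `<< mu.
  apply/null_content_dominatesP => A mA A0; rewrite /nu' /= /mfrestr /mrestr.
  move/null_content_dominatesP : nu_dom => /(_ A mA A0) nA0.
  apply/eqP; rewrite eq_le measure_ge0 andbT -nA0.
  by apply: le_measure; rewrite ?inE//; exact: measurableI.
have [g [g0 gfin ig nug]] := radon_nikodym_sigma_finite dom'.
pose f := fine \o g.
have fE : EFin \o f = g by apply/funext => x /=; rewrite /f/= fineK.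
have intf (A : set R) : measurable A -> mu.-integrable A (EFin \o f).
  by move=> mA; rewrite fE; apply: integrableS ig.
have locf : locally_integrable [set: R] f.
  by apply: open_integrable_locally; [exact: openT|exact: intf].
have := @FTC1 R f (BRight a) (fun y => intf _ (measurable_itv _)) locf.
apply: ae_imply => t /= Ft /andP[at_ tb].
have /Ft[dF _] : (BRight a < BRight t)%O by rewrite bnd_simp.
have hE : \forall x \near t,
    (\int[mu]_(s in `]a, x]) f s)%R + h a = h x.
  have tab : t \in `]a, b[ by rewrite in_itv/= at_ tb.
  apply: filterS (near_in_itvoo tab) => x; rewrite in_itv/= => /andP[ax xb].
  have : nu' `]a, x]%classic = (h x - h a)%:E.
    rewrite /nu' /= /mfrestr /mrestr -nuE ?ltW//; congr (nu _).
    apply/seteqP; split => y /=; rewrite !in_itv/=; first by case.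
    by move=> /andP[ay yx]; split; rewrite ?ay ?yx// (le_trans yx) ?ltW.
  rewrite nug// => gE; rewrite /Rintegral.
  rewrite (_ : (\int[mu]_(s in `]a, x]) (f s)%:E)%E = (h x - h a)%:E).
    by rewrite /= subrK.
  by rewrite -[RHS]gE; apply: eq_integral => y _; rewrite -fE.
apply: near_eq_derivable hE _.
by apply: derivableD; [exact: dF|exact: derivable_cst].
Qed.

End LipschitzDerivable.

(** Adding a large multiple of the identity makes a Lipschitz function monotone. *)
Lemma lipschitz_ae_derivable (R : realType) (f : R -> R) (L : R) (a b : R) :
  (forall x y, `|f x - f y| <= L * `|x - y|) ->
  {ae (@lebesgue_measure R), forall t, a < t < b -> derivable f t 1}.
Proof.
move=> fL.
have L0 : 0 <= L.
  by have := le_trans (normr_ge0 _) (fL 0 1); rewrite sub0r normrN1 mulr1.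
have fLle x y : x <= y -> `|f y - f x| <= L * (y - x).
  by move=> xy; have := fL y x; rewrite (@ger0_norm _ (y - x)) ?subr_ge0.
pose h t := f t + L * t.
have h_nd : {homo h : x y / x <= y}.
  move=> x y xy; rewrite -subr_ge0 /h.
  by have := fLle _ _ xy; rewrite ler_norml => /andP[+ _]; lra.
have h_lip x y : x <= y -> h y - h x <= (L + L) * (y - x).
  move=> xy; rewrite /h; have := fLle _ _ xy.
  rewrite ler_norml => /andP[_]; lra.
have := monotone_lipschitz_derivable h_nd h_lip (addr_ge0 L0 L0) a b.
apply: ae_imply => t ht /ht dh.
rewrite (_ : f = h - (fun t => L * t)); last first.
  by apply/funext => x; rewrite /h !fctE addrK.
apply: derivableB; first exact: dh.
by apply: derivableM; [exact: derivable_cst|exact: derivable_id].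
Qed.

(** * A mean value inequality for absolutely continuous functions *)

(** Compactness of a segment, in the form of an induction: look at the supremum of
    the points of the segment that satisfy [P]. *)
Lemma cousin_induction (R : realType) (a b : R) (P : R -> Prop) :
  a <= b -> P a ->
  (forall c, a <= c <= b -> exists2 r, 0 < r & forall u v,
     [/\ a <= u, u <= c, c <= v & v <= b] -> c - r < u -> v < c + r ->
     P u -> P v) ->
  P b.
Proof.
move=> ab Pa step; pose S := [set t | a <= t <= b /\ P t].
have Sa : S a by split; rewrite ?lexx.
have supS : has_sup S by split; [exists a|exists b => t [/andP[]]].
have ac : a <= sup S by apply: sup_upper_bound Sa.
have cb : sup S <= b by apply: ge_sup; [exists a|move=> t [/andP[]]].
have [|r r0 cr] := step (sup S); first by rewrite ac.
have [u [/andP[au ub] Pu] uc] := sup_adherent r0 supS.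
have us : u <= sup S by apply: sup_upper_bound => //; split=> //; rewrite au.
pose v := Num.min b (sup S + r / 2).
have sv : sup S <= v by rewrite le_min cb lerDl divr_ge0// ltW.
have vb : v <= b by rewrite ge_min lexx.
have vr : v < sup S + r.
  by rewrite gt_min; apply/orP; right; rewrite ltrD2l ltr_pdivrMr// ltr_pMr ?ltr1n.
have Pv : P v by apply: (cr u).
have : v <= sup S.
  by apply: sup_upper_bound => //; split=> //; rewrite vb (le_trans ac).
rewrite ge_min => /orP[bs|]; last first.
  by rewrite gerDl leNgt divr_gt0.
suff -> : b = v by [].
by apply/eqP; rewrite eq_le vb (le_trans bs).
Qed.

Definition convex_in (R : realType) (n : nat) (Q : set 'rV[R]_n) :=
  forall p q (s t : R), Q p -> Q q -> 0 <= s -> 0 <= t -> s + t = 1 ->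
    Q (s *: p + t *: q).

Lemma convex_in_comb (R : realType) (n : nat) (Q : set 'rV[R]_n) p q (s t : R) :
  convex_in Q -> Q p -> Q q -> 0 <= s -> 0 <= t ->
  exists2 w, Q w & (s + t) *: w = s *: p + t *: q.
Proof.
move=> cQ Qp Qq s0 t0; have [st0|st0] := eqVneq (s + t) 0.
  exists p => //; have /eqP := st0; rewrite paddr_eq0// => /andP[/eqP -> /eqP ->].
  by rewrite addr0 !scale0r addr0.
exists ((s / (s + t)) *: p + (t / (s + t)) *: q).
  by apply: cQ => //; rewrite ?divr_ge0 ?addr_ge0// -mulrDl divff.
by rewrite scalerDr !scalerA; congr (_ *: _ + _ *: _); field.
Qed.

Section MeanValue.
Variables (R : realType) (n : nat).
Notation mu := (@lebesgue_measure R).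
Implicit Types (f : R -> 'rV[R]_n) (l : seq (R * R)).

Let below a t l := all (fun p : R * R => [&& a <= p.1, p.1 <= p.2 & p.2 <= t]) l.
Let stacked l := pairwise (fun p q : R * R => q.2 <= p.1) l.

(* The intervals in [l] are the ones used to cross the exceptional set: they are
   ordered, hence disjoint, and their total length is at most the measure of [U]. *)
Let stacked_measure (U : set R) a t l :
  open U -> below a t l -> stacked l ->
  (forall p, p \in l -> `]p.1, p.2[%classic `<=` U) ->
  trivIset [set: 'I_(size l)]
    (fun k => `](nth (a, a) l k).1, (nth (a, a) l k).2[%classic) /\
  ((\sum_(k < size l) ((nth (a, a) l k).2 - (nth (a, a) l k).1))%:E
     <= mu U)%E.
Proof.
move=> oU bl sl lU.
have tr : trivIset [set: 'I_(size l)]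
    (fun k => `](nth (a, a) l k).1, (nth (a, a) l k).2[%classic).
  apply/trivIsetP => i j _ _ ij.
  wlog ltij : i j ij / (i < j)%N.
    move=> H; have : i != j :> nat by [].
    rewrite neq_ltn => /orP[|ji]; first exact: H.
    by rewrite setIC; apply: H => //; rewrite eq_sym.
  have := pairwiseP (a, a) sl; move=> /(_ i j (ltn_ord i) (ltn_ord j) ltij) ji.
  rewrite -subset0 => x /=; rewrite !in_itv/= => -[/andP[ix _] /andP[_ xj]].
  by have := lt_le_trans (lt_trans ix xj) ji; rewrite ltxx.
split => //.
have lek (k : 'I_(size l)) : (nth (a, a) l k).1 <= (nth (a, a) l k).2.
  by have /allP/(_ _ (mem_nth (a, a) (ltn_ord k)))/and3P[] := bl.
have := @measure_bigsetU_ord _ _ _ mu _ xpredT _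
  (fun k => measurable_itv `](nth (a, a) l k).1, (nth (a, a) l k).2[) tr.
rewrite -sumEFin => mE.
rewrite (_ : (\sum_(k < size l) _)%E =
   (\sum_(k < size l) mu `](nth (a, a) l k).1, (nth (a, a) l k).2[%classic)%E).
  rewrite -mE; apply: le_measure; rewrite ?inE.
  - by apply: bigsetU_measurable => i _; exact: measurable_itv.
  - exact: measurable_realfun.open_measurable.
  - elim/big_ind: _ => [|A B AU BU|i _ x xi]; first exact: sub0set.
      by rewrite subUset.
    by apply: (lU (nth (a, a) l i)) => //; exact: mem_nth.
apply: eq_bigr => k _; rewrite lebesgue_measure_itv/= lte_fin.
case: ltP => // kk.
by apply/eqP; rewrite eqe subr_eq0 eq_le kk lek.
Qed.

(** Cousin induction from [a] to [b].  Across a point where the derivative is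
    known, the increment is added to a convex combination of derivatives.  The
    other points form a null set, covered by an open set of small measure: the
    increments across them are collected in the list [l], where absolute
    continuity bounds their sum, and they are replaced by displacements along an
    arbitrary [q0] in [Q]. *)
Lemma mean_value_convex f (Q : set 'rV[R]_n) (a b eta : R) :
  a <= b -> 0 <= eta -> abs_continuous_on f a b -> Q !=set0 -> convex_in Q ->
  {ae mu, forall t, a < t < b -> exists2 q, Q q &
     \forall s \near t, `|f s - f t - (s - t) *: q| <= eta * `|s - t|} ->
  forall e, 0 < e -> exists2 q, Q q &
    `|f b - f a - (b - a) *: q| <= eta * (b - a) + e.
Proof.
move=> ab eta0 acf [q0 Qq0] cQ aef e e0.
have [d d0 acd] := acf (e / 2) (divr_gt0 e0 (@ltr0n R 2)).
pose N := ~` [set t | a < t < b -> exists2 q, Q q &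
     \forall s \near t, `|f s - f t - (s - t) *: q| <= eta * `|s - t|]
  `|` [set a; b].
have /negligible_outer_measure N0 : mu.-negligible N.
  apply: negligibleU; first exact: aef.
  apply/negligibleP; first by apply: measurableU; exact: measurable_set1.
  apply: countable_lebesgue_measure0; apply: finite_set_countable.
  exact: finite_set2.
have q1 : 0 < `|q0| + 1 by rewrite ltr_wpDl.
pose d' := Num.min (d / 2) (e / 2 / (`|q0| + 1)).
have d'0 : 0 < d' by rewrite lt_min !divr_gt0.
have [U [oU NU]] := outer_measure_open_le N d'0.
rewrite N0 add0e => muU.
pose S l := \sum_(p <- l) ((f p.2 - f p.1) - (p.2 - p.1) *: q0).
pose P t := exists l, [/\ below a t l, stacked l,
   (forall p, p \in l -> `]p.1, p.2[%classic `<=` U) &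
   exists2 q, Q q & `|f t - f a - (t - a) *: q - S l| <= eta * (t - a)].
have : P b.
  apply: (cousin_induction ab) => [|c /andP[ac cb]].
    exists [::]; split => //; exists q0 => //.
    by rewrite !subrr scale0r subrr /S big_nil subr0 normr0 mulr0.
  have [Nc|nNc] := pselect (N c).
    have /oU/nbhs_ballP[r /= r0 rU] : U c by exact: NU.
    exists r => // u v [au uc cv vb] cu vc [l [bl sl lU [q Qq fq]]].
    have uv := le_trans uc cv.
    have [w Qw wE] : exists2 w, Q w &
        (u - a + (v - u)) *: w = (u - a) *: q + (v - u) *: q0.
      by apply: convex_in_comb => //; rewrite subr_ge0.
    exists ((u, v) :: l); split.
    - rewrite /below /= au uv lexx /=; apply/allP => p.
      move/(allP bl) => /and3P[-> -> pu]; exact: le_trans uv.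
    - rewrite /stacked /= -/(stacked l) sl andbT; apply/allP => p.
      by move/(allP bl) => /and3P[_ _].
    - move=> p; rewrite inE => /predU1P[->|]; last exact: lU.
      move=> x /=; rewrite in_itv/= => /andP[ux xv]; apply: rU.
      by rewrite /ball/= ltr_distl; apply/andP; split; lra.
    - exists w => //; rewrite /S big_cons -/(S l) /=.
      rewrite (_ : _ - _ = f u - f a - (u - a) *: q - S l).
        by apply: (le_trans fq); rewrite ler_wpM2l// lerD2r.
      move: wE; rewrite (_ : u - a + (v - u) = v - a); last by ring.
      by move=> ->; apply/rowP => i; rewrite !mxE; ring.
  have [acb [q Qq]] : a < c < b /\ exists2 q, Q q &
     \forall s \near c, `|f s - f c - (s - c) *: q| <= eta * `|s - c|.
    have acb : a < c < b.
      rewrite !lt_neqAle ac cb !andbT; apply/andP; split; apply/eqP => h;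
        apply: nNc; right; [left|right]; exact/esym.
    split=> //; apply: contrapT => H; apply: nNc; left.
    by move=> /(_ acb).
  move=> /nbhs_ballP[r /= r0 rq]; exists r => //.
  move=> u v [au uc cv vb] cu vc [l [bl sl lU [p Qp fp]]].
  have uv := le_trans uc cv.
  have [w Qw wE] : exists2 w, Q w &
      (u - a + (v - u)) *: w = (u - a) *: p + (v - u) *: q.
    by apply: convex_in_comb => //; rewrite subr_ge0.
  exists l; split => //.
    by apply/allP => x /(allP bl)/and3P[-> -> xu]; exact: le_trans uv.
  exists w => //.
  have fv : `|f v - f c - (v - c) *: q| <= eta * (v - c).
    have := rq v; rewrite /ball/= [`|v - c|]ger0_norm ?subr_ge0//; apply.
    by rewrite ltr_distl; apply/andP; split; lra.
  have fu : `|f u - f c - (u - c) *: q| <= eta * (c - u).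
    have := rq u; rewrite /ball/= [`|u - c|]distrC [`|c - u|]ger0_norm ?subr_ge0//.
    by apply; lra.
  rewrite (_ : _ - S l = (f u - f a - (u - a) *: p - S l) +
     ((f v - f c - (v - c) *: q) - (f u - f c - (u - c) *: q))); last first.
    move: wE; rewrite (_ : u - a + (v - u) = v - a); last by ring.
    by move=> ->; apply/rowP => i; rewrite !mxE; ring.
  apply: le_trans (ler_normD _ _) _.
  apply: (@le_trans _ _ (eta * (u - a) + (eta * (v - c) + eta * (c - u)))).
    apply: lerD => //; apply: le_trans (ler_normB _ _) _; exact: lerD.
  by rewrite -!mulrDr ler_wpM2l//; lra.
move=> [l [bl sl lU [q Qq fq]]]; exists q => //.
have [tr muS] := stacked_measure oU bl sl lU.
set K := \sum_(k < size l) _ in muS.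
have lK : K <= d' by rewrite -lee_fin (le_trans muS).
have SK : `|S l| <= e / 2 + K * `|q0|.
  rewrite /S (big_nth (a, a)) big_mkord.
  apply: le_trans (ler_norm_sum _ _ _) _.
  apply: (@le_trans _ _ (\sum_(k < size l)
     (`|f (nth (a, a) l k).2 - f (nth (a, a) l k).1| +
      ((nth (a, a) l k).2 - (nth (a, a) l k).1) * `|q0|))).
    apply: ler_sum => k _; apply: le_trans (ler_normB _ _) _.
    rewrite lerD2l normrZ ger0_norm// subr_ge0.
    by have /allP/(_ _ (mem_nth (a, a) (ltn_ord k)))/and3P[] := bl.
  rewrite big_split/= -mulr_suml lerD2r ltW//.
  apply: (acd _ (fun k => (nth (a, a) l k).1) (fun k => (nth (a, a) l k).2)).
  - by move=> k; have /allP/(_ _ (mem_nth (a, a) (ltn_ord k)))/and3P[] := bl.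
  - exact: tr.
  - apply: (le_lt_trans lK); rewrite gt_min; apply/orP; left.
    by rewrite ltr_pdivrMr// ltr_pMr// ltr1n.
rewrite -[X in `|X|](subrK (S l)); apply: le_trans (ler_normD _ _) _.
apply: lerD => //; apply: (le_trans SK).
have : d' * `|q0| <= e / 2.
  apply: (@le_trans _ _ (e / 2 / (`|q0| + 1) * `|q0|)).
    by rewrite ler_wpM2r// ge_min lexx orbT.
  rewrite -mulrA ler_piMr ?divr_ge0 ?(ltW e0)//.
  by rewrite mulrC ler_pdivrMr// mul1r lerDl.
have : K * `|q0| <= d' * `|q0| by rewrite ler_wpM2r.
lra.
Qed.

End MeanValue.

Lemma rV_coord_le (R : realType) (n : nat) (x : 'rV[R]_n) i : `|x 0 i| <= `|x|.
Proof.
rewrite [leRHS]mx_normrE.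
exact: (@le_bigmax_cond _ _ _ _ (0, i) xpredT (fun i => `|x i.1 i.2|)).
Qed.

Lemma rV_norm_le (R : realType) (n : nat) (x : 'rV[R]_n) c :
  0 <= c -> (forall i, `|x 0 i| <= c) -> `|x| <= c.
Proof.
move=> c0 xc; rewrite [leLHS]mx_normrE; apply: bigmax_le => // -[i j] _ /=.
by rewrite (ord1 i).
Qed.

Lemma continuousP (R : realType) (V : normedModType R) (f : R -> V) :
  continuous f <-> forall c e, 0 < e ->
    exists2 r, 0 < r & forall s, `|s - c| < r -> `|f s - f c| <= e.
Proof.
split=> [cf c e e0|H c].
  have /cvgrPdist_le/(_ _ e0)/nbhs_ballP[r /= r0 rP] := cf c.
  exists r => // s sr; rewrite distrC; apply: rP.
  by rewrite /ball/= distrC.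
apply/cvgrPdist_le => e e0; have [r r0 rP] := H c e e0.
apply/nbhs_ballP; exists r => //= s; rewrite /ball/= => sr.
by rewrite distrC; apply: rP; rewrite distrC.
Qed.

Lemma cousin_lipschitz (R : realType) (n : nat) (f : R -> 'rV[R]_n) (a b eta : R) :
  a <= b ->
  (forall c, a <= c <= b -> exists2 r, 0 < r & forall u v,
     [/\ a <= u, u <= c, c <= v & v <= b] -> c - r < u -> v < c + r ->
     `|f v - f u| <= eta * (v - u)) ->
  `|f b - f a| <= eta * (b - a).
Proof.
move=> ab H; apply: (@cousin_induction _ a b (fun t => `|f t - f a| <= eta * (t - a))).
- exact: ab.
- by rewrite !subrr normr0 mulr0.
- move=> c /H[r r0 rP]; exists r => // u v uv cu vc fu.
  rewrite -(subrKA (f u)); apply: le_trans (ler_normD _ _) _.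
  apply: le_trans (lerD (rP _ _ uv cu vc) fu) _.
  by rewrite -mulrDr subrKA.
Qed.

Lemma le_forall_eps (R : realType) (x y c : R) :
  0 <= c -> (forall e, 0 < e -> x <= y + e * c) -> x <= y.
Proof.
move=> c0 H; apply/ler_addgt0Pr => e e0.
apply: le_trans (H (e / (c + 1)) _) _; first by rewrite divr_gt0// ltr_wpDl.
rewrite lerD2l mulrAC ler_pdivrMr ?ltr_wpDl//.
by apply: ler_wpM2l; rewrite ?lerDl// ltW.
Qed.

(** * Integrals of continuous and of periodic functions *)

Section VInt.
Variables (R : realType) (n : nat).
Notation mu := (@lebesgue_measure R).
Implicit Types (f g : R -> 'rV[R]_n).

Lemma continuous_coord f i : continuous f -> continuous (fun s => f s 0 i).
Proof.
move=> /continuousP cf; apply/continuousP => c e e0.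
have [r r0 rP] := cf c e e0; exists r => // s sr.
have := le_trans (rV_coord_le (f s - f c) i) (rP s sr).
by rewrite !mxE.
Qed.

Lemma coord_integrable f a b i : continuous f ->
  mu.-integrable `[a, b] (EFin \o (fun s => f s 0 i)).
Proof.
move=> cf; apply: continuous_compact_integrable; first exact: segment_compact.
exact/continuous_subspaceT/continuous_coord.
Qed.

Lemma eq_vint f g a b : (forall s, a <= s <= b -> f s = g s) ->
  vint a b f = vint a b g.
Proof.
move=> fg; apply/rowP => i; rewrite !mxE; apply: eq_Rintegral => s.
by rewrite inE/= in_itv/= => /fg ->.
Qed.

Lemma vintD f g a b : continuous f -> continuous g ->
  vint a b (fun s => f s + g s) = vint a b f + vint a b g.
Proof.
move=> cf cg; apply/rowP => i; rewrite !mxE.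
rewrite -RintegralD//; [|exact: coord_integrable..].
by apply: eq_Rintegral => s _; rewrite mxE.
Qed.

Lemma vintZ k f a b : continuous f ->
  vint a b (fun s => k *: f s) = k *: vint a b f.
Proof.
move=> cf; apply/rowP => i; rewrite !mxE.
rewrite -RintegralZl//; last exact: coord_integrable.
by apply: eq_Rintegral => s _; rewrite mxE.
Qed.

Lemma vintB f g a b : continuous f -> continuous g ->
  vint a b (fun s => f s - g s) = vint a b f - vint a b g.
Proof.
move=> cf cg; apply/rowP => i; rewrite !mxE.
rewrite -RintegralB//; [|exact: coord_integrable..].
by apply: eq_Rintegral => s _; rewrite !mxE.
Qed.

Lemma vint_cst c a b : a <= b -> vint a b (fun=> c) = (b - a) *: (c : 'rV[R]_n).
Proof.
move=> ab; apply/rowP => i; rewrite !mxE Rintegral_cst//.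
rewrite [X in fine X](_ : _ = (b - a)%:E); first exact: mulrC.
have := lebesgue_measure_itv `[a, b]; rewrite /= lte_fin => ->.
case: ltP => //= ba; rewrite (_ : b = a) ?subrr//.
by apply/eqP; rewrite eq_le ab ba.
Qed.

Lemma vint_itv_cat f a b c : continuous f -> a <= b -> b <= c ->
  vint a c f = vint a b f + vint b c f.
Proof.
move=> cf ab bc; apply/rowP => i; rewrite !mxE.
have H := @Rintegral_itvB R (fun s => f s 0 i) (BLeft a) (BRight c) b
  (coord_integrable _ _ _ cf).
rewrite -(Rintegral_itv_obnd_cbnd (r := b)); last first.
  apply: integrableS (coord_integrable b c i cf) => //.
  by apply: subset_itvr; rewrite bnd_simp.
by rewrite -H ?bnd_simp// addrC subrK.
Qed.

Lemma vintxx f a : vint a a f = 0.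
Proof. by apply/rowP => i; rewrite !mxE set_itv1 Rintegral_set1. Qed.

Lemma vint_gt f a b : b < a -> vint a b f = 0.
Proof.
by move=> ba; apply/rowP => i; rewrite !mxE set_itv_ge ?Rintegral_set0// bnd_simp -ltNge.
Qed.

Lemma vint_norm_le f a b M : continuous f -> a <= b ->
  (forall s, a <= s <= b -> `|f s| <= M) -> `|vint a b f| <= M * (b - a).
Proof.
move=> cf ab fM.
have M0 : 0 <= M by apply: le_trans (normr_ge0 _) (fM a _); rewrite lexx ab.
apply: rV_norm_le => [|i]; first by rewrite mulr_ge0// subr_ge0.
rewrite mxE; apply: le_trans (le_normr_Rintegral _ _) _ => //.
  exact: coord_integrable.
apply: (@le_trans _ _ (\int[mu]_(s in `[a, b]) M)%R).
  apply: le_Rintegral => //.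
  - have := coord_integrable a b i cf; move=> /integrable_norm.
    by apply: eq_integrable.
  - apply: continuous_compact_integrable; first exact: segment_compact.
    by apply: continuous_subspaceT => x; exact: cvg_cst.
  - move=> s; rewrite /= in_itv/= => /fM; apply: le_trans.
    exact: rV_coord_le.
by have := vint_cst (const_mx M) ab => /rowP/(_ i); rewrite !mxE mulrC => <-.
Qed.

End VInt.

Lemma lt_subr_min (R : realType) (c r1 r2 u : R) :
  c - Num.min r1 r2 < u -> c - r1 < u /\ c - r2 < u.
Proof.
have [h1 h2] : Num.min r1 r2 <= r1 /\ Num.min r1 r2 <= r2.
  by rewrite !ge_min !lexx orbT.
by move=> h; split; lra.
Qed.

Lemma lt_addr_min (R : realType) (c r1 r2 v : R) :
  v < c + Num.min r1 r2 -> v < c + r1 /\ v < c + r2.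
Proof.
have [h1 h2] : Num.min r1 r2 <= r1 /\ Num.min r1 r2 <= r2.
  by rewrite !ge_min !lexx orbT.
by move=> h; split; lra.
Qed.

Section Primitive.
Variables (R : realType) (n : nat).
Implicit Types (f g w : R -> 'rV[R]_n).

Lemma vint_straddle f c e : continuous f -> 0 < e ->
  exists2 r, 0 < r & forall u v, u <= c -> c <= v -> c - r < u -> v < c + r ->
    `|vint u v f - (v - u) *: f c| <= e * (v - u).
Proof.
move=> cf e0; have /continuousP/(_ c e e0)[r r0 rP] := cf.
exists r => // u v uc cv ru vr; have uv := le_trans uc cv.
rewrite -vint_cst// -(vintB _ _ cf (@cst_continuous _ _ _)).
apply: vint_norm_le => //.
  by move=> x; apply: continuousB; [exact: cf|exact: cst_continuous].
move=> s /andP[us sv]; apply: rP.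
by rewrite ltr_distl; apply/andP; split; lra.
Qed.

Lemma vint_derivative f c e : continuous f -> 0 <= c -> 0 < e ->
  exists2 r, 0 < r & forall s, 0 <= s -> `|s - c| < r ->
    `|vint 0 s f - vint 0 c f - (s - c) *: f c| <= e * `|s - c|.
Proof.
move=> cf c0 e0; have [r r0 rP] := vint_straddle c cf e0.
exists r => // s s0; rewrite ltr_distl => /andP[cs sc].
have [sc'|/ltW cs'] := leP s c.
  rewrite (vint_itv_cat cf s0 sc').
  rewrite (_ : _ - _ = - (vint s c f - (c - s) *: f c)); last first.
    by apply/rowP => i; rewrite !mxE; ring.
  rewrite normrN [`|s - c|]distrC [`|c - s|]ger0_norm ?subr_ge0//.
  by apply: rP; rewrite // ltrDl.
rewrite (vint_itv_cat cf c0 cs') [vint 0 c f + _]addrC addrK.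
rewrite [`|s - c|]ger0_norm ?subr_ge0//.
by apply: rP => //; rewrite gtrBl.
Qed.

(** The derivative of [F] is only known pointwise on the segment: the difference
    between [F] and the integral has arbitrarily small slopes near every point. *)
Lemma vint_FTC2 F w a b : a <= b -> continuous w ->
  (forall c e, a <= c <= b -> 0 < e -> exists2 r, 0 < r &
     forall s, a <= s <= b -> `|s - c| < r ->
       `|F s - F c - (s - c) *: w c| <= e * `|s - c|) ->
  vint a b w = F b - F a :> 'rV[R]_n.
Proof.
move=> ab cw HF.
suff : `|(F b - vint a b w) - (F a - vint a a w)| <= 0.
  rewrite normr_le0 vintxx subr0 addrAC subr_eq0 => /eqP ->; by [].
apply: (le_forall_eps (c := (1 + 1) * (b - a))) => [|e e0].
  by rewrite mulr_ge0// subr_ge0.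
rewrite add0r mulrA.
apply: (@cousin_lipschitz _ _ (fun t => F t - vint a t w)) => //.
move=> c cab; have [r1 r10 r1P] := HF c e cab e0.
have [r2 r20 r2P] := vint_straddle c cw e0.
exists (Num.min r1 r2); first by rewrite lt_min r10.
move=> u v [au uc cv vb] cu vc.
have [ur1 ur2] : c - r1 < u /\ c - r2 < u.
  exact: lt_subr_min.
have [vr1 vr2] : v < c + r1 /\ v < c + r2.
  exact: lt_addr_min.
have uv := le_trans uc cv.
rewrite (vint_itv_cat cw au uv).
rewrite (_ : _ - _ = (F v - F c - (v - c) *: w c) - (F u - F c - (u - c) *: w c)
   - (vint u v w - (v - u) *: w c)); last first.
  by apply/rowP => i; rewrite !mxE; ring.
have av := le_trans au uv; have ub := le_trans uv vb.
have fv : `|F v - F c - (v - c) *: w c| <= e * (v - c).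
  have := r1P v; rewrite av vb [`|v - c|]ger0_norm ?subr_ge0//; apply => //.
  by rewrite ltrBlDl.
have fu : `|F u - F c - (u - c) *: w c| <= e * (c - u).
  have := r1P u; rewrite au ub [`|u - c|]distrC [`|c - u|]ger0_norm ?subr_ge0//.
  by apply => //; lra.
apply: le_trans (ler_normB _ _) _.
apply: le_trans (lerD (le_trans (ler_normB _ _) (lerD fv fu)) (r2P u v uc cv ur2 vr2)) _.
by lra.
Qed.

Lemma vint_increment_le f (M s s' : R) : continuous f ->
  (forall a, `|f a| <= M) -> `|vint 0 s' f - vint 0 s f| <= M * `|s' - s|.
Proof.
move=> cf fM; wlog ss : s s' / s <= s' => [H|].
  have [ss|/ltW ss] := leP s s'; first exact: H.
  by rewrite distrC [`|s' - s|]distrC; exact: H.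
have M0 : 0 <= M by apply: le_trans (fM 0).
have fle a b : a <= b -> `|vint a b f| <= M * (b - a).
  by move=> ab; apply: vint_norm_le.
rewrite [`|s' - s|]ger0_norm ?subr_ge0//.
have [s'0|s'0] := ltP s' 0.
  rewrite !vint_gt// ?(le_lt_trans ss)// subrr normr0.
  by apply: mulr_ge0; rewrite ?subr_ge0.
have [s0|s0] := ltP s 0.
  rewrite (vint_gt _ s0) subr0; apply: le_trans (fle _ _ s'0) _.
  by rewrite subr0; apply: ler_wpM2l => //; lra.
by rewrite (vint_itv_cat cf s0 ss) addrC addKr; exact: fle.
Qed.

Section Periodic.
Variables (f : R -> 'rV[R]_n) (T : R).
Hypotheses (cf : continuous f) (T0 : 0 < T).
Hypothesis fT : forall s, 0 <= s -> f (s + T) = f s.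
Hypothesis f0 : vint 0 T f = 0.

Lemma periodic_primitive s : 0 <= s -> vint 0 (s + T) f = vint 0 s f.
Proof.
move=> s0; apply/eqP; rewrite -subr_eq0 -normr_le0.
pose H t := vint 0 (t + T) f - vint 0 t f.
have -> : vint 0 (s + T) f - vint 0 s f = H s - H 0.
  by rewrite /H add0r f0 vintxx subrr subr0.
apply: (le_forall_eps (c := (1 + 1) * (s - 0))) => [|e e0].
  by rewrite mulr_ge0// subr0.
rewrite add0r mulrA; apply: cousin_lipschitz => // c /andP[c0 cs].
have [r1 r10 r1P] := vint_straddle c cf e0.
have [r2 r20 r2P] := vint_straddle (c + T) cf e0.
exists (Num.min r1 r2); first by rewrite lt_min r10.
move=> u v [u0 uc cv vs] cu vc.
have [ur1 ur2] : c - r1 < u /\ c - r2 < u.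
  exact: lt_subr_min.
have [vr1 vr2] : v < c + r1 /\ v < c + r2.
  exact: lt_addr_min.
have uv := le_trans uc cv.
rewrite /H (vint_itv_cat (b := u) (c := v) cf u0 uv).
rewrite (vint_itv_cat (b := u + T) (c := v + T) cf) ?lerD2r//; last first.
  by rewrite addr_ge0// ltW.
rewrite (_ : _ - _ = (vint (u + T) (v + T) f - (v - u) *: f c)
   - (vint u v f - (v - u) *: f c)); last first.
  by apply/rowP => i; rewrite !mxE; ring.
apply: le_trans (ler_normB _ _) _.
rewrite [leRHS](_ : _ = e * (v - u) + e * (v - u)); last by ring.
apply: lerD; last exact: r1P.
have := r2P (u + T) (v + T); rewrite !lerD2r fT//.
rewrite (_ : v + T - (u + T) = v - u); last by ring.
by apply => //; lra.
Qed.

Variable M : R.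
Hypothesis fM : forall s, 0 <= s -> `|f s| <= M.

(** Zero mean makes the primitive periodic, so that it is bounded by its values
    on one period. *)
Lemma periodic_primitive_le s : 0 <= s -> `|vint 0 s f| <= M * T.
Proof.
have M0 : 0 <= M by apply: le_trans (normr_ge0 _) (fM (lexx 0)).
have short t : 0 <= t -> t <= T -> `|vint 0 t f| <= M * T.
  move=> t0 tT; apply: (@le_trans _ _ (M * (t - 0))).
    by apply: vint_norm_le => // x /andP[x0 _]; exact: fM.
  by rewrite subr0 ler_wpM2l.
have H (k : nat) t : 0 <= t -> t <= k%:R * T -> `|vint 0 t f| <= M * T.
  elim: k t => [|k IH] t t0 tk.
    by apply: short => //; apply: le_trans tk _; rewrite mul0r ltW.
  have [tT|/ltW Tt] := leP t T; first exact: short.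
  rewrite -(subrK T t) periodic_primitive ?subr_ge0//.
  apply: IH; first by rewrite subr_ge0.
  by rewrite lerBlDr; move: tk; rewrite -natr1 mulrDl mul1r.
move=> s0; apply: (H (Num.truncn (s / T)).+1) => //.
by rewrite -ler_pdivrMr// ltW// truncnS_gt.
Qed.

End Periodic.
End Primitive.

(** * Slow and fast time: regularity of the fields *)

Lemma prod_norm_le (R : realType) (V W : normedModType R) (a : V) (b : W) :
  `|(a, b)| <= `|a| + `|b|.
Proof. by rewrite prod_normE/= ge_max lerDl lerDr !normr_ge0. Qed.

Lemma prod_norm_fst (R : realType) (V W : normedModType R) (h : V * W) :
  `|h.1| <= `|h|.
Proof. by rewrite prod_normE/= le_max lexx. Qed.

Lemma prod_norm_snd (R : realType) (V W : normedModType R) (h : V * W) :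
  `|h.2| <= `|h|.
Proof. by rewrite prod_normE/= le_max lexx orbT. Qed.

Lemma linear_le_small (R : realType) (V W : normedModType R)
    (L : V -> W) (rho c : R) :
  (forall a h, L (a *: h) = a *: L h) -> 0 < rho -> 0 <= c ->
  (forall h, `|h| <= rho -> `|L h| <= c) -> forall h, `|L h| <= c / rho * `|h|.
Proof.
move=> LZ rho0 c0 Lc h; have [->|h0] := eqVneq h 0.
  by have := LZ 0 0; rewrite !scale0r => ->; rewrite !normr0 mulr0.
have nh : 0 < `|h| by rewrite normr_gt0.
set a := rho / `|h|.
have na : `|a| = a by rewrite ger0_norm// divr_ge0// ltW.
have := Lc (a *: h); rewrite LZ (normrZ a h) (normrZ a (L h)) na.
rewrite /a divfK ?lt0r_neq0// lexx => /(_ isT).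
by rewrite mulrAC ler_pdivrMr// mulrC -ler_pdivlMr// mulrAC.
Qed.

Lemma linear_quadratic_eq0 (R : realType) (V W : normedModType R)
    (L : V -> W) (rho c : R) :
  (forall a h, L (a *: h) = a *: L h) -> 0 < rho -> 0 <= c ->
  (forall h, `|h| <= rho -> `|L h| <= c * `|h| ^+ 2) -> forall h, L h = 0.
Proof.
move=> LZ rho0 c0 Lc h; apply/eqP; rewrite -normr_le0.
apply: (le_forall_eps (c := c * `|h|)) => [|e e0]; first by rewrite mulr_ge0.
rewrite add0r mulrA.
pose d := Num.min e rho; have d0 : 0 < d by rewrite lt_min e0.
have := @linear_le_small _ _ _ L d (c * d ^+ 2) LZ d0.
rewrite mulr_ge0 ?exprn_ge0 ?(ltW d0)// => /(_ isT).
have H (h' : V) : `|h'| <= d -> `|L h'| <= c * d ^+ 2.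
  move=> hd; apply: (le_trans (Lc _ _)); first by rewrite (le_trans hd)// ge_min lexx orbT.
  by rewrite ler_wpM2l// lerXn2r// nnegrE// ltW.
move=> /(_ H h)/le_trans; apply; rewrite ler_wpM2r//.
rewrite expr2 mulrA mulfK ?lt0r_neq0// mulrC ler_wpM2r//.
by rewrite ge_min lexx.
Qed.

Section Averaging.
Variables (R : realType) (n1 n2 : nat).
Notation X := 'rV[R]_n1.
Notation Z := 'rV[R]_n2.

(** The local form of the regularity assumption near ([x0], [z0]), for fields of
    [x], [z], the intermediate time [t] and the fast time [s], periodic over all
    times.  The derivative [D] of [p1] in ([x], [t]) is only known through a
    quadratic Taylor remainder, which is stable under changing the base point:
    its size, Lipschitz constant, periodicity and continuity are recovered below
    by comparing expansions. *)
Record regular_field (x0 : X) (z0 : Z) (r k T1 T2 : R)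
    (p1 p2 : X -> Z -> R -> R -> X)
    (D : X -> Z -> R -> R -> {linear (X * R)%type -> X}) : Prop := RegularField {
  rf_r : 0 < r ;
  rf_k : 0 <= k ;
  rf_T1 : 0 < T1 ;
  rf_T2 : 0 < T2 ;
  rf_le1 : forall x z t s, `|x - x0| < r -> `|z - z0| < r -> `|p1 x z t s| <= k ;
  rf_le2 : forall x z t s, `|x - x0| < r -> `|z - z0| < r -> `|p2 x z t s| <= k ;
  rf_z1 : forall x z z' t s, `|x - x0| < r -> `|z - z0| < r -> `|z' - z0| < r ->
    `|p1 x z' t s - p1 x z t s| <= k * `|z' - z| ;
  rf_z2 : forall x z z' t s, `|x - x0| < r -> `|z - z0| < r -> `|z' - z0| < r ->
    `|p2 x z' t s - p2 x z t s| <= k * `|z' - z| ;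
  rf_x2 : forall x x' z t t' s,
    `|x - x0| < r -> `|x' - x0| < r -> `|z - z0| < r -> `|t' - t| < r ->
    `|p2 x' z t' s - p2 x z t s| <= k * `|(x' - x, t' - t)| ;
  rf_D : forall x x' z t t' s,
    `|x - x0| < r -> `|x' - x0| < r -> `|z - z0| < r -> `|t' - t| < r ->
    `|p1 x' z t' s - p1 x z t s - D x z t s (x' - x, t' - t)|
      <= k * `|(x' - x, t' - t)| ^+ 2 ;
  rf_c1 : forall x z t, `|x - x0| < r -> `|z - z0| < r -> continuous (p1 x z t) ;
  rf_c2 : forall x z t, `|x - x0| < r -> `|z - z0| < r -> continuous (p2 x z t) ;
  rf_t1 : forall x z t s, p1 x z (t + T1) s = p1 x z t s ;
  rf_s1 : forall x z t s, p1 x z t (s + T2) = p1 x z t s ;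
  rf_t2 : forall x z t s, p2 x z (t + T1) s = p2 x z t s ;
  rf_s2 : forall x z t s, p2 x z t (s + T2) = p2 x z t s ;
  rf_mean : forall x z t, `|x - x0| < r -> `|z - z0| < r -> vint 0 T2 (p1 x z t) = 0
}.

Variables (x0 : X) (z0 : Z) (r k T1 T2 : R) (p1 p2 : X -> Z -> R -> R -> X).
Variable D : X -> Z -> R -> R -> {linear (X * R)%type -> X}.
Hypothesis RF : regular_field x0 z0 r k T1 T2 p1 p2 D.

(* Points at which increments of size r / 2 stay in the ball of radius r. *)
Notation rho := (r / 4).
Notation nearx x := (`|x - x0| < rho).
Notation nearz z := (`|z - z0| < rho).

Let r0 : 0 < r. Proof. exact: rf_r RF. Qed.
Let k0 : 0 <= k. Proof. exact: rf_k RF. Qed.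
Let rho0 : 0 < rho. Proof. by rewrite divr_gt0. Qed.
Let rho_r : rho < r. Proof. by have := r0; lra. Qed.

Let wide (V : normedModType R) (x y : V) : `|x - y| < rho -> `|x - y| < r.
Proof. by move=> /lt_trans; apply. Qed.

Let near_shift (x : X) (h : X) :
  nearx x -> `|h| <= rho + rho -> `|x + h - x0| < r.
Proof.
move=> xx hh; rewrite addrAC.
by apply: le_lt_trans (ler_normD _ _) _; have := r0; lra.
Qed.

Lemma D_expansion x z t s (h : X * R) : nearx x -> nearz z -> `|h| <= rho + rho ->
  `|p1 (x + h.1) z (t + h.2) s - p1 x z t s - D x z t s h| <= k * `|h| ^+ 2.
Proof.
move=> xx zz hh.
have h1 : `|h.1| <= rho + rho.
  by apply: le_trans hh; exact: prod_norm_fst.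
have h2 : `|h.2| <= rho + rho.
  by apply: le_trans hh; exact: prod_norm_snd.
have := @rf_D _ _ _ _ _ _ _ _ _ RF x (x + h.1) z t (t + h.2) s.
rewrite [_ + _ - x]addrC addKr [_ + _ - t]addrC addKr -surjective_pairing.
apply; [exact: wide|exact: near_shift|exact: wide|].
by apply: le_lt_trans h2 _; have := r0; lra.
Qed.

(** The bound on [D] given by the Taylor remainder with increments of size [rho]. *)
Definition KD := (k + k + k * rho ^+ 2) / rho.

Let DZ x z t s a h : D x z t s (a *: h) = a *: D x z t s h.
Proof. by rewrite linearZ. Qed.

Lemma KD_ge0 : 0 <= KD.
Proof.
apply: divr_ge0; last exact: ltW.
by rewrite !addr_ge0// mulr_ge0// exprn_ge0// ltW.
Qed.

Lemma D_le x z t s h : nearx x -> nearz z -> `|D x z t s h| <= KD * `|h|.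
Proof.
move=> xx zz; apply: (@linear_le_small _ _ _ (D x z t s) rho) => //.
  by rewrite !addr_ge0// mulr_ge0// exprn_ge0// ltW.
move=> {}h hr; have hr2 : `|h| <= rho + rho by have := rho0; lra.
have h1 : `|h.1| <= rho + rho.
  by apply: le_trans hr2; exact: prod_norm_fst.
rewrite -normrN -[- D _ _ _ _ h](addKr (p1 (x + h.1) z (t + h.2) s - p1 x z t s)).
apply: le_trans (ler_normD _ _) _; apply: lerD.
  rewrite normrN; apply: le_trans (ler_normB _ _) _.
  apply: lerD; apply: (rf_le1 RF); [exact: near_shift|exact: wide..].
apply: le_trans (D_expansion t s xx zz hr2) _.
by rewrite ler_wpM2l// lerXn2r// nnegrE// ltW.
Qed.

(** A function with a quadratic Taylor remainder has a Lipschitz derivative: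
    expand at both points the increment between the three points involved. *)
Lemma D_lipschitz x x' z t t' s h : nearx x -> nearx x' -> nearz z ->
  `|(x' - x, t' - t)| <= rho ->
  `|D x z t s h - D x' z t' s h| <= 6 * k * `|(x' - x, t' - t)| * `|h|.
Proof.
move=> xx xx' zz; set d := (x' - x, t' - t) => dr.
have [d0|d0] := eqVneq `|d| 0.
  have /eqP := d0; rewrite normr_eq0 => /eqP[]/eqP; rewrite subr_eq0 => /eqP ->.
  by move/eqP; rewrite subr_eq0 => /eqP ->; rewrite subrr normr0 !mulr_ge0.
have dp : 0 < `|d| by rewrite lt_neqAle eq_sym d0/=.
rewrite (_ : 6 * k * `|d| = (6 * k * `|d| ^+ 2) / `|d|); last first.
  by rewrite expr2 mulrA mulfK.
apply: (@linear_le_small _ _ _ (fun h => D x z t s h - D x' z t' s h)) => //.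
- by move=> a h'; rewrite !DZ scalerBr.
- by rewrite !mulr_ge0.
move=> {}h hd.
have E1 := @D_expansion x z t s h xx zz.
have E2 := @D_expansion x' z t' s (h - d) xx' zz.
have E3 := @D_expansion x' z t' s (- d) xx' zz.
have nhd : `|h - d| <= `|d| + `|d|.
  by apply: le_trans (ler_normB _ _) _; rewrite lerD2r.
have b1 : `|h| ^+ 2 <= `|d| ^+ 2 by rewrite lerXn2r// nnegrE.
have b2 : `|h - d| ^+ 2 <= 4 * `|d| ^+ 2.
  apply: (@le_trans _ _ ((`|d| + `|d|) ^+ 2)).
    by rewrite lerXn2r// nnegrE ?addr_ge0.
  by rewrite (_ : (`|d| + `|d|) ^+ 2 = 4 * `|d| ^+ 2)//; ring.
have {}E1 := E1 ltac:(by have := rho0; lra).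
have {}E2 := E2 ltac:(by have := rho0; lra).
have {}E3 := E3 ltac:(by rewrite normrN; have := rho0; lra).
rewrite normrN in E3.
have e1 : x' + (h - d).1 = x + h.1 by apply/rowP => i; rewrite !mxE; ring.
have e2 : t' + (h - d).2 = t + h.2 by rewrite /d/=; ring.
have e3 : x' + (- d).1 = x by apply/rowP => i; rewrite !mxE; ring.
have e4 : t' + (- d).2 = t by rewrite /d/=; ring.
rewrite e1 e2 in E2; rewrite e3 e4 in E3.
rewrite linearB in E2; rewrite linearN in E3.
set P := p1 (x + h.1) z (t + h.2) s in E1 E2.
rewrite (_ : D x z t s h - D x' z t' s h =
  (P - p1 x' z t' s - (D x' z t' s h - D x' z t' s d))
  - (P - p1 x z t s - D x z t s h)
  - (p1 x z t s - p1 x' z t' s - - D x' z t' s d)); last first.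
  by apply/rowP => i; rewrite !mxE; ring.
apply: le_trans (ler_normB _ _) _.
apply: le_trans (lerD (le_trans (ler_normB _ _) (lerD E2 E1)) E3) _.
rewrite -!mulrDr [6 * k]mulrC -mulrA ler_wpM2l//.
by lra.
Qed.

Lemma D_periodic1 x z t s h : nearx x -> nearz z ->
  D x z (t + T1) s h = D x z t s h.
Proof.
move=> xx zz; apply/eqP; rewrite -subr_eq0; apply/eqP.
apply: (@linear_quadratic_eq0 _ _ _ (fun h => D x z (t + T1) s h - D x z t s h)
  rho (k + k)) => //; first by move=> a h'; rewrite !DZ scalerBr.
  by rewrite addr_ge0.
move=> {}h hr; have hr2 : `|h| <= rho + rho by have := rho0; lra.
have E1 := D_expansion (t + T1) s xx zz hr2.
have E2 := D_expansion t s xx zz hr2.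
rewrite [t + T1 + _]addrAC !(rf_t1 RF) in E1.
rewrite (_ : D x z (t + T1) s h - D x z t s h =
  (p1 (x + h.1) z (t + h.2) s - p1 x z t s - D x z t s h) -
  (p1 (x + h.1) z (t + h.2) s - p1 x z t s - D x z (t + T1) s h)); last first.
  by apply/rowP => i; rewrite !mxE; ring.
by rewrite mulrDl; apply: le_trans (ler_normB _ _) (lerD E2 E1).
Qed.

Lemma D_periodic2 x z t s h : nearx x -> nearz z ->
  D x z t (s + T2) h = D x z t s h.
Proof.
move=> xx zz; apply/eqP; rewrite -subr_eq0; apply/eqP.
apply: (@linear_quadratic_eq0 _ _ _ (fun h => D x z t (s + T2) h - D x z t s h)
  rho (k + k)) => //; first by move=> a h'; rewrite !DZ scalerBr.
  by rewrite addr_ge0.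
move=> {}h hr; have hr2 : `|h| <= rho + rho by have := rho0; lra.
have E1 := D_expansion t (s + T2) xx zz hr2.
have E2 := D_expansion t s xx zz hr2.
rewrite !(rf_s1 RF) in E1.
rewrite (_ : D x z t (s + T2) h - D x z t s h =
  (p1 (x + h.1) z (t + h.2) s - p1 x z t s - D x z t s h) -
  (p1 (x + h.1) z (t + h.2) s - p1 x z t s - D x z t (s + T2) h)); last first.
  by apply/rowP => i; rewrite !mxE; ring.
by rewrite mulrDl; apply: le_trans (ler_normB _ _) (lerD E2 E1).
Qed.

(** [D] is a uniform limit of difference quotients, which are continuous in the
    fast time. *)
Lemma D_continuous x z t h : nearx x -> nearz z -> continuous (fun s => D x z t s h).
Proof.
move=> xx zz; apply/continuousP => c e e0.
have [h0|h0] := eqVneq h 0.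
  exists 1 => // s _; rewrite h0 [D x z t s 0]linear0 [D x z t c 0]linear0 subrr normr0; exact: ltW.
have nh : 0 < `|h| by rewrite normr_gt0.
(* step [a] of the difference quotient *)
pose a := Num.min (rho / `|h|) (e / (4 * (k + 1) * `|h| ^+ 2)).
have k10 : 0 < k + 1 by rewrite ltr_wpDl.
have a0 : 0 < a by rewrite lt_min !divr_gt0// !mulr_gt0// exprn_gt0.
have ah : `|a *: h| <= rho + rho.
  rewrite normrZ ger0_norm; last exact: ltW.
  have : a <= rho / `|h| by rewrite ge_min lexx.
  by rewrite ler_pdivlMr//; have := rho0; lra.
have xh : `|x + (a *: h).1 - x0| < r.
  apply: near_shift => //; apply: le_trans ah.
  by exact: prod_norm_fst.
have ea : 0 < e * a / 4 by rewrite divr_gt0// mulr_gt0.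
have cP1 : continuous (p1 (x + (a *: h).1) z (t + (a *: h).2)).
  by apply: (rf_c1 RF) => //; exact: wide.
have cP2 : continuous (p1 x z t) by apply: (rf_c1 RF); exact: wide.
have /continuousP/(_ c _ ea)[r1 r10 r1P] := cP1.
have /continuousP/(_ c _ ea)[r2 r20 r2P] := cP2.
exists (Num.min r1 r2); first by rewrite lt_min r10.
move=> s; rewrite lt_min => /andP[/r1P S1 /r2P S2].
have E1 := D_expansion t s xx zz ah.
have E2 := D_expansion t c xx zz ah.
suff : `|a *: (D x z t s h - D x z t c h)| <= a * e.
  by rewrite normrZ ger0_norm ?(ltW a0)// ler_pM2l.
rewrite scalerBr -!DZ.
set P := (p1 (x + _) z (t + _)) in E1 E2 S1.
set d := a *: h in E1 E2 *.
rewrite (_ : D x z t s d - D x z t c d =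
  (P c - p1 x z t c - D x z t c d) - (P s - p1 x z t s - D x z t s d)
  + ((P s - P c) - (p1 x z t s - p1 x z t c))); last first.
  by apply/rowP => i; rewrite !mxE; ring.
apply: le_trans (ler_normD _ _) _.
apply: le_trans (lerD (le_trans (ler_normB _ _) (lerD E2 E1))
                      (le_trans (ler_normB _ _) (lerD S1 S2))) _.
have kd : k * `|d| ^+ 2 <= e * a / 4.
  rewrite /d normrZ ger0_norm ?(ltW a0)// exprMn.
  have : a <= e / (4 * (k + 1) * `|h| ^+ 2) by rewrite ge_min lexx orbT.
  rewrite ler_pdivlMr; last by rewrite !mulr_gt0// exprn_gt0.
  have ah2 : 0 <= a * `|h| ^+ 2 by rewrite mulr_ge0 ?exprn_ge0// ltW.
  move=> H; rewrite ler_pdivlMr//.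
  apply: (@le_trans _ _ (a * (a * (4 * (k + 1) * `|h| ^+ 2)))); last first.
    by rewrite mulrC ler_wpM2r// ltW.
  have : 0 <= a * (a * `|h| ^+ 2) by rewrite mulr_ge0// ltW.
  lra.
by lra.
Qed.

End Averaging.

(** * The primitive of the dominant field in the fast time *)

Lemma rV_continuousB (R : realType) (n : nat) (f g : R -> 'rV[R]_n) :
  continuous f -> continuous g -> continuous (fun s => f s - g s).
Proof. by move=> cf cg s; apply: continuousB; [exact: cf|exact: cg]. Qed.

Section AveragingCorrectors.
Variables (R : realType) (n1 n2 : nat).
Notation X := 'rV[R]_n1.
Notation Z := 'rV[R]_n2.
Variables (x0 : X) (z0 : Z) (r k T1 T2 : R) (p1 p2 : X -> Z -> R -> R -> X).
Variable D : X -> Z -> R -> R -> {linear (X * R)%type -> X}.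
Hypothesis RF : regular_field x0 z0 r k T1 T2 p1 p2 D.

Notation rho := (r / 4).
Notation nearx x := (`|x - x0| < rho).
Notation nearz z := (`|z - z0| < rho).
Notation KD := (KD r k).

Let r0 : 0 < r. Proof. exact: rf_r RF. Qed.
Let k0 : 0 <= k. Proof. exact: rf_k RF. Qed.
Let rho0 : 0 < rho. Proof. by rewrite divr_gt0. Qed.
Let rho_r : rho < r. Proof. by have := r0; lra. Qed.
Let T20 : 0 < T2. Proof. exact: rf_T2 RF. Qed.
Let T10 : 0 < T1. Proof. exact: rf_T1 RF. Qed.
Let KD0 : 0 <= KD. Proof. exact: KD_ge0 RF. Qed.
Let wide (V : normedModType R) (x y : V) : `|x - y| < rho -> `|x - y| < r.
Proof. by move=> /lt_trans; apply. Qed.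
Let xx0 : nearx x0. Proof. by rewrite subrr normr0. Qed.
Let zz0 : nearz z0. Proof. by rewrite subrr normr0. Qed.

(** The field [p1] is Lipschitz in [z], but its derivative is only continuous in
    [z]: with increments of size [q], the Lipschitz bound on [p1] costs a factor
    [1 / q] and the Taylor remainder gains a factor [q]. *)
Lemma D_z e : 0 < e -> exists2 d, 0 < d &
  forall x z z', nearx x -> nearz z -> nearz z' -> `|z' - z| <= d ->
  forall t s h, `|D x z' t s h - D x z t s h| <= e * `|h|.
Proof.
move=> e0; have k10 : 0 < 4 * (k + 1) by rewrite mulr_gt0// ltr_wpDl.
pose q := Num.min rho (e / (4 * (k + 1))).
have q0 : 0 < q by rewrite lt_min rho0 divr_gt0.
exists (q * q) => [|x z z' xx zz zz' zd t s h]; first exact: mulr_gt0.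
apply: (@le_trans _ _ (4 * k * q ^+ 2 / q * `|h|)); last first.
  rewrite expr2 mulrA mulfK ?lt0r_neq0// ler_wpM2r//.
  have : q <= e / (4 * (k + 1)) by rewrite ge_min lexx orbT.
  rewrite ler_pdivlMr//; have := q0; lra.
apply: (@linear_le_small _ _ _ (fun h => D x z' t s h - D x z t s h)) => //.
- by move=> a h'; rewrite [D x z' t s (a *: h')]linearZ [D x z t s (a *: h')]linearZ scalerBr.
- by apply: mulr_ge0; [exact: mulr_ge0|exact/exprn_ge0/ltW].
move=> {}h hq; have hr2 : `|h| <= rho + rho.
  by apply: (le_trans hq); rewrite ge_min lerDl (ltW rho0).
have E1 := D_expansion RF t s xx zz hr2.
have E2 := D_expansion RF t s xx zz' hr2.
have h1 : `|x + h.1 - x0| < r.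
  rewrite addrAC; apply: le_lt_trans (ler_normD _ _) _.
  have := le_trans (prod_norm_fst h) hr2.
  by have := r0; move: xx; lra.
have Z1 := @rf_z1 _ _ _ _ _ _ _ _ _ _ _ _ RF (x + h.1) z z' (t + h.2) s h1 (wide zz) (wide zz').
have Z2 := @rf_z1 _ _ _ _ _ _ _ _ _ _ _ _ RF x z z' t s (wide xx) (wide zz) (wide zz').
rewrite (_ : D x z' t s h - D x z t s h =
  (p1 (x + h.1) z (t + h.2) s - p1 x z t s - D x z t s h)
  - (p1 (x + h.1) z' (t + h.2) s - p1 x z' t s - D x z' t s h)
  + ((p1 (x + h.1) z' (t + h.2) s - p1 (x + h.1) z (t + h.2) s)
     - (p1 x z' t s - p1 x z t s))); last first.
  by apply/rowP => i; rewrite !mxE; ring.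
apply: le_trans (ler_normD _ _) _.
apply: le_trans (lerD (le_trans (ler_normB _ _) (lerD E1 E2))
                      (le_trans (ler_normB _ _) (lerD Z1 Z2))) _.
have kz : k * `|z' - z| <= k * q ^+ 2 by rewrite ler_wpM2l// expr2.
have kh : k * `|h| ^+ 2 <= k * q ^+ 2.
  by rewrite ler_wpM2l// lerXn2r// nnegrE// ltW.
by lra.
Qed.

Definition primitive2 x z t s := vint 0 s (p1 x z t).
Notation u := primitive2.
Definition primitive2D x z t s h := vint 0 s (fun s => D x z t s h).
Notation Du := primitive2D.

Section Points.
Variables (x : X) (z : Z) (t : R).
Hypotheses (xx : nearx x) (zz : nearz z).

Let cp1 : continuous (p1 x z t).
Proof. by apply: (rf_c1 RF); exact: wide. Qed.
Let cD h : continuous (fun s => D x z t s h).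
Proof. exact (D_continuous RF xx zz). Qed.

Lemma p1_le s : `|p1 x z t s| <= k.
Proof. by apply: (rf_le1 RF); exact: wide. Qed.

Lemma p1_mean : vint 0 T2 (p1 x z t) = 0.
Proof. by apply: (rf_mean RF); exact: wide. Qed.

Lemma primitive2_le s : 0 <= s -> `|u x z t s| <= k * T2.
Proof.
move=> s0; apply: (periodic_primitive_le cp1 T20) => //.
- by move=> s' _; exact: (rf_s1 RF).
- exact: p1_mean.
- by move=> s' _; exact: p1_le.
Qed.

Lemma primitive2_s s s' : `|u x z t s' - u x z t s| <= k * `|s' - s|.
Proof. exact (vint_increment_le s s' cp1 p1_le). Qed.

Lemma primitive2_derivative s e : 0 <= s -> 0 < e -> exists2 q, 0 < q &
  forall s', 0 <= s' -> `|s' - s| < q ->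
    `|u x z t s' - u x z t s - (s' - s) *: p1 x z t s| <= e * `|s' - s|.
Proof. by move=> s0 e0; exact: vint_derivative. Qed.

(** The mean of [p1] vanishes at all points, so that the mean of [D] is a linear
    map with a quadratic bound. *)
Lemma D_mean h : vint 0 T2 (fun s => D x z t s h) = 0.
Proof.
apply: (@linear_quadratic_eq0 _ _ _ (fun h => vint 0 T2 (fun s => D x z t s h))
  rho (k * T2)) => //.
- move=> a h'; rewrite -vintZ//.
  by apply: eq_vint => s _; rewrite linearZ.
- by rewrite mulr_ge0// ltW.
move=> {}h hr; have hr2 : `|h| <= rho + rho by have := rho0; lra.
have h1 : `|x + h.1 - x0| < r.
  rewrite addrAC; apply: le_lt_trans (ler_normD _ _) _.
  have := le_trans (prod_norm_fst h) hr2.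
  by have := r0; move: xx; lra.
have cP : continuous (p1 (x + h.1) z (t + h.2)).
  by apply: (rf_c1 RF) => //; exact: wide.
have := @vint_norm_le _ _ (fun s => p1 (x + h.1) z (t + h.2) s - p1 x z t s
   - D x z t s h) 0 T2 (k * `|h| ^+ 2).
rewrite (vintB _ _ (rV_continuousB cP cp1) (@cD h)) (vintB _ _ cP cp1).
rewrite !(rf_mean RF)//; [|exact: wide..].
rewrite subrr sub0r normrN subr0 mulrAC; apply; last 2 first.
- exact: ltW.
- by move=> s _; exact: (D_expansion RF t s xx zz hr2).
exact (rV_continuousB (rV_continuousB cP cp1) (@cD h)).
Qed.

Lemma primitive2D_le s h : `|Du x z t s h| <= KD * `|h| * T2.
Proof.
have [s0|s0] := ltP s 0.
  rewrite /Du vint_gt// normr0; apply: mulr_ge0; last exact: ltW.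
  exact: mulr_ge0.
apply: (periodic_primitive_le (@cD h) T20) => //.
- by move=> s' _; rewrite (D_periodic2 RF).
- exact: D_mean.
- by move=> s' _; apply: (D_le RF).
Qed.

Lemma primitive2D_periodic s h : 0 <= s -> Du x z t (s + T2) h = Du x z t s h.
Proof.
move=> s0; apply: (periodic_primitive (@cD h) T20) => // [s' _|].
  by rewrite (D_periodic2 RF).
exact: D_mean.
Qed.

Lemma primitive2DZ s a h : Du x z t s (a *: h) = a *: Du x z t s h.
Proof. by rewrite /Du -vintZ//; apply: eq_vint => ? _; rewrite linearZ. Qed.

Lemma primitive2DD s h h' : Du x z t s (h + h') = Du x z t s h + Du x z t s h'.
Proof. by rewrite /Du -vintD//; apply: eq_vint => ? _; rewrite linearD. Qed.

Lemma primitive2DB s h h' : Du x z t s (h - h') = Du x z t s h - Du x z t s h'.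
Proof. by rewrite /Du -vintB//; apply: eq_vint => ? _; rewrite linearB. Qed.

Lemma primitive2D_s s s' h : `|Du x z t s' h - Du x z t s h| <= KD * `|h| * `|s' - s|.
Proof.
by apply: (vint_increment_le _ _ (@cD h)) => ?; apply: (D_le RF).
Qed.

Lemma primitive2D_continuous (h : R -> X * R) : continuous h ->
  continuous (fun s => Du x z t s (h s)).
Proof.
move=> /continuousP ch; apply/continuousP => c e e0.
pose K := KD * T2 + KD * `|h c| + 1.
have K0 : 0 < K.
  apply: ltr_wpDl => //; apply: addr_ge0; apply: mulr_ge0 => //; exact: ltW.
have eK : 0 < e / K by rewrite divr_gt0.
have [q q0 qP] := ch c _ eK.
exists (Num.min q (e / K)); first by rewrite lt_min q0.
move=> s; rewrite lt_min => /andP[/qP sq /ltW se].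
rewrite (_ : _ - _ = Du x z t s (h s - h c) + (Du x z t s (h c) - Du x z t c (h c))).
  apply: le_trans (ler_normD _ _) _.
  apply: le_trans (lerD (primitive2D_le _ _) (primitive2D_s _ _ _)) _.
  apply: (@le_trans _ _ (KD * T2 * (e / K) + KD * `|h c| * (e / K))).
    apply: lerD; last by rewrite ler_wpM2l// mulr_ge0.
    by rewrite mulrAC ler_wpM2l// mulr_ge0// ltW.
  rewrite -mulrDl mulrCA ler_piMr ?(ltW e0)// ler_pdivrMr// mul1r.
  by rewrite lerDl.
by rewrite primitive2DB; apply/rowP => i; rewrite !mxE; ring.
Qed.

End Points.

Lemma primitive2_z x z z' t s : nearx x -> nearz z -> nearz z' -> 0 <= s ->
  `|u x z' t s - u x z t s| <= k * `|z' - z| * T2.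
Proof.
move=> xx zz zz' s0.
have cp1 : continuous (p1 x z t) by apply: (rf_c1 RF); exact: wide.
have cp1' : continuous (p1 x z' t) by apply: (rf_c1 RF); exact: wide.
rewrite /u -(vintB _ _ cp1' cp1); apply: periodic_primitive_le => //.
- exact (rV_continuousB cp1' cp1).
- by move=> ? _; rewrite !(rf_s1 RF).
- by rewrite (vintB _ _ cp1' cp1) !p1_mean// subrr.
- by move=> ? _; apply: (rf_z1 RF); exact: wide.
Qed.

Lemma primitive2_expansion x x' z t t' s : nearx x -> nearx x' -> nearz z -> 0 <= s ->
  `|t' - t| < r ->
  `|u x' z t' s - u x z t s - Du x z t s (x' - x, t' - t)|
    <= k * `|(x' - x, t' - t)| ^+ 2 * T2.
Proof.
move=> xx xx' zz s0 tt.
have cp1 : continuous (p1 x z t) by apply: (rf_c1 RF); exact: wide.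
have cp1' : continuous (p1 x' z t') by apply: (rf_c1 RF); exact: wide.
have cD : continuous (fun s => D x z t s (x' - x, t' - t)).
  exact (D_continuous RF xx zz).
have cB : continuous (fun s => p1 x' z t' s - p1 x z t s).
  exact (rV_continuousB cp1' cp1).
rewrite /u /Du -(vintB _ _ cp1' cp1) -(vintB _ _ cB cD); apply: periodic_primitive_le => //.
- exact (rV_continuousB cB cD).
- by move=> ? _; rewrite !(rf_s1 RF) (D_periodic2 RF).
- by rewrite (vintB _ _ cB cD) (vintB _ _ cp1' cp1) !p1_mean// D_mean// !subrr.
- by move=> ? _; apply: (rf_D RF) => //; exact: wide.
Qed.

Lemma primitive2D_lipschitz x x' z t t' s h : nearx x -> nearx x' -> nearz z -> 0 <= s ->
  `|(x' - x, t' - t)| <= rho ->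
  `|Du x' z t' s h - Du x z t s h| <= 6 * k * `|(x' - x, t' - t)| * `|h| * T2.
Proof.
move=> xx xx' zz s0 tt.
have cD : continuous (fun s => D x z t s h) by exact (D_continuous RF xx zz).
have cD' : continuous (fun s => D x' z t' s h) by exact (D_continuous RF xx' zz).
rewrite /Du -(vintB _ _ cD' cD); apply: periodic_primitive_le => //.
- exact (rV_continuousB cD' cD).
- by move=> ? _; rewrite !(D_periodic2 RF).
- by rewrite (vintB _ _ cD' cD) !D_mean// subrr.
- by move=> ? _; rewrite distrC; apply: (D_lipschitz RF).
Qed.

Lemma primitive2D_z e : 0 < e -> exists2 d, 0 < d &
  forall x z z', nearx x -> nearz z -> nearz z' -> `|z' - z| <= d ->
  forall t s h, 0 <= s -> `|Du x z' t s h - Du x z t s h| <= e * `|h| * T2.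
Proof.
move=> /D_z[d d0 H]; exists d => // x z z' xx zz zz' zd t s h s0.
have cD : continuous (fun s => D x z t s h) by exact (D_continuous RF xx zz).
have cD' : continuous (fun s => D x z' t s h) by exact (D_continuous RF xx zz').
rewrite /Du -(vintB _ _ cD' cD); apply: periodic_primitive_le => //.
- exact (rV_continuousB cD' cD).
- by move=> ? _; rewrite !(D_periodic2 RF).
- by rewrite (vintB _ _ cD' cD) !D_mean// subrr.
- by move=> ? _; exact: H.
Qed.

End AveragingCorrectors.

(** * The drift and its averages over the two times *)

Lemma subrACA (V : zmodType) (a b c d : V) : (a - b) - (c - d) = (a - c) - (b - d).
Proof. by rewrite !opprB [d - c]addrC addrACA [- b + d]addrC. Qed.

Lemma small_lipschitz_continuous (R : realType) (n : nat) (f : R -> 'rV[R]_n) (rho K : R) :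
  0 < rho -> 0 <= K ->
  (forall t t', `|t' - t| <= rho -> `|f t' - f t| <= K * `|t' - t|) ->
  continuous f.
Proof.
move=> rho0 K0 H; apply/continuousP => c e e0.
have K1 : 0 < K + 1 by rewrite ltr_wpDl.
exists (Num.min rho (e / (K + 1))); first by rewrite lt_min rho0 divr_gt0.
move=> s; rewrite lt_min => /andP[/ltW sr /ltW]; rewrite ler_pdivlMr// => se.
apply: (le_trans (H _ _ sr)); apply: le_trans se.
by rewrite mulrC ler_wpM2l// lerDl.
Qed.

Section AveragedField.
Variables (R : realType) (n1 n2 : nat).
Notation X := 'rV[R]_n1.
Notation Z := 'rV[R]_n2.
Variables (x0 : X) (z0 : Z) (r k T1 T2 : R) (p1 p2 : X -> Z -> R -> R -> X).
Variable D : X -> Z -> R -> R -> {linear (X * R)%type -> X}.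
Hypothesis RF : regular_field x0 z0 r k T1 T2 p1 p2 D.

Notation rho := (r / 4).
Notation nearx x := (`|x - x0| < rho).
Notation nearz z := (`|z - z0| < rho).
Notation KD := (KD r k).
Notation Du := (primitive2D D).

Let r0 : 0 < r. Proof. exact: rf_r RF. Qed.
Let k0 : 0 <= k. Proof. exact: rf_k RF. Qed.
Let rho0 : 0 < rho. Proof. by rewrite divr_gt0. Qed.
Let rho_r : rho < r. Proof. by have := r0; lra. Qed.
Let T20 : 0 < T2. Proof. exact: rf_T2 RF. Qed.
Let T10 : 0 < T1. Proof. exact: rf_T1 RF. Qed.
Let KD0 : 0 <= KD. Proof. exact: KD_ge0 RF. Qed.
Let wide (V : normedModType R) (x y : V) : `|x - y| < rho -> `|x - y| < r.
Proof. by move=> /lt_trans; apply. Qed.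
Let xx0 : nearx x0. Proof. by rewrite subrr normr0. Qed.
Let zz0 : nearz z0. Proof. by rewrite subrr normr0. Qed.

(** Let [u] be the primitive of [p1] in the fast time.  Along a solution, the time
    derivative of [x - eps *: u] has no term of order [eps^-1]; its term of order
    [1] is the drift. *)
Definition drift x z t s := p2 x z t s - Du x z t s (p1 x z t s, 1).

Lemma driftE x z t s :
  drift x z t s = p2 x z t s - Du x z t s (p1 x z t s, 1).
Proof. by []. Qed.

(** [Kg] and [Lg] are a bound and a Lipschitz constant for the drift. *)
Definition Kg := k + KD * (k + 1) * T2.
Definition Lg := k + 6 * k * (k + 1) * T2 + KD * (KD + k * rho) * T2.

Lemma Kg_ge0 : 0 <= Kg.
Proof.
by apply: addr_ge0 => //; apply: mulr_ge0; [apply: mulr_ge0 => //; exact: addr_ge0|exact: ltW].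
Qed.

Lemma Lg_ge0 : 0 <= Lg.
Proof.
apply: addr_ge0; [apply: addr_ge0 => //|]; (apply: mulr_ge0; last exact: ltW).
  by apply: mulr_ge0; [exact: mulr_ge0|exact: addr_ge0].
by apply: mulr_ge0 => //; apply: addr_ge0 => //; apply: mulr_ge0 => //; exact: ltW.
Qed.

Lemma p1_1_le x z t s : nearx x -> nearz z -> `|(p1 x z t s, 1 : R)| <= k + 1.
Proof.
move=> xx zz; apply: le_trans (prod_norm_le _ _) _.
by rewrite normr1 lerD2r; apply: (p1_le RF).
Qed.

Lemma drift_le x z t s : nearx x -> nearz z -> `|drift x z t s| <= Kg.
Proof.
move=> xx zz; apply: le_trans (ler_normB _ _) _; apply: lerD.
  by apply: (rf_le2 RF); exact: wide.
apply: le_trans (primitive2D_le RF _ xx zz _ _) _.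
by rewrite ler_wpM2r ?(ltW T20)// ler_wpM2l//; exact: p1_1_le.
Qed.

Lemma p1_lipschitz x x' z t t' s : nearx x -> nearx x' -> nearz z ->
  `|(x' - x, t' - t)| <= rho ->
  `|p1 x' z t' s - p1 x z t s| <= (KD + k * rho) * `|(x' - x, t' - t)|.
Proof.
move=> xx xx' zz dr; set d := (x' - x, t' - t) in dr *.
rewrite -[X in `|X|](subrK (D x z t s d)).
apply: le_trans (ler_normD _ _) _; rewrite addrC mulrDl; apply: lerD.
  exact: (D_le RF).
apply: (@le_trans _ _ (k * `|d| ^+ 2)); last first.
  by rewrite expr2 -mulrA ler_wpM2l// ler_wpM2r.
apply: (rf_D RF); [exact: wide..|].
by apply: le_lt_trans rho_r; apply: le_trans dr; exact: (prod_norm_snd d).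
Qed.

Lemma drift_lipschitz x x' z t t' s : nearx x -> nearx x' -> nearz z -> 0 <= s ->
  `|(x' - x, t' - t)| <= rho ->
  `|drift x' z t' s - drift x z t s| <= Lg * `|(x' - x, t' - t)|.
Proof.
move=> xx xx' zz s0 dr; set d := (x' - x, t' - t) in dr *.
rewrite (_ : _ - _ = (p2 x' z t' s - p2 x z t s)
  - ((Du x' z t' s (p1 x' z t' s, 1) - Du x z t s (p1 x' z t' s, 1))
  + Du x z t s ((p1 x' z t' s, 1) - (p1 x z t s, 1)))); last first.
  rewrite (primitive2DB RF)// /drift; set a := Du _ _ _ _ _; set b := Du _ _ _ _ _.
  set c := Du _ _ _ _ _; clearbody a b c.
  by apply/rowP => i; rewrite !mxE; ring.
apply: le_trans (ler_normB _ _) _.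
rewrite (_ : Lg * `|d| = k * `|d| + (6 * k * `|d| * (k + 1) * T2
  + KD * ((KD + k * rho) * `|d|) * T2)); last by rewrite /Lg; ring.
apply: lerD.
  apply: (rf_x2 RF); [exact: wide..|].
  by apply: le_lt_trans rho_r; apply: le_trans dr; exact: (prod_norm_snd d).
apply: le_trans (ler_normD _ _) _; apply: lerD.
  apply: le_trans (primitive2D_lipschitz RF _ xx xx' zz s0 dr) _.
  rewrite -/d ler_wpM2r ?(ltW T20)//.
  by rewrite ler_wpM2l ?mulr_ge0//; exact: p1_1_le.
apply: le_trans (primitive2D_le RF _ xx zz _ _) _.
rewrite ler_wpM2r ?(ltW T20)// ler_wpM2l//.
apply: le_trans (prod_norm_le _ _) _; rewrite /= subrr normr0 addr0.
exact: p1_lipschitz.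
Qed.

Lemma drift_near e : 0 < e -> exists2 d, 0 < d & forall x z t s,
  `|x - x0| <= d -> `|z - z0| <= d -> 0 <= s ->
  `|drift x z t s - drift x0 z0 t s| <= e.
Proof.
move=> e0; have k10 : 0 < k + 1 by rewrite ltr_wpDl.
pose e1 := e / 4 / ((k + 1) * T2).
have e10 : 0 < e1 by rewrite !divr_gt0// mulr_gt0.
have [d1 d10 Hd1] := primitive2D_z RF e10.
pose K := k + KD * k * T2.
have K0 : 0 <= K.
  by apply: addr_ge0 => //; apply: mulr_ge0; [exact: mulr_ge0|exact: ltW].
have L0 := Lg_ge0.
have Lp : 0 < Lg + 1 by rewrite ltr_wpDl.
have Kp : 0 < K + 1 by rewrite ltr_wpDl.
exists (Num.min (Num.min d1 (rho / 2)) (Num.min (e / 4 / (Lg + 1)) (e / 4 / (K + 1)))).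
  by rewrite !lt_min d10 !divr_gt0.
move=> x z t s; rewrite !le_min.
move=> /andP[/andP[_ xr] /andP[xL _]] /andP[/andP[zd zr] /andP[_ zK]] s0.
have xx : nearx x by have := rho0; lra.
have zz : nearz z by have := rho0; lra.
have xE : `|(x0 - x, t - t)| = `|x - x0|.
  apply/eqP; rewrite eq_le; apply/andP; split; last first.
    by rewrite distrC; exact: (prod_norm_fst (x0 - x, t - t)).
  by apply: le_trans (prod_norm_le _ _) _; rewrite subrr normr0 addr0 distrC.
have A1 : `|drift x0 z t s - drift x z t s| <= e / 4.
  apply: (le_trans (drift_lipschitz xx xx0 zz s0 _)); rewrite xE; first lra.
  apply: (@le_trans _ _ ((Lg + 1) * `|x - x0|)).
    by rewrite ler_wpM2r// lerDl.
  by rewrite mulrC -ler_pdivlMr.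
have A2 : `|Du x0 z t s (p1 x0 z t s, 1) - Du x0 z0 t s (p1 x0 z t s, 1)| <= e / 4.
  apply: le_trans (Hd1 _ _ _ xx0 zz0 zz zd t s _ s0) _.
  rewrite [leRHS](_ : _ = e1 * ((k + 1) * T2)); last first.
    by rewrite divfK// lt0r_neq0// mulr_gt0.
  rewrite mulrA ler_wpM2r ?(ltW T20)// ler_wpM2l ?(ltW e10)//.
  exact: p1_1_le.
have A34 : `|p2 x0 z t s - p2 x0 z0 t s|
   + `|Du x0 z0 t s ((p1 x0 z t s, 1) - (p1 x0 z0 t s, 1))| <= e / 4.
  apply: (@le_trans _ _ (K * `|z - z0|)).
    rewrite /K mulrDl; apply: lerD.
      by apply: (rf_z2 RF); exact: wide.
    apply: le_trans (primitive2D_le RF _ xx0 zz0 _ _) _.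
    rewrite [leRHS](_ : _ = KD * (k * `|z - z0|) * T2); last by ring.
    rewrite ler_wpM2r ?(ltW T20)// ler_wpM2l//.
    apply: le_trans (prod_norm_le _ _) _; rewrite /= subrr normr0 addr0.
    by apply: (rf_z1 RF); exact: wide.
  apply: (@le_trans _ _ ((K + 1) * `|z - z0|)).
    by rewrite ler_wpM2r// lerDl.
  by rewrite mulrC -ler_pdivlMr.
rewrite (_ : _ - _ = - (drift x0 z t s - drift x z t s)
  + ((p2 x0 z t s - p2 x0 z0 t s)
   - (Du x0 z t s (p1 x0 z t s, 1) - Du x0 z0 t s (p1 x0 z t s, 1))
   - Du x0 z0 t s ((p1 x0 z t s, 1) - (p1 x0 z0 t s, 1)))); last first.
  rewrite (primitive2DB RF)// /drift; set a := Du _ _ _ _ _; set b := Du _ _ _ _ _.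
  set c := Du _ _ _ _ _; clearbody a b c.
  by apply/rowP => i; rewrite !mxE; ring.
apply: le_trans (ler_normD _ _) _; rewrite normrN.
apply: le_trans (lerD A1 (le_trans (ler_normB _ _)
  (lerD (le_trans (ler_normB _ _) (lerD (lexx _) A2)) (lexx _)))) _.
lra.
Qed.

(** The drift is frozen at ([x0], [z0]): since all increments are estimated near
    this point, the correctors below only have to depend on the times. *)
Definition g0 t s := drift x0 z0 t s.

Lemma g0_le t s : `|g0 t s| <= Kg. Proof. exact: drift_le. Qed.

Lemma g0_lipschitz t t' s : 0 <= s -> `|t' - t| <= rho ->
  `|g0 t' s - g0 t s| <= Lg * `|t' - t|.
Proof.
move=> s0 tt; have nE : `|(x0 - x0, t' - t)| = `|t' - t|.
  apply/eqP; rewrite eq_le; apply/andP; split; last exact: (prod_norm_snd (x0 - x0, t' - t)).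
  by apply: le_trans (prod_norm_le _ _) _; rewrite subrr normr0 add0r.
by rewrite -nE; apply: drift_lipschitz => //; rewrite nE.
Qed.

Lemma g0_T1 t s : g0 (t + T1) s = g0 t s.
Proof.
rewrite /g0 /drift (rf_t2 RF) (rf_t1 RF); congr (_ - _).
by apply: eq_vint => s' _; rewrite (D_periodic1 RF).
Qed.

Lemma g0_T2 t s : 0 <= s -> g0 t (s + T2) = g0 t s.
Proof.
by move=> s0; rewrite /g0 /drift (rf_s2 RF) (rf_s1 RF) (primitive2D_periodic RF).
Qed.

Lemma g0_continuous t : continuous (g0 t).
Proof.
apply: rV_continuousB.
  by apply: (rf_c2 RF); exact: wide.
apply: (primitive2D_continuous RF) => //; apply/continuousP => c e e0.
have /continuousP/(_ c _ e0)[q q0 qP] : continuous (p1 x0 z0 t).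
  by apply: (rf_c1 RF); exact: wide.
exists q => // s /qP; apply: le_trans.
by apply: le_trans (prod_norm_le _ _) _; rewrite /= subrr normr0 addr0.
Qed.

#[local] Opaque g0.

Definition avg1 t := T2^-1 *: vint 0 T2 (g0 t).

Let T2i (c : R) : T2^-1 * (c * T2) = c.
Proof. by rewrite mulrCA mulVf ?mulr1// lt0r_neq0. Qed.
Let T1i (c : R) : T1^-1 * (c * T1) = c.
Proof. by rewrite mulrCA mulVf ?mulr1// lt0r_neq0. Qed.

Lemma avg1_le t : `|avg1 t| <= Kg.
Proof.
rewrite normrZ ger0_norm ?invr_ge0 ?(ltW T20)//.
rewrite -[leRHS]T2i ler_wpM2l ?invr_ge0 ?(ltW T20)//.
have := @vint_norm_le _ _ (g0 t) 0 T2 Kg (@g0_continuous t); rewrite subr0.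
by apply; [exact: ltW|move=> s _; exact: g0_le].
Qed.

Lemma avg1_lipschitz t t' : `|t' - t| <= rho ->
  `|avg1 t' - avg1 t| <= Lg * `|t' - t|.
Proof.
move=> tt; rewrite /avg1 -scalerBr normrZ ger0_norm ?invr_ge0 ?(ltW T20)//.
rewrite -[leRHS]T2i ler_wpM2l ?invr_ge0 ?(ltW T20)//.
rewrite -vintB; [|exact: g0_continuous..].
have := @vint_norm_le _ _ (fun s => g0 t' s - g0 t s) 0 T2 (Lg * `|t' - t|).
rewrite subr0; apply; last by move=> s /andP[s0 _]; exact: g0_lipschitz.
- exact (rV_continuousB (@g0_continuous t') (@g0_continuous t)).
- exact: ltW.
Qed.

Lemma avg1_T1 t : avg1 (t + T1) = avg1 t.
Proof.
have E : vint 0 T2 (g0 (t + T1)) = vint 0 T2 (g0 t).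
  by apply: eq_vint => s _; apply: g0_T1.
by rewrite /avg1 E.
Qed.

Lemma avg1_continuous : continuous avg1.
Proof. exact: small_lipschitz_continuous rho0 Lg_ge0 avg1_lipschitz. Qed.

Lemma avg1E t : T2 *: avg1 t = vint 0 T2 (g0 t).
Proof. by rewrite scalerA divff ?lt0r_neq0// scale1r. Qed.

#[local] Opaque avg1.

Definition avg := T1^-1 *: vint 0 T1 avg1.

Lemma avg_le : `|avg| <= Kg.
Proof.
rewrite normrZ ger0_norm ?invr_ge0 ?(ltW T10)//.
rewrite -[leRHS]T1i ler_wpM2l ?invr_ge0 ?(ltW T10)//.
have := @vint_norm_le _ _ avg1 0 T1 Kg avg1_continuous; rewrite subr0.
by apply; [exact: ltW|move=> s _; exact: avg1_le].
Qed.

Lemma avgE : T1 *: avg = vint 0 T1 avg1.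
Proof. by rewrite scalerA divff ?lt0r_neq0// scale1r. Qed.

#[local] Opaque avg.

(** Correctors for the oscillation of the drift around its averages. *)
Definition sig2 t s := vint 0 s (fun s' => g0 t s' - avg1 t).
Definition sig1 t := vint 0 t (fun t' => avg1 t' - avg).

Let cst_c (c : X) : continuous (fun _ : R => c).
Proof. by move=> ?; exact: cst_continuous. Qed.

Let c2 t : continuous (fun s' => g0 t s' - avg1 t).
Proof. exact (rV_continuousB (@g0_continuous t) (@cst_c _)). Qed.

Let c1 : continuous (fun t' => avg1 t' - avg).
Proof. exact (rV_continuousB avg1_continuous (@cst_c _)). Qed.

Let m2 t : vint 0 T2 (fun s' => g0 t s' - avg1 t) = 0.
Proof.
rewrite vintB; [|exact: g0_continuous|exact: cst_c].
by rewrite vint_cst ?(ltW T20)// subr0 avg1E subrr.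
Qed.

Let m1 : vint 0 T1 (fun t' => avg1 t' - avg) = 0.
Proof.
rewrite vintB; [|exact: avg1_continuous|exact: cst_c].
by rewrite vint_cst ?(ltW T10)// subr0 avgE subrr.
Qed.

Let b2 t s : `|g0 t s - avg1 t| <= Kg + Kg.
Proof. by apply: le_trans (ler_normB _ _) _; apply: lerD; [exact: g0_le|exact: avg1_le]. Qed.

Let b1 t : `|avg1 t - avg| <= Kg + Kg.
Proof. by apply: le_trans (ler_normB _ _) _; apply: lerD; [exact: avg1_le|exact: avg_le]. Qed.

Lemma sig2_le t s : 0 <= s -> `|sig2 t s| <= (Kg + Kg) * T2.
Proof.
move=> s0; have H s' : 0 <= s' -> g0 t (s' + T2) - avg1 t = g0 t s' - avg1 t.
  by move=> s'0; rewrite g0_T2.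
exact (periodic_primitive_le (@c2 t) T20 H (@m2 t) (fun s _ => b2 t s) s0).
Qed.

Lemma sig1_le t : 0 <= t -> `|sig1 t| <= (Kg + Kg) * T1.
Proof.
move=> t0; have H t' : 0 <= t' -> avg1 (t' + T1) - avg = avg1 t' - avg.
  by rewrite avg1_T1.
exact (periodic_primitive_le c1 T10 H m1 (fun t _ => b1 t) t0).
Qed.

Lemma sig2_lipschitz t t' s : 0 <= s -> `|t' - t| <= rho ->
  `|sig2 t' s - sig2 t s| <= (Lg + Lg) * `|t' - t| * T2.
Proof.
move=> s0 tt; pose f s := (g0 t' s - avg1 t') - (g0 t s - avg1 t).
have cf : continuous f := rV_continuousB (@c2 t') (@c2 t).
have fT s' : 0 <= s' -> f (s' + T2) = f s' by move=> s'0; rewrite /f !g0_T2.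
have f0 : vint 0 T2 f = 0.
  exact (etrans (vintB 0 T2 (@c2 t') (@c2 t))
    (etrans (congr2 (fun a b : X => a - b) (m2 t') (m2 t)) (subrr 0))).
have fM s' : 0 <= s' -> `|f s'| <= (Lg + Lg) * `|t' - t|.
  move=> s'0; rewrite (_ : f s' = (g0 t' s' - g0 t s') - (avg1 t' - avg1 t)).
    apply: le_trans (ler_normB _ _) _; rewrite mulrDl; apply: lerD.
      exact: g0_lipschitz.
    exact: avg1_lipschitz.
  exact: subrACA.
have E : vint 0 s f = sig2 t' s - sig2 t s := vintB 0 s (@c2 t') (@c2 t).
by have := periodic_primitive_le cf T20 fT f0 fM s0; rewrite E.
Qed.

Lemma sig2_s t s s' : `|sig2 t s' - sig2 t s| <= (Kg + Kg) * `|s' - s|.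
Proof. exact (vint_increment_le _ _ (@c2 t) (@b2 t)). Qed.

Lemma sig1_t t t' : `|sig1 t' - sig1 t| <= (Kg + Kg) * `|t' - t|.
Proof. exact (vint_increment_le _ _ c1 b1). Qed.

Lemma sig2_derivative t s e : 0 <= s -> 0 < e -> exists2 q, 0 < q &
  forall s', 0 <= s' -> `|s' - s| < q ->
    `|sig2 t s' - sig2 t s - (s' - s) *: (g0 t s - avg1 t)| <= e * `|s' - s|.
Proof. move=> s0 e0; exact (vint_derivative (@c2 t) s0 e0). Qed.

Lemma sig1_derivative t e : 0 <= t -> 0 < e -> exists2 q, 0 < q &
  forall t', 0 <= t' -> `|t' - t| < q ->
    `|sig1 t' - sig1 t - (t' - t) *: (avg1 t - avg)| <= e * `|t' - t|.
Proof. move=> s0 e0; exact (vint_derivative c1 s0 e0). Qed.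

End AveragedField.

(** * The average of the drift is the average field with the Lie bracket *)

Lemma rV_continuousD (R : realType) (n : nat) (f g : R -> 'rV[R]_n) :
  continuous f -> continuous g -> continuous (fun s => f s + g s).
Proof. by move=> cf cg s; apply: continuousD; [exact: cf|exact: cg]. Qed.

Lemma rV_continuousZ (R : realType) (n : nat) (f : R -> 'rV[R]_n) (c : R) :
  continuous f -> continuous (fun s => c *: f s).
Proof. by move=> cf s; apply: continuousZr; exact: cf. Qed.

Lemma near0_norm (R : realType) (V : normedModType R) (r : R) : 0 < r ->
  \forall h \near (0 : V), `|h| < r.
Proof.
move=> r0; apply/nbhs_normP; exists r => // h /=.
by rewrite sub0r normrN.
Qed.

Lemma diff_quadratic (R : realType) (V W : normedModType R) (f L : V -> W) (x : V)
    (r C K : R) :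
  (forall a h h', L (a *: h + h') = a *: L h + L h') ->
  (forall h, `|L h| <= C * `|h|) -> 0 < r -> 0 <= K ->
  (forall y, `|y - x| < r -> `|f y - f x - L (y - x)| <= K * `|y - x| ^+ 2) ->
  'd f x = L :> (V -> W).
Proof.
move=> Llin LC r0 K0 H.
pose df : {linear V -> W} := HB.pack L (GRing.isLinear.Build R V W *:%R L Llin).
have C1 : 0 < `|C| + 1 by rewrite ltr_wpDl.
have cL : continuous df.
  move=> y; apply/cvgrPdist_le => e e0.
  near=> z; rewrite -linearB; apply: le_trans (LC _) _.
  apply: (@le_trans _ _ ((`|C| + 1) * `|y - z|)).
    by rewrite ler_wpM2r// ler_wpDr// ler_norm.
  rewrite mulrC -ler_pdivlMr//; near: z.
  by apply: (@cvgr_dist_le _ _ _ (nbhs y) _ id y); [exact: cvg_id|rewrite divr_gt0].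
apply: (@diff_unique _ _ _ _ df) => //.
apply/eqaddoP => e e0; have K1 : 0 < K + 1 by rewrite ltr_wpDl.
near=> h.
have hr : `|h| < r.
  by near: h; exact: near0_norm.
have he : `|h| < e / (K + 1).
  by near: h; apply: near0_norm; rewrite divr_gt0.
rewrite !fctE /= opprD addrA; have := H (h + x); rewrite addrK => /(_ hr)/le_trans; apply.
rewrite expr2 mulrA ler_wpM2r//; apply: (@le_trans _ _ ((K + 1) * `|h|)).
  by rewrite ler_wpM2r// lerDl.
by rewrite mulrC -ler_pdivlMr// ltW.
Unshelve. all: by end_near. Qed.

Lemma vint_continuous (R : realType) (n : nat) (f : R -> 'rV[R]_n) M :
  continuous f -> (forall a, `|f a| <= M) -> continuous (fun s => vint 0 s f).
Proof.
move=> cf fM; apply: (@small_lipschitz_continuous _ _ _ 1 M) => //.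
  exact: le_trans (normr_ge0 _) (fM 0).
by move=> s s' _; exact: vint_increment_le.
Qed.

Section AverageIdentity.
Variables (R : realType) (n1 n2 : nat).
Notation X := 'rV[R]_n1.
Notation Z := 'rV[R]_n2.
Variables (x0 : X) (z0 : Z) (r k T1 T2 : R) (p1 p2 : X -> Z -> R -> R -> X).
Variable D : X -> Z -> R -> R -> {linear (X * R)%type -> X}.
Hypothesis RF : regular_field x0 z0 r k T1 T2 p1 p2 D.

Notation rho := (r / 4).
Notation KD := (KD r k).
Notation u := (primitive2 p1 x0 z0).
Notation Du := (primitive2D D x0 z0).
Notation g0 := (g0 x0 z0 p1 p2 D).
Notation avg1 := (avg1 x0 z0 T2 p1 p2 D).
Notation avg := (avg x0 z0 T1 T2 p1 p2 D).

Let r0 : 0 < r. Proof. exact: rf_r RF. Qed.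
Let k0 : 0 <= k. Proof. exact: rf_k RF. Qed.
Let rho0 : 0 < rho. Proof. by rewrite divr_gt0. Qed.
Let T20 : 0 < T2. Proof. exact: rf_T2 RF. Qed.
Let T10 : 0 < T1. Proof. exact: rf_T1 RF. Qed.
Let KD0 : 0 <= KD. Proof. exact: KD_ge0 RF. Qed.
Let xx0 : `|x0 - x0| < rho. Proof. by rewrite subrr normr0. Qed.
Let zz0 : `|z0 - z0| < rho. Proof. by rewrite subrr normr0. Qed.
Let xr0 : `|x0 - x0| < r. Proof. by rewrite subrr normr0. Qed.
Let zr0 : `|z0 - z0| < r. Proof. by rewrite subrr normr0. Qed.

Let cp1 t : continuous (p1 x0 z0 t). Proof. exact: (rf_c1 RF). Qed.
Let p1k t s : `|p1 x0 z0 t s| <= k. Proof. exact: (p1_le RF). Qed.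

Let cu t : continuous (u t).
Proof. exact: vint_continuous (@cp1 t) (@p1k t). Qed.

Let fst_c (f : R -> X) : continuous f -> continuous (fun s => (f s, 0 : R)).
Proof.
move=> /continuousP cf; apply/continuousP => c e e0.
have [q q0 qP] := cf c e e0; exists q => // s /qP; apply: le_trans.
by apply: le_trans (prod_norm_le _ _) _; rewrite /= subrr normr0 addr0.
Qed.

Let D_comp_continuous t (h : R -> X * R) : continuous h ->
  continuous (fun s => D x0 z0 t s (h s)).
Proof.
move=> /continuousP ch; apply/continuousP => c e e0.
have K1 : 0 < KD + 1 by rewrite ltr_wpDl.
have e2 : 0 < e / 2 by rewrite divr_gt0.
have eK : 0 < e / 2 / (KD + 1) by rewrite divr_gt0.
have [q1 q10 q1P] := ch c _ eK.
have /continuousP/(_ c _ e2)[q2 q20 q2P] :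
  continuous (fun s => D x0 z0 t s (h c)) by exact (D_continuous RF xx0 zz0).
exists (Num.min q1 q2); first by rewrite lt_min q10.
move=> s; rewrite lt_min => /andP[/q1P h1 /q2P h2].
have -> : D x0 z0 t s (h s) - D x0 z0 t c (h c) =
    D x0 z0 t s (h s - h c) + (D x0 z0 t s (h c) - D x0 z0 t c (h c)).
  by rewrite linearB subrKA.
apply: le_trans (ler_normD _ _) _; rewrite [leRHS]splitr; apply: lerD => //.
have H1 : `|D x0 z0 t s (h s - h c)| <= KD * `|h s - h c| by apply: (D_le RF).
apply: (le_trans H1); apply: (@le_trans _ _ ((KD + 1) * (e / 2 / (KD + 1)))).
  by apply: ler_pM => //; rewrite lerDl.
by rewrite mulrC divfK// lt0r_neq0.
Qed.

Let cDu t h : continuous h -> continuous (fun s => Du t s (h s)).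
Proof. by move=> ch; apply: (primitive2D_continuous RF). Qed.

Let cst_c (V : normedModType R) (c : V) : continuous (fun _ : R => c).
Proof. by move=> ?; exact: cst_continuous. Qed.

Lemma u0_T2 t : u t T2 = 0.
Proof. exact: (p1_mean RF). Qed.

(** The integrand is the derivative, in the fast time, of the periodic function
    [Du t s (u t s, 0)].  This is why averaging the drift, which contains the
    product [Du p1] only, gives half of an antisymmetric bracket. *)
Lemma symmetric_part_mean t :
  vint 0 T2 (fun s => D x0 z0 t s (u t s, 0) + Du t s (p1 x0 z0 t s, 0)) = 0.
Proof.
rewrite (@vint_FTC2 _ _ (fun s => Du t s (u t s, 0))); last first.
- move=> c e /andP[c0 cT] e0.
  pose K := KD * T2 + KD * k + 1.
  have K00 : 0 <= KD * T2 + KD * k.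
    by apply: addr_ge0; apply: mulr_ge0 => //; exact: ltW.
  have K0 : 0 < K by rewrite ltr_wpDl.
  have e2 : 0 < e / 2 by rewrite divr_gt0.
  have e1 : 0 < e / 2 / K by rewrite divr_gt0.
  have [q1 q10 q1P] := primitive2_derivative RF t xx0 zz0 c0 e1.
  have [q2 q20 q2P] : exists2 q, 0 < q & forall s, 0 <= s -> `|s - c| < q ->
      `|Du t s (u t c, 0) - Du t c (u t c, 0) - (s - c) *: D x0 z0 t c (u t c, 0)|
        <= e / 2 * `|s - c|.
    have cD : continuous (fun s => D x0 z0 t s (u t c, 0)).
      exact (D_continuous RF xx0 zz0).
    exact (vint_derivative cD c0 e2).
  exists (Num.min (Num.min q1 q2) (e / 2 / K)); first by rewrite !lt_min q10 q20.
  move=> s /andP[s0 sT]; rewrite !lt_min => /andP[/andP[sq1 sq2] /ltW se].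
  have H1 := q1P s s0 sq1; have H2 := q2P s s0 sq2.
  have -> : Du t s (u t s, 0) - Du t c (u t c, 0)
       - (s - c) *: (D x0 z0 t c (u t c, 0) + Du t c (p1 x0 z0 t c, 0)) =
     (Du t s (u t s - u t c - (s - c) *: p1 x0 z0 t c, 0)
      + (s - c) *: (Du t s (p1 x0 z0 t c, 0) - Du t c (p1 x0 z0 t c, 0)))
     + (Du t s (u t c, 0) - Du t c (u t c, 0) - (s - c) *: D x0 z0 t c (u t c, 0)).
    have -> : (u t s - u t c - (s - c) *: p1 x0 z0 t c, 0 : R) =
        (u t s, 0) - (u t c, 0) - (s - c) *: (p1 x0 z0 t c, 0).
      by congr (_, _); rewrite /= scaler0 !subr0.
    rewrite !(primitive2DB RF)// (primitive2DZ RF)//.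
    move: (Du t s (u t s, 0)) (Du t s (u t c, 0)) (Du t s (p1 x0 z0 t c, 0)).
    move: (Du t c (u t c, 0)) (Du t c (p1 x0 z0 t c, 0)) (D x0 z0 t c (u t c, 0)).
    by move=> A B C E F G; apply/rowP => i; rewrite !mxE; ring.
  apply: le_trans (ler_normD _ _) _; rewrite [e in leRHS]splitr mulrDl.
  apply: lerD => //; apply: le_trans (ler_normD _ _) _.
  have fstE (v : X) : `|(v, 0 : R)| <= `|v|.
    by apply: le_trans (prod_norm_le _ _) _; rewrite normr0 addr0.
  apply: (@le_trans _ _ ((KD * T2 + KD * k) * (e / 2 / K) * `|s - c|)).
    rewrite [leRHS](_ : _ = KD * (e / 2 / K * `|s - c|) * T2
       + `|s - c| * (KD * k * (e / 2 / K))); last by ring.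
    apply: lerD.
      apply: le_trans (primitive2D_le RF _ xx0 zz0 _ _) _.
      rewrite ler_wpM2r ?(ltW T20)// ler_wpM2l//.
      exact: le_trans (fstE _) H1.
    rewrite normrZ ler_wpM2l//.
    apply: le_trans (primitive2D_s RF _ xx0 zz0 _ _ _) _.
    apply: ler_pM => //; first exact: mulr_ge0.
    by rewrite ler_wpM2l//; exact: le_trans (fstE _) (p1k _ _).
  rewrite ler_wpM2r//; apply: (@le_trans _ _ (K * (e / 2 / K))).
    by rewrite ler_wpM2r ?(ltW e1)// lerDl.
  by rewrite mulrC divfK// lt0r_neq0.
- exact (rV_continuousD (@D_comp_continuous t _ (fst_c (@cu t)))
    (@cDu t _ (fst_c (@cp1 t)))).
- exact: ltW.
rewrite u0_T2 (_ : u t 0 = 0); last exact: vintxx.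
have Du0 s : Du t s (0, 0) = 0.
  by have := primitive2DZ RF t xx0 zz0 s 0 (0, 0); rewrite !scale0r.
by rewrite !Du0 subrr.
Qed.

Definition slow_part t := vint 0 T2 (fun s => Du t s (0, 1)).

Let one_norm (a : R) : `|(0 : X, a)| = `|a|.
Proof.
apply/eqP; rewrite eq_le; apply/andP; split; last exact: (prod_norm_snd (0 : X, a)).
by apply: le_trans (prod_norm_le _ _) _; rewrite normr0 add0r.
Qed.

Let cDu1 t : continuous (fun s => Du t s (0, 1)).
Proof. by apply: cDu; exact: cst_c. Qed.

Lemma slow_part_continuous : continuous slow_part.
Proof.
apply: (@small_lipschitz_continuous _ _ _ rho (6 * k * T2 * T2)) => //.
  by rewrite !mulr_ge0// ltW.
move=> t t' tt; rewrite /slow_part -(vintB _ _ (@cDu1 t') (@cDu1 t)).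
apply: le_trans (vint_norm_le (M := 6 * k * `|t' - t| * T2)
   (rV_continuousB (@cDu1 t') (@cDu1 t)) (ltW T20) _) _.
  move=> s /andP[s0 _].
  have := @primitive2D_lipschitz _ _ _ _ _ _ _ _ _ _ _ _ RF x0 x0 z0 t t' s (0, 1) xx0 xx0 zz0 s0.
  by rewrite subrr !one_norm normr1 mulr1; apply.
by rewrite subr0 [leRHS](_ : _ = 6 * k * `|t' - t| * T2 * T2)//; ring.
Qed.

(** [slow_part] is the derivative of the mean of [u], which is periodic in the
    intermediate time. *)
Lemma slow_part_mean : vint 0 T1 slow_part = 0.
Proof.
rewrite (@vint_FTC2 _ _ (fun t => vint 0 T2 (u t))); last first.
- move=> c e _ e0; pose K := k * T2 * T2.
  have K0 : 0 <= K by rewrite !mulr_ge0// ltW.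
  have K1 : 0 < K + 1 by rewrite ltr_wpDl.
  exists (Num.min r (e / (K + 1))); first by rewrite lt_min r0 divr_gt0.
  move=> t _; rewrite lt_min => /andP[tr /ltW te].
  have -> : vint 0 T2 (u t) - vint 0 T2 (u c) - (t - c) *: slow_part c =
      vint 0 T2 (fun s => u t s - u c s - (t - c) *: Du c s (0, 1)).
    rewrite /slow_part -(vintZ _ _ _ (@cDu1 c)) -(vintB _ _ (@cu t) (@cu c)) -vintB//.
      exact: (rV_continuousB (@cu t) (@cu c)).
    exact: (rV_continuousZ (@cDu1 c)).
  apply: (@le_trans _ _ (k * `|t - c| ^+ 2 * T2 * (T2 - 0))).
    apply: vint_norm_le; [|exact: ltW|].
      apply: rV_continuousB; first exact: (rV_continuousB (@cu t) (@cu c)).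
      exact: (rV_continuousZ (@cDu1 c)).
    move=> s /andP[s0 _]; rewrite -(primitive2DZ RF)//.
    have -> : (t - c) *: (0 : X, 1 : R) = (x0 - x0, t - c).
      by rewrite subrr; congr (_, _); [exact: scaler0|exact: mulr1].
    rewrite (_ : `|t - c| = `|(x0 - x0, t - c)|); last by rewrite subrr one_norm.
    exact: (primitive2_expansion RF).
  rewrite subr0 [leLHS](_ : _ = K * `|t - c| * `|t - c|); last by rewrite /K; ring.
  rewrite ler_wpM2r//; apply: (@le_trans _ _ ((K + 1) * `|t - c|)).
    by rewrite ler_wpM2r// lerDl.
  by rewrite mulrC -ler_pdivlMr.
- exact: slow_part_continuous.
- exact: ltW.
apply/eqP; rewrite subr_eq0; apply/eqP; apply: eq_vint => s _; apply: eq_vint => s' _.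
by rewrite -[T1]add0r (rf_t1 RF).
Qed.

Variables phi1 phi2 : vfield R n1 n2.
Hypothesis phi1E : forall x t s, `|x - x0| < r -> 0 <= t -> 0 <= s ->
  phi1 x z0 t s = p1 x z0 t s.
Hypothesis phi2E : forall t s, 0 <= t -> 0 <= s -> phi2 x0 z0 t s = p2 x0 z0 t s.

Let u1E x t s : `|x - x0| < r -> 0 <= t -> 0 <= s ->
  u1_of phi1 x z0 t s = primitive2 p1 x z0 t s.
Proof.
by move=> xr t0 s0; apply: eq_vint => s' /andP[s'0 _]; exact: phi1E.
Qed.

Let fst_norm (h : X) : `|(h, 0 : R)| = `|h|.
Proof.
apply/eqP; rewrite eq_le; apply/andP; split; last exact: (prod_norm_fst (h, 0 : R)).
by apply: le_trans (prod_norm_le _ _) _; rewrite normr0 addr0.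
Qed.

Let fst_lin a (h h' : X) : (a *: h + h', 0 : R) = a *: (h, 0) + (h', 0).
Proof. by congr (_, _); rewrite /= scaler0 addr0. Qed.

Let sum0 (s : R) : `|s - s| < r. Proof. by rewrite subrr normr0. Qed.

Lemma diff_phi1 t s (h : X) : 0 <= t -> 0 <= s ->
  'd (fun x => phi1 x z0 t s) x0 h = D x0 z0 t s (h, 0).
Proof.
move=> t0 s0.
rewrite (@diff_quadratic _ _ _ _ (fun h => D x0 z0 t s (h, 0)) _ rho KD k)//.
- by move=> a h1 h2; rewrite fst_lin linearP.
- by move=> h1; rewrite -(fst_norm h1); apply: (D_le RF).
move=> y yr; have yr' : `|y - x0| < r by move: yr; have := r0; lra.
rewrite !phi1E// (_ : (y - x0, 0) = (y - x0, t - t)); last by rewrite subrr.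
rewrite (_ : `|y - x0| = `|(y - x0, t - t)|); last by rewrite subrr fst_norm.
by apply: (rf_D RF).
Qed.

Lemma diff_u1 t s (h : X) : 0 <= t -> 0 <= s ->
  'd (fun x => u1_of phi1 x z0 t s) x0 h = Du t s (h, 0).
Proof.
move=> t0 s0.
rewrite (@diff_quadratic _ _ _ _ (fun h => Du t s (h, 0)) _ rho (KD * T2) (k * T2))//.
- by move=> a h1 h2; rewrite fst_lin (primitive2DD RF)// (primitive2DZ RF).
- move=> h1; rewrite -(fst_norm h1) mulrAC.
  exact: (primitive2D_le RF).
- by apply: mulr_ge0 => //; exact: ltW.
move=> y yr; have yr' : `|y - x0| < r by move: yr; have := r0; lra.
rewrite !u1E// (_ : (y - x0, 0) = (y - x0, t - t)); last by rewrite subrr.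
rewrite (_ : `|y - x0| = `|(y - x0, t - t)|); last by rewrite subrr fst_norm.
rewrite mulrAC.
by apply: (primitive2_expansion RF).
Qed.

Lemma inner_average t : 0 <= t ->
  vint 0 T2 (fun s => phi2 x0 z0 t s
    + 2^-1 *: lie_bracket_x (u1_of phi1) phi1 x0 z0 t s)
  = T2 *: avg1 t + slow_part t.
Proof.
move=> t0.
have cA := fst_c (@cu t); have cB := fst_c (@cp1 t).
have cDA := @D_comp_continuous t _ cA; have cDB := @cDu t _ cB.
have -> : vint 0 T2 (fun s => phi2 x0 z0 t s
    + 2^-1 *: lie_bracket_x (u1_of phi1) phi1 x0 z0 t s)
  = vint 0 T2 (fun s => (g0 t s + Du t s (0, 1))
     + 2^-1 *: (D x0 z0 t s (u t s, 0) + Du t s (p1 x0 z0 t s, 0))).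
  apply: eq_vint => s /andP[s0 _].
  have -> : lie_bracket_x (u1_of phi1) phi1 x0 z0 t s
      = D x0 z0 t s (u t s, 0) - Du t s (p1 x0 z0 t s, 0).
    rewrite -(phi1E xr0 t0 s0) -(u1E xr0 t0 s0).
    exact (congr2 (fun a b : X => a - b) (diff_phi1 _ t0 s0) (diff_u1 _ t0 s0)).
  rewrite (phi2E t0 s0).
  have -> : g0 t s = p2 x0 z0 t s
      - (Du t s (p1 x0 z0 t s, 0) + Du t s (0, 1)).
    rewrite -(primitive2DD RF)//; congr (_ - Du t s _).
    by congr (_, _); rewrite /= ?addr0 ?add0r.
  move: (D x0 z0 t s _) (Du t s (p1 _ _ _ _, 0)) (Du t s (0, 1)) => A B C.
  by apply/rowP => i; rewrite !mxE; field.
have cg := g0_continuous RF (t := t).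
rewrite vintD; last 2 first.
- exact (rV_continuousD cg (@cDu1 t)).
- exact (rV_continuousZ (rV_continuousD cDA cDB)).
rewrite (vintZ _ _ _ (rV_continuousD cDA cDB)) symmetric_part_mean scaler0 addr0.
by rewrite (vintD _ _ cg (@cDu1 t)) (avg1E RF).
Qed.

(** The bracket differs from twice the opposite of the product in the drift by the
    exact derivative of [symmetric_part_mean]. *)
Lemma avg_f_bar (th : 'rV[R]_(n1 + n2)) : xpart th = x0 -> zpart th = z0 ->
  f_bar phi1 phi2 T1 T2 th = avg.
Proof.
move=> xE zE; rewrite /f_bar xE zE.
have ca : continuous avg1 by exact (avg1_continuous RF).
have -> : vint 0 T1 (fun t => vint 0 T2 (fun s => phi2 x0 z0 t s
    + 2^-1 *: lie_bracket_x (u1_of phi1) phi1 x0 z0 t s))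
  = vint 0 T1 (fun t => T2 *: avg1 t + slow_part t).
  by apply: eq_vint => t /andP[t0 _]; exact: inner_average.
rewrite (vintD _ _ (rV_continuousZ ca) slow_part_continuous) slow_part_mean addr0.
have T1n : T1 != 0 by rewrite lt0r_neq0.
have T2n : T2 != 0 by rewrite lt0r_neq0.
rewrite (vintZ _ _ _ ca) -(avgE RF) [_ *: (T1 *: _)]scalerA scalerA.
have -> : (T1 * T2)^-1 * (T2 * T1) = 1 by rewrite mulrC [T2 * T1]mulrC mulfV// mulf_neq0.
by rewrite scale1r.
Qed.

End AverageIdentity.

(** * Approximate derivatives *)

Lemma addrBACA (V : zmodType) (a b c d : V) : (a + b) - (c + d) = (a - c) + (b - d).
Proof. by rewrite opprD addrACA. Qed.

Section ApproximateDerivative.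
Variable R : realType.
Implicit Types (V W : normedModType R).

(** An error on the slope is allowed because the correctors are differentiable in
    the times, but only Lipschitz in [z] and, for [sig2], in the intermediate
    time. *)
Definition apd V (f : R -> V) (t : R) (v : V) (eta : R) :=
  forall e, 0 < e -> \forall s \near t,
    `|f s - f t - (s - t) *: v| <= (eta + e) * `|s - t|.

Lemma near_dist (t e : R) : 0 < e -> \forall s \near t, `|s - t| < e.
Proof.
move=> e0; apply/nbhs_ballP; exists e => //= s.
by rewrite /ball/= distrC.
Qed.

Lemma apdD V (f g : R -> V) t v w eta eta' :
  apd f t v eta -> apd g t w eta' ->
  apd (fun s => f s + g s) t (v + w) (eta + eta').
Proof.
move=> Hf Hg e e0; have e2 : 0 < e / 2 by rewrite divr_gt0.
apply: filterS2 (Hf _ e2) (Hg _ e2) => s Fs Gs.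
rewrite scalerDr [f s + g s - _]addrBACA addrBACA.
apply: le_trans (ler_normD _ _) _; apply: le_trans (lerD Fs Gs) _.
by rewrite -mulrDl ler_wpM2r//; lra.
Qed.

Lemma apdB V (f g : R -> V) t v w eta eta' :
  apd f t v eta -> apd g t w eta' ->
  apd (fun s => f s - g s) t (v - w) (eta + eta').
Proof.
move=> Hf Hg; apply: apdD Hf _ => e e0; apply: filterS (Hg _ e0) => s.
by rewrite scalerN -normrN !opprD !opprK.
Qed.

Lemma apdZ V (f : R -> V) t v eta c : 0 <= c ->
  apd f t v eta -> apd (fun s => c *: f s) t (c *: v) (c * eta).
Proof.
move=> c0 Hf e e0; have c1 : 0 < c + 1 by rewrite ltr_wpDl.
apply: filterS (Hf (e / (c + 1)) _); last by rewrite divr_gt0.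
move=> s Fs; rewrite scalerA [_ * c]mulrC -scalerA -!scalerBr normrZ ger0_norm//.
apply: le_trans (ler_wpM2l c0 Fs) _; rewrite mulrA ler_wpM2r// mulrDr lerD2l.
by rewrite mulrCA ler_piMr ?(ltW e0)// ler_pdivrMr// mul1r lerDl.
Qed.

Lemma apd_near_eq V (f g : R -> V) t v eta :
  (forall s, f s = g s) -> apd f t v eta -> apd g t v eta.
Proof. by move=> /funext ->. Qed.

Lemma apd_lip V (f : R -> V) t v eta e : apd f t v eta -> 0 < e ->
  \forall s \near t, `|f s - f t| <= (`|v| + eta + e) * `|s - t|.
Proof.
move=> Hf e0; apply: filterS (Hf e e0) => s Fs.
rewrite -[X in `|X|](subrK ((s - t) *: v)).
apply: le_trans (ler_normD _ _) _; apply: le_trans (lerD Fs (lexx _)) _.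
by rewrite normrZ [`|s - t| * _]mulrC -mulrDl ler_wpM2r//; lra.
Qed.

Lemma apd_near V (f : R -> V) t v eta e : 0 <= eta -> apd f t v eta -> 0 < e ->
  \forall s \near t, `|f s - f t| < e.
Proof.
move=> eta0 Hf e0; have K0 : 0 < `|v| + eta + 1.
  by rewrite ltr_wpDl// addr_ge0.
apply: filterS2 (apd_lip Hf (@ltr01 R)) (near_dist t (divr_gt0 e0 K0)) => s Fs.
by rewrite ltr_pdivlMr// mulrC; exact: le_lt_trans.
Qed.

Lemma apd_slope V (f : R -> V) t v w eta e : 0 < e -> apd f t v eta ->
  \forall s \near t, `|f s - f t - (s - t) *: w| <= (eta + `|v - w| + e) * `|s - t|.
Proof.
move=> e0 /(_ e e0); apply: filterS => s Fs.
rewrite (_ : f s - f t - _ = (f s - f t - (s - t) *: v) + (s - t) *: (v - w)).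
  apply: le_trans (ler_normD _ _) _; apply: le_trans (lerD Fs (lexx _)) _.
  by rewrite normrZ [`|s - t| * _]mulrC -mulrDl ler_wpM2r//; lra.
by rewrite scalerBr subrKA.
Qed.

(** This is where a Lipschitz dependence is accounted for, as an error. *)
Lemma apd_dominated V W (f : R -> V) (sg : R -> W) t w K M : 0 <= K ->
  f t = 0 -> apd sg t w 0 -> `|w| <= M ->
  (\forall s \near t, `|f s| <= K * `|sg s - sg t|) ->
  apd f t 0 (K * M).
Proof.
move=> K0 ft Hs wM fs e e0; rewrite ft; have K1 : 0 < K + 1 by rewrite ltr_wpDl.
have eK : 0 < e / (K + 1) by rewrite divr_gt0.
apply: filterS2 fs (apd_lip Hs eK) => s Fs Ss.
rewrite scaler0 !subr0; apply: (le_trans Fs).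
apply: le_trans (ler_wpM2l K0 Ss) _; rewrite mulrA ler_wpM2r// addr0 mulrDr.
apply: lerD; first exact: ler_wpM2l.
by rewrite mulrCA ler_piMr ?(ltW e0)// ler_pdivrMr// mul1r lerDl.
Qed.

Lemma apd_comp V (Phi : R -> V) (sg : R -> R) t w v :
  (forall e, 0 < e -> exists2 q, 0 < q & forall s, 0 <= s -> `|s - sg t| < q ->
     `|Phi s - Phi (sg t) - (s - sg t) *: v| <= e * `|s - sg t|) ->
  apd sg t w 0 -> (\forall s \near t, 0 <= sg s) ->
  apd (fun s => Phi (sg s)) t (w *: v) 0.
Proof.
move=> HP Hs s0 e e0; pose K := `|w| + 1 + `|v| + 1.
have K0 : 0 < K by rewrite /K; have := normr_ge0 w; have := normr_ge0 v; lra.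
have [q q0 qP] := HP (e / K) (divr_gt0 e0 K0).
have e1 : 0 < e / K by rewrite divr_gt0.
have L := apd_lip Hs (@ltr01 R).
have N := near_dist t (divr_gt0 q0 K0).
near=> s.
have ls : `|sg s - sg t| <= (`|w| + 1) * `|s - t|.
  by rewrite -[`|w|]addr0; near: s.
have hs : `|s - t| < q / K by near: s.
have sq : `|sg s - sg t| < q.
  apply: (le_lt_trans ls); move: hs; rewrite ltr_pdivlMr//; apply: le_lt_trans.
  rewrite mulrC ler_wpM2l// /K; have := normr_ge0 v; lra.
have sg0 : 0 <= sg s by near: s.
have Ps := qP _ sg0 sq.
have Ws : `|sg s - sg t - (s - t) *: w| <= e / K * `|s - t|.
  by rewrite -[e / K]add0r; near: s; exact: Hs.
rewrite add0r.
rewrite (_ : _ - _ = (Phi (sg s) - Phi (sg t) - (sg s - sg t) *: v)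
    + (sg s - sg t - (s - t) *: w) *: v); last first.
  have -> : (sg s - sg t - (s - t) *: w) *: v =
      (sg s - sg t) *: v - (s - t) *: (w *: v) by rewrite scalerA [LHS]scalerBl.
  by rewrite addrA subrK.
apply: le_trans (ler_normD _ _) _; rewrite normrZ.
apply: le_trans (lerD Ps (ler_wpM2r (normr_ge0 _) Ws)) _.
apply: (@le_trans _ _ (e / K * ((`|w| + 1) * `|s - t|) + e / K * `|s - t| * `|v|)).
  by rewrite lerD2r ler_wpM2l ?(ltW e1).
rewrite [leLHS](_ : _ = e / K * (`|w| + 1 + `|v|) * `|s - t|); last by ring.
rewrite ler_wpM2r// mulrAC ler_pdivrMr// ler_wpM2l ?(ltW e0)// /K.
by rewrite lerDl.
Unshelve. all: by end_near. Qed.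

End ApproximateDerivative.

Lemma abs_continuous_comp (R : realType) (V W : normedModType R)
    (Y : R -> V) (F : R -> W) (a b rho C : R) :
  0 < rho -> 0 <= C -> abs_continuous_on Y a b ->
  (forall s t, a <= s <= b -> a <= t <= b -> `|Y t - Y s| <= rho ->
     `|F t - F s| <= C * `|Y t - Y s|) ->
  abs_continuous_on F a b.
Proof.
move=> rho0 C0 acY H e e0; have C1 : 0 < C + 1 by rewrite ltr_wpDl.
have e1 : 0 < Num.min rho (e / (C + 1)) by rewrite lt_min rho0 divr_gt0.
have [d d0 dP] := acY _ e1; exists d => // N u v uv tr sd.
have := dP N u v uv tr sd; rewrite lt_min => /andP[S1 S2].
have Yk (i : 'I_N) : `|Y (v i) - Y (u i)| <= rho.
  apply/ltW/(le_lt_trans _ S1).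
  by rewrite (bigD1 i)//= lerDl sumr_ge0.
apply: (@le_lt_trans _ _ (C * \sum_(i < N) `|Y (v i) - Y (u i)|)).
  rewrite mulr_sumr; apply: ler_sum => i _; apply: H => //.
    by have [au [uv' vb]] := uv i; rewrite au (le_trans uv').
  by have [au [uv' vb]] := uv i; rewrite vb (le_trans au).
move: S2; rewrite ltr_pdivlMr//; apply: le_lt_trans.
by rewrite mulrC ler_wpM2l ?lerDl// sumr_ge0.
Qed.

(** * The near-identity change of variables *)

Lemma subrDAC (V : zmodType) (a b c d : V) : a - (b + c) - d = (a - b - d) - c.
Proof. by rewrite opprD addrA [a - b - c - d]addrAC. Qed.

Lemma subrKAK (V : zmodType) (a b c : V) : (a - b) + (b - c) + c = a.
Proof. by rewrite subrKA subrK. Qed.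

#[local] Opaque primitive2 primitive2D drift g0 avg1 avg sig2 sig1 KD Kg Lg.

Section Window.
Variables (R : realType) (n1 n2 : nat).
Notation X := 'rV[R]_n1.
Notation Z := 'rV[R]_n2.
Variables (x0 : X) (z0 : Z) (r k T1 T2 : R) (p1 p2 : X -> Z -> R -> R -> X).
Variable D : X -> Z -> R -> R -> {linear (X * R)%type -> X}.
Hypothesis RF : regular_field x0 z0 r k T1 T2 p1 p2 D.

Notation rho := (r / 4).
Notation nearx x := (`|x - x0| < rho).
Notation nearz z := (`|z - z0| < rho).
Notation KD := (KD r k).
Notation Kg := (Kg r k T2).
Notation Lg := (Lg r k T2).
Notation u := (primitive2 p1).
Notation Du := (primitive2D D).
Notation drift := (drift p1 p2 D).
Notation g0 := (g0 x0 z0 p1 p2 D).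
Notation avg1 := (avg1 x0 z0 T2 p1 p2 D).
Notation avg := (avg x0 z0 T1 T2 p1 p2 D).
Notation sig2 := (sig2 x0 z0 T2 p1 p2 D).
Notation sig1 := (sig1 x0 z0 T1 T2 p1 p2 D).

Let r0 : 0 < r. Proof. exact: rf_r RF. Qed.
Let k0 : 0 <= k. Proof. exact: rf_k RF. Qed.
Let rho0 : 0 < rho. Proof. by rewrite divr_gt0. Qed.
Let T20 : 0 < T2. Proof. exact: rf_T2 RF. Qed.
Let T10 : 0 < T1. Proof. exact: rf_T1 RF. Qed.
Let KD0 : 0 <= KD. Proof. exact: KD_ge0 RF. Qed.
Let Kg0 : 0 <= Kg. Proof. exact: Kg_ge0 RF. Qed.
Let Lg0 : 0 <= Lg. Proof. exact: Lg_ge0 RF. Qed.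

(** The primitive [u] removes the terms of order [eps^-1]; [sig2] and [sig1] remove
    the oscillation of the frozen drift in the fast and in the intermediate
    time. *)
Definition corrected (eps : R) (x : X) (z : Z) (t s : R) :=
  x - (eps *: u x z t s + eps ^+ 2 *: sig2 t s + eps *: sig1 t).

Lemma corrected_le eps x z t s : 0 < eps -> eps <= 1 -> nearx x -> nearz z ->
  0 <= t -> 0 <= s ->
  `|corrected eps x z t s - x| <=
    eps * (k * T2 + (Kg + Kg) * T2 + (Kg + Kg) * T1).
Proof.
move=> e0 e1 xx zz t0 s0; rewrite /corrected addrAC subrr add0r normrN.
have eE : eps ^+ 2 <= eps by rewrite expr2 ler_piMr// ltW.
rewrite !mulrDr; apply: le_trans (ler_normD _ _) _; apply: lerD.
  apply: le_trans (ler_normD _ _) _; apply: lerD.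
    rewrite normrZ ger0_norm ?(ltW e0)// ler_wpM2l ?(ltW e0)//.
    exact: (primitive2_le RF).
  rewrite normrZ ger0_norm ?exprn_ge0 ?(ltW e0)//.
  by apply: ler_pM => //; [exact/exprn_ge0/ltW|exact: (sig2_le RF)].
rewrite normrZ ger0_norm ?(ltW e0)// ler_wpM2l ?(ltW e0)//.
exact: (sig1_le RF).
Qed.

Section Trajectory.
Variables (eps Mz : R) (x : R -> X) (z : R -> Z) (t s : R -> R) (a b tau : R).
Hypotheses (eps0 : 0 < eps) (tab : a < tau < b).
Hypothesis tube : forall q, a <= q <= b ->
  [/\ nearx (x q), nearz (z q), 0 <= t q & 0 <= s q].
Variable vz : Z.
Hypothesis vzM : `|vz| <= Mz.
Notation vx := (eps^-1 *: p1 (x tau) (z tau) (t tau) (s tau)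
                + p2 (x tau) (z tau) (t tau) (s tau)).
Hypothesis dx : apd x tau vx 0.
Hypothesis dz : apd z tau vz 0.
Hypothesis dt : apd t tau eps^-1 0.
Hypothesis ds : apd s tau (eps ^- 2) 0.

Let tube_near : \forall q \near tau,
  [/\ nearx (x q), nearz (z q), 0 <= t q & 0 <= s q].
Proof.
have tI : tau \in `]a, b[ by rewrite in_itv.
apply: filterS (near_in_itvoo tI) => q; rewrite in_itv/= => /andP[aq qb].
by apply: tube; rewrite !ltW.
Qed.

Let tube_tau : [/\ nearx (x tau), nearz (z tau), 0 <= t tau & 0 <= s tau].
Proof. by apply: tube; case/andP: tab => ? ?; rewrite !ltW. Qed.

Let Mz0 : 0 <= Mz. Proof. exact: le_trans (normr_ge0 _) vzM. Qed.

Lemma apd_u_z : apd (fun q => u (x q) (z q) (t q) (s q)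
                            - u (x q) (z tau) (t q) (s q)) tau 0 (k * T2 * Mz).
Proof.
have [_ zt _ _] := tube_tau.
refine (apd_dominated _ _ dz vzM _).
- by rewrite mulr_ge0// ltW.
- exact: subrr.
apply: filterS tube_near => q [xq zq tq sq].
by rewrite mulrAC; apply: (primitive2_z RF).
Qed.

Lemma apd_u_x : apd (fun q => u (x q) (z tau) (t q) (s q)
                            - u (x tau) (z tau) (t tau) (s q)) tau
  (Du (x tau) (z tau) (t tau) (s tau) (vx, eps^-1)) 0.
Proof.
have [xt zt tt st] := tube_tau.
move=> e e0; rewrite add0r.
pose w := `|vx| + `|eps^-1| + `|eps ^- 2| + 1.
have w0 : 0 < w by rewrite /w ltr_wpDl// !addr_ge0.
pose e1 := e / 2 / (KD * T2 + KD * T2 + 1).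
have KT0 : 0 <= KD * T2 by rewrite mulr_ge0// ltW.
have e10 : 0 < e1 by rewrite !divr_gt0// ltr_wpDl// addr_ge0.
pose e2 := e / 2 / ((k * T2 + KD) * w ^+ 2 + 1).
have KKw : 0 <= (k * T2 + KD) * w ^+ 2.
  apply: mulr_ge0; last exact/exprn_ge0/ltW.
  by apply: addr_ge0 => //; apply: mulr_ge0 => //; exact: ltW.
have e20 : 0 < e2 by rewrite !divr_gt0// ltr_wpDl.
have rw : 0 < rho / w by rewrite divr_gt0.
have Lx := apd_lip dx (@ltr01 R).
have Lt := apd_lip dt (@ltr01 R).
have Ls := apd_lip ds (@ltr01 R).
near=> q.
have [xq zq tq sq] : [/\ nearx (x q), nearz (z q), 0 <= t q & 0 <= s q] by near: q.
set h := q - tau.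
have lx : `|x q - x tau| <= w * `|h|.
  apply: (@le_trans _ _ ((`|vx| + 0 + 1) * `|h|)); first by rewrite /h; near: q.
  rewrite ler_wpM2r// addr0 /w lerD2r -addrA lerDl.
  exact: addr_ge0.
have lt : `|t q - t tau| <= w * `|h|.
  apply: (@le_trans _ _ ((`|eps^-1| + 0 + 1) * `|h|)); first by rewrite /h; near: q.
  rewrite ler_wpM2r// addr0 /w lerD2r.
  by rewrite addrAC lerDr addr_ge0.
have ls : `|s q - s tau| <= w * `|h|.
  apply: (@le_trans _ _ ((`|eps ^- 2| + 0 + 1) * `|h|)); first by rewrite /h; near: q.
  rewrite ler_wpM2r// addr0 /w lerD2r.
  by rewrite lerDr addr_ge0.
have hr : `|h| < rho / w by rewrite /h; near: q; exact: near_dist.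
have he : `|h| < e2 by rewrite /h; near: q; exact: near_dist.
set d := (x q - x tau, t q - t tau).
have ld : `|d| <= w * `|h| by rewrite prod_normE/= ge_max lx lt.
have wr : w * `|h| < r.
  by move: hr; rewrite ltr_pdivlMr// mulrC => hr; apply: lt_trans hr _; have := r0; lra.
have Ex : `|x q - x tau - h *: vx| <= e1 * `|h|.
  by rewrite /h -[e1]add0r; near: q; exact: dx.
have Et : `|t q - t tau - h *: eps^-1| <= e1 * `|h|.
  by rewrite /h -[e1]add0r; near: q; exact: dt.
have P1 : `|u (x q) (z tau) (t q) (s q) - u (x tau) (z tau) (t tau) (s q)
    - Du (x tau) (z tau) (t tau) (s q) d| <= k * `|d| ^+ 2 * T2.
  by apply: (primitive2_expansion RF) => //; apply: le_lt_trans lt wr.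
have P2 := primitive2D_s RF (t tau) xt zt (s tau) (s q) d.
have P3 : `|Du (x tau) (z tau) (t tau) (s tau) (d - h *: (vx, eps^-1))|
    <= (KD * T2 + KD * T2) * e1 * `|h|.
  apply: le_trans (primitive2D_le RF _ xt zt _ _) _.
  rewrite [leLHS]mulrAC -[leRHS]mulrA.
  have : `|d - h *: (vx, eps^-1)| <= e1 * `|h|.
    by rewrite prod_normE/= ge_max Ex Et.
  move=> H; apply: le_trans (ler_wpM2l KT0 H) _.
  apply: ler_wpM2r; last by rewrite lerDl.
  by apply: mulr_ge0 => //; exact: ltW.
rewrite (subrr (u (x tau) (z tau) (t tau) (s tau))) subr0.
set A := u (x q) _ _ _ - _ in P1 *.
set B := Du _ _ _ (s q) d in P1 P2 *; set C := Du _ _ _ (s tau) d in P2 *.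
rewrite (primitive2DB RF)// (primitive2DZ RF)// -/C in P3.
rewrite (_ : A - _ = (A - B) + (B - C) +
  (C - h *: Du (x tau) (z tau) (t tau) (s tau) (vx, eps^-1))); last first.
  by rewrite !subrKA.
apply: le_trans (ler_normD _ _) _.
apply: le_trans (lerD (le_trans (ler_normD _ _) (lerD P1 P2)) P3) _.
have Q1 : k * `|d| ^+ 2 * T2 + KD * `|d| * `|s q - s tau| <= e / 2 * `|h|.
  apply: (@le_trans _ _ ((k * T2 + KD) * w ^+ 2 * `|h| * `|h|)).
    rewrite [leRHS](_ : _ = k * (w * `|h|) ^+ 2 * T2 + KD * (w * `|h|) * (w * `|h|)).
      apply: lerD.
        rewrite ler_wpM2r ?(ltW T20)// ler_wpM2l// lerXn2r ?nnegrE//.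
        by apply: mulr_ge0 => //; exact: ltW.
      by apply: ler_pM => //; [exact: mulr_ge0|exact: ler_wpM2l].
    by ring.
  rewrite ler_wpM2r//.
  apply: (@le_trans _ _ (((k * T2 + KD) * w ^+ 2 + 1) * e2)).
    by apply: ler_pM => //; [rewrite lerDl|exact: ltW].
  by rewrite /e2 mulrC divfK// lt0r_neq0// ltr_wpDl.
have Q2 : (KD * T2 + KD * T2) * e1 <= e / 2.
  apply: (@le_trans _ _ ((KD * T2 + KD * T2 + 1) * e1)).
    by rewrite ler_wpM2r ?(ltW e10)// lerDl.
  by rewrite /e1 mulrC divfK// lt0r_neq0// ltr_wpDl// addr_ge0.
apply: le_trans (lerD Q1 (ler_wpM2r (normr_ge0 h) Q2)) _.
by rewrite -mulrDl -splitr.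
Unshelve. all: by end_near. Qed.

Let near_t : \forall q \near tau, `|t q - t tau| <= rho.
Proof. by apply: filterS (apd_near (lexx 0) dt rho0) => q /ltW. Qed.

Lemma apd_u_s : apd (fun q => u (x tau) (z tau) (t tau) (s q)) tau
  (eps ^- 2 *: p1 (x tau) (z tau) (t tau) (s tau)) 0.
Proof.
have [xt zt tt st] := tube_tau.
apply: (apd_comp _ ds).
  by move=> e e0; exact: (primitive2_derivative RF _ xt zt st e0).
by apply: filterS tube_near => q [].
Qed.

Lemma apd_sig2_t : apd (fun q => sig2 (t q) (s q) - sig2 (t tau) (s q)) tau 0
  ((Lg + Lg) * T2 * eps^-1).
Proof.
refine (apd_dominated _ _ dt _ _).
- by apply: mulr_ge0; [exact: addr_ge0|exact: ltW].
- exact: subrr.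
- by rewrite ger0_norm// invr_ge0 ltW.
apply: filterS2 tube_near near_t => q [_ _ _ sq] tq.
rewrite [leRHS](_ : _ = (Lg + Lg) * `|t q - t tau| * T2); last by ring.
by apply: (sig2_lipschitz RF).
Qed.

Lemma apd_sig2_s : apd (fun q => sig2 (t tau) (s q)) tau
  (eps ^- 2 *: (g0 (t tau) (s tau) - avg1 (t tau))) 0.
Proof.
have [xt zt tt st] := tube_tau.
apply: (apd_comp _ ds).
  by move=> e e0; exact: (sig2_derivative RF _ st e0).
by apply: filterS tube_near => q [].
Qed.

Lemma apd_sig1 : apd (fun q => sig1 (t q)) tau (eps^-1 *: (avg1 (t tau) - avg)) 0.
Proof.
have [xt zt tt st] := tube_tau.
apply: (apd_comp _ dt).
  by move=> e e0; exact: (sig1_derivative RF tt e0).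
by apply: filterS tube_near => q [].
Qed.

(* The terms of order [eps^-1] cancel, and so does the frozen drift [G] up to its
   average [A]. *)
Lemma slope_cancel (P1 P2 G A1 A S : X) :
  eps^-1 *: P1 + P2 - (eps *: (0 + S + eps ^- 2 *: P1)
    + eps ^+ 2 *: (0 + eps ^- 2 *: (G - A1)) + eps *: (eps^-1 *: (A1 - A))) - A
  = P2 - eps *: S - G.
Proof.
have en0 : eps != 0 by rewrite lt0r_neq0.
by apply/rowP => i; rewrite !mxE; field.
Qed.

(** The derivative of the corrected variable is the average up to the variation of
    the drift between the current point and ([x0], [z0]) and to terms of order
    [eps]; the derivative of [u] is taken one variable after the other. *)
Lemma apd_corrected :
  exists2 v, apd (fun q => corrected eps (x q) (z q) (t q) (s q)) tau v
      (eps * (k * T2 * Mz + (Lg + Lg) * T2))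
    & `|v - avg| <= `|drift (x tau) (z tau) (t tau) (s tau) - g0 (t tau) (s tau)|
        + eps * (KD * k * T2).
Proof.
have [xt zt tt st] := tube_tau.
have en0 : eps != 0 by rewrite lt0r_neq0.
have H := apdB dx (apdD (apdD
  (apdZ (ltW eps0) (apdD (apdD apd_u_z apd_u_x) apd_u_s))
  (apdZ (exprn_ge0 2 (ltW eps0)) (apdD apd_sig2_t apd_sig2_s)))
  (apdZ (ltW eps0) apd_sig1)).
eexists.
  rewrite (_ : eps * _ = 0 + (eps * (k * T2 * Mz + 0 + 0) +
     eps ^+ 2 * ((Lg + Lg) * T2 * eps^-1 + 0) + eps * 0)); last first.
    by field.
  refine (apd_near_eq _ H) => q.
  exact (congr1 (fun w => x q - w) (congr2 (fun v w => v + w)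
    (congr2 (fun v w => v + w) (congr1 (fun w => eps *: w) (subrKAK _ _ _))
      (congr1 (fun w => eps ^+ 2 *: w) (subrK _ _))) erefl)).
rewrite slope_cancel -(primitive2DZ RF)//.
have -> : eps *: (vx, eps^-1) = (p1 (x tau) (z tau) (t tau) (s tau), 1 : R)
    + eps *: (p2 (x tau) (z tau) (t tau) (s tau), 0).
  congr (_, _); last by rewrite /= scaler0 addr0; exact: divff.
  by rewrite /= scalerDr scalerA divff// scale1r.
rewrite (primitive2DD RF)// (primitive2DZ RF)//.
set P := Du _ _ _ _ _; set Q := Du _ _ _ _ _.
have -> : p2 (x tau) (z tau) (t tau) (s tau) - (P + eps *: Q) - g0 (t tau) (s tau)
   = (drift (x tau) (z tau) (t tau) (s tau) - g0 (t tau) (s tau)) - eps *: Q.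
  by rewrite driftE; exact: subrDAC.
apply: le_trans (ler_normB _ _) _; rewrite lerD2l normrZ ger0_norm ?(ltW eps0)//.
rewrite ler_wpM2l ?(ltW eps0)//; apply: le_trans (primitive2D_le RF _ xt zt _ _) _.
rewrite ler_wpM2r ?(ltW T20)// ler_wpM2l//.
apply: le_trans (prod_norm_le _ _) _; rewrite normr0 addr0.
by apply: (rf_le2 RF) => //; have := r0; move: xt zt; lra.
Qed.

End Trajectory.
End Window.

Section WindowEstimate.
Variables (R : realType) (n1 n2 : nat).
Notation X := 'rV[R]_n1.
Notation Z := 'rV[R]_n2.
Variables (x0 : X) (z0 : Z) (r k T1 T2 : R) (p1 p2 : X -> Z -> R -> R -> X).
Variable D : X -> Z -> R -> R -> {linear (X * R)%type -> X}.
Hypothesis RF : regular_field x0 z0 r k T1 T2 p1 p2 D.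

Notation rho := (r / 4).
Notation nearx x := (`|x - x0| < rho).
Notation nearz z := (`|z - z0| < rho).
Notation KD := (KD r k).
Notation Kg := (Kg r k T2).
Notation Lg := (Lg r k T2).
Notation u := (primitive2 p1).
Notation Du := (primitive2D D).
Notation avg := (avg x0 z0 T1 T2 p1 p2 D).
Notation sig2 := (sig2 x0 z0 T2 p1 p2 D).
Notation sig1 := (sig1 x0 z0 T1 T2 p1 p2 D).
Notation corrected := (corrected x0 z0 T1 T2 p1 p2 D).

Let r0 : 0 < r. Proof. exact: rf_r RF. Qed.
Let k0 : 0 <= k. Proof. exact: rf_k RF. Qed.
Let rho0 : 0 < rho. Proof. by rewrite divr_gt0. Qed.
Let T20 : 0 < T2. Proof. exact: rf_T2 RF. Qed.
Let T10 : 0 < T1. Proof. exact: rf_T1 RF. Qed.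
Let KD0 : 0 <= KD. Proof. exact: KD_ge0 RF. Qed.
Let Kg0 : 0 <= Kg. Proof. exact: Kg_ge0 RF. Qed.
Let Lg0 : 0 <= Lg. Proof. exact: Lg_ge0 RF. Qed.

Definition Cu := k * T2 + (k * rho + KD) * T2 + k.
Definition Cs := (Lg + Lg) * T2 + (Kg + Kg).

Lemma u_increment x x' z z' t t' s s' w :
  nearx x -> nearx x' -> nearz z -> nearz z' -> 0 <= s -> 0 <= s' -> w <= rho ->
  `|x' - x| <= w -> `|z' - z| <= w -> `|t' - t| <= w -> `|s' - s| <= w ->
  `|u x' z' t' s' - u x z t s| <= Cu * w.
Proof.
move=> xx xx' zz zz' s0 s0' wr xw zw tw sw.
have w0 : 0 <= w by apply: le_trans xw.
set d := (x' - x, t' - t).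
have dw : `|d| <= w by rewrite prod_normE/= ge_max xw tw.
have E1 := primitive2_z RF t' xx' zz zz' s0'.
have E2 : `|u x' z t' s' - u x z t s' - Du x z t s' d| <= k * `|d| ^+ 2 * T2.
  by apply: (primitive2_expansion RF) => //; apply: le_lt_trans (le_trans tw wr) _; have := r0; lra.
have E3 := primitive2D_le RF t xx zz s' d.
have E4 := primitive2_s RF t xx zz s s'.
have -> : u x' z' t' s' - u x z t s = (u x' z' t' s' - u x' z t' s')
    + ((u x' z t' s' - u x z t s' - Du x z t s' d + Du x z t s' d)
       + (u x z t s' - u x z t s)).
  move: (u x' z' t' s') (u x' z t' s') (u x z t s') (u x z t s) (Du x z t s' d).
  by move=> A B C E F; rewrite subrK !subrKA.
apply: le_trans (ler_normD _ _) _; rewrite (_ : Cu * w = k * T2 * w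
  + ((k * (rho * w) * T2 + KD * w * T2) + k * w)); last by rewrite /Cu; ring.
apply: lerD.
  apply: (le_trans E1); rewrite mulrAC ler_wpM2l//.
  by apply: mulr_ge0 => //; exact: ltW.
apply: le_trans (ler_normD _ _) _; apply: lerD; last first.
  by apply: (le_trans E4); rewrite ler_wpM2l.
apply: le_trans (ler_normD _ _) _; apply: lerD.
  apply: (le_trans E2).
  rewrite ler_wpM2r ?(ltW T20)// ler_wpM2l// expr2.
  by apply: ler_pM => //; exact: le_trans dw wr.
apply: (le_trans E3).
by rewrite ler_wpM2r ?(ltW T20)// ler_wpM2l.
Qed.

Lemma sig2_increment t t' s s' w : 0 <= s -> 0 <= s' -> w <= rho ->
  `|t' - t| <= w -> `|s' - s| <= w -> `|sig2 t' s' - sig2 t s| <= Cs * w.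
Proof.
move=> s0 s0' wr tw sw.
have E1 : `|sig2 t' s' - sig2 t s'| <= (Lg + Lg) * `|t' - t| * T2.
  by apply: (sig2_lipschitz RF) => //; exact: le_trans tw wr.
have E2 := sig2_s RF t s s'.
have -> : sig2 t' s' - sig2 t s = (sig2 t' s' - sig2 t s') + (sig2 t s' - sig2 t s).
  by move: (sig2 t' s') (sig2 t s') (sig2 t s) => A B C; rewrite subrKA.
apply: le_trans (ler_normD _ _) _; rewrite /Cs mulrDl; apply: lerD.
  apply: (le_trans E1); rewrite mulrAC ler_wpM2l//.
  by apply: mulr_ge0; [exact: addr_ge0|exact: ltW].
by apply: (le_trans E2); rewrite ler_wpM2l// addr_ge0.
Qed.

(** Integrate the derivative of the corrected variable, which is within [eta] of the
    average as long as the trajectory stays close to ([x0], [z0]); the correction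
    itself contributes the term [c * eps].  The function [Y] carries the absolute
    continuity of the four components. *)
Lemma averaged_window (Mz eta : R) : 0 <= Mz -> 0 < eta ->
  exists d c eps0, [/\ 0 < d, 0 <= c, 0 < eps0 &
  forall eps, 0 < eps -> eps <= eps0 ->
  forall (V : normedModType R) (Y : R -> V) (x : R -> X) (z : R -> Z) (t s : R -> R) a b,
  a <= b -> abs_continuous_on Y a b ->
  (forall q q', [/\ `|x q' - x q| <= `|Y q' - Y q|, `|z q' - z q| <= `|Y q' - Y q|,
     `|t q' - t q| <= `|Y q' - Y q| & `|s q' - s q| <= `|Y q' - Y q|]) ->
  (forall q, a <= q <= b ->
     [/\ `|x q - x0| <= d, `|z q - z0| <= d, 0 <= t q & 0 <= s q]) ->
  {ae (@lebesgue_measure R), forall q, a < q < b -> exists2 vz, `|vz| <= Mz &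
     [/\ apd x q (eps^-1 *: p1 (x q) (z q) (t q) (s q)
                  + p2 (x q) (z q) (t q) (s q)) 0,
         apd z q vz 0, apd t q eps^-1 0 & apd s q (eps ^- 2) 0]} ->
  `|x b - x a - (b - a) *: avg| <= eta * (b - a) + c * eps].
Proof.
move=> Mz0 eta0.
have e4 : 0 < eta / 4 by rewrite divr_gt0.
have [d1 d10 d1P] := drift_near RF e4.
have kT2 : 0 <= k * T2 := mulr_ge0 k0 (ltW T20).
have KKg : 0 <= Kg + Kg := addr_ge0 Kg0 Kg0.
have LLT : 0 <= (Lg + Lg) * T2 := mulr_ge0 (addr_ge0 Lg0 Lg0) (ltW T20).
have krho : 0 <= k * rho := mulr_ge0 k0 (ltW rho0).
pose C0 := k * T2 + (Kg + Kg) * T2 + (Kg + Kg) * T1.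
have C00 : 0 <= C0.
  exact: addr_ge0 (addr_ge0 kT2 (mulr_ge0 KKg (ltW T20))) (mulr_ge0 KKg (ltW T10)).
pose C1 := k * T2 * Mz + (Lg + Lg) * T2.
pose C2 := KD * k * T2.
have C10 : 0 <= C1.
  exact: addr_ge0 (mulr_ge0 kT2 Mz0) LLT.
have C20 : 0 <= C2 by apply: mulr_ge0; [exact: mulr_ge0|exact: ltW].
have C12 : 0 < C1 + C2 + 1 by rewrite ltr_wpDl// addr_ge0.
exists (Num.min d1 (rho / 2)), (C0 + C0), (Num.min 1 (eta / 4 / (C1 + C2 + 1))).
split; [by rewrite lt_min d10 divr_gt0|exact: addr_ge0|by rewrite lt_min ltr01 divr_gt0|].
move=> eps eps0; rewrite le_min => /andP[eps1 epsC].
have eC : eps * (C1 + C2) <= eta / 4.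
  move: epsC; rewrite ler_pdivlMr//; apply: le_trans.
  by rewrite ler_wpM2l ?(ltW eps0)// lerDl.
move=> V Y x z t s a b ab acY dom tube0 aeq.
have tube q : a <= q <= b -> [/\ nearx (x q), nearz (z q), 0 <= t q & 0 <= s q].
  move=> /tube0[]; rewrite !le_min => /andP[_ xq] /andP[_ zq] tq sq.
  by split => //; have := rho0; lra.
have drq q : a <= q <= b -> `|drift p1 p2 D (x q) (z q) (t q) (s q)
     - g0 x0 z0 p1 p2 D (t q) (s q)| <= eta / 4.
  by move=> /tube0[]; rewrite !le_min => /andP[xq _] /andP[zq _] tq sq; exact: d1P.
pose F q := corrected eps (x q) (z q) (t q) (s q).
have Cu0 : 0 <= Cu.
  exact: addr_ge0 (addr_ge0 kT2 (mulr_ge0 (addr_ge0 krho KD0) (ltW T20))) k0.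
have Cs0 : 0 <= Cs.
  exact: addr_ge0 LLT KKg.
have acF : abs_continuous_on F a b.
  apply: (@abs_continuous_comp _ _ _ Y F a b rho
    (1 + (eps * Cu + eps ^+ 2 * Cs + eps * (Kg + Kg)))) => //.
    apply: addr_ge0 => //; apply: addr_ge0; first apply: addr_ge0.
    - by apply: mulr_ge0 => //; exact: ltW.
    - by apply: mulr_ge0 => //; exact/exprn_ge0/ltW.
    - by apply: mulr_ge0; [exact: ltW|exact: addr_ge0].
  move=> q q' /tube[xq zq tq sq] /tube[xq' zq' tq' sq'] wr.
  have [dx dz dt ds] := dom q q'.
  rewrite /F /corrected.
  rewrite (_ : _ - _ = (x q' - x q) - (eps *: (u (x q') (z q') (t q') (s q') - u (x q) (z q) (t q) (s q))
    + eps ^+ 2 *: (sig2 (t q') (s q') - sig2 (t q) (s q))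
    + eps *: (sig1 (t q') - sig1 (t q)))); last first.
    move: (u _ _ _ _) (u _ _ _ _) (sig2 _ _) (sig2 _ _) (sig1 _) (sig1 _).
    by move=> A A' B B' E E'; rewrite !scalerBr -!addrBACA subrACA.
  apply: le_trans (ler_normB _ _) _; rewrite mulrDl mul1r; apply: lerD => //.
  apply: le_trans (ler_normD _ _) _; rewrite mulrDl; apply: lerD.
    apply: le_trans (ler_normD _ _) _; rewrite mulrDl; apply: lerD.
      rewrite normrZ ger0_norm ?(ltW eps0)// -mulrA ler_wpM2l ?(ltW eps0)//.
      exact: u_increment.
    rewrite normrZ ger0_norm; last exact/exprn_ge0/ltW.
    rewrite [leRHS](_ : _ = eps ^+ 2 * (Cs * `|Y q' - Y q|)); last by rewrite mulrA.
    by apply: ler_wpM2l; [exact/exprn_ge0/ltW|exact: sig2_increment].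
  rewrite normrZ ger0_norm ?(ltW eps0)// -mulrA ler_wpM2l ?(ltW eps0)//.
  apply: le_trans (sig1_t RF _ _) _.
  by rewrite ler_wpM2l// addr_ge0.
have FE : `|F b - F a - (b - a) *: avg| <= eta * (b - a).
  apply/ler_addgt0Pr => e e0.
  have [|||_ -> //] := @mean_value_convex R n1 F [set avg] a b eta ab (ltW eta0) acF _ _ _ e e0.
  - by exists avg.
  - by move=> p q c c' -> -> _ _ /= cc; rewrite -scalerDl cc scale1r.
  apply: ae_imply aeq => q H /[dup] qab /H[vz vzM [dx dz dt ds]].
  exists avg => //.
  have [v dF vE] := apd_corrected RF eps0 qab tube vzM dx dz dt ds.
  have := apd_slope avg e4 dF; apply: filterS => q' /le_trans; apply.
  rewrite ler_wpM2r//.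
  have qab' : a <= q <= b by case/andP: qab => ? ?; rewrite !ltW.
  have := drq q qab'; rewrite -/C1 -/C2 in vE *.
  rewrite mulrDr in eC; move: vE eC; rewrite -/C2; lra.
have [xa za ta sa] := tube a ltac:(by rewrite lexx ab).
have [xb zb tb sb] := tube b ltac:(by rewrite lexx ab).
have Ea := corrected_le RF eps0 eps1 xa za ta sa.
have Eb := corrected_le RF eps0 eps1 xb zb tb sb.
rewrite (_ : x b - x a - _ = (F b - F a - (b - a) *: avg) - ((F b - x b) - (F a - x a))).
  apply: le_trans (ler_normB _ _) _; apply: lerD => //.
  apply: le_trans (ler_normB _ _) _; rewrite mulrDl.
  by apply: lerD; rewrite mulrC.
rewrite [F b - x b - _]subrACA [F b - F a - (b - a) *: avg - _]subrACA.
by rewrite subrr sub0r opprD opprK addrC.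
Qed.

End WindowEstimate.

(** * Extension of the fields to all times *)

Section Wrap.
Variable R : realType.

(** The representative of [t] modulo [T] in the interval from [0] to [T]. *)
Definition wrap (T t : R) := t - T * (Num.floor (t / T))%:~R.

Lemma wrap_itv T t : 0 < T -> 0 <= wrap T t < T.
Proof.
move=> T0; rewrite /wrap; set m := Num.floor _.
have /andP[m1 m2] := floor_itv (t / T); rewrite -/m in m1 m2.
rewrite ler_pdivlMr// in m1; rewrite ltr_pdivrMr// intrD mulrDl in m2.
by apply/andP; split; [rewrite subr_ge0 mulrC|rewrite ltrBlDl mulrC; move: m2; rewrite mul1r].
Qed.

Lemma wrap_shift T t (m : int) : 0 < T -> wrap T (t + T * m%:~R) = wrap T t.
Proof.
move=> T0; have Tn : T != 0 by rewrite lt0r_neq0.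
rewrite /wrap mulrDl [T * _ / T]mulrAC divff// mul1r floorDrz ?intr_int//.
rewrite intrKfloor intrD mulrDr; ring.
Qed.

Lemma wrapD T t : 0 < T -> wrap T (t + T) = wrap T t.
Proof. by move=> T0; rewrite -(wrap_shift t 1 T0) mulr1. Qed.

(** Periodicity is only assumed at nonnegative times, whence the induction on the
    number of periods. *)
Lemma wrap_periodic (V : Type) (f : R -> V) T t : 0 < T ->
  (forall s, 0 <= s -> f (s + T) = f s) -> 0 <= t -> f (wrap T t) = f t.
Proof.
move=> T0 fT t0.
have : 0 <= Num.floor (t / T) by rewrite floor_ge_int/= divr_ge0// ltW.
have := wrap_itv t T0; rewrite /wrap.
case: (Num.floor (t / T)) => // n /andP[w0 _] _; move: w0.
set w := t - _ => w0; have -> : t = w + T * n%:R by rewrite /w subrK.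
clearbody w; elim: n w w0 => [|n IH] w w0; first by rewrite mulr0 addr0.
have wn : 0 <= w + T * n%:R.
  by apply: addr_ge0 => //; apply: mulr_ge0; [exact: ltW|exact: ler0n].
have -> : w + T * n.+1%:R = w + T * n%:R + T by rewrite -natr1 mulrDr mulr1 addrA.
by rewrite (fT _ wn); exact: IH.
Qed.

End Wrap.

Lemma klipschitzP (R : realType) (V W : normedModType R) (A : set V) (f : V -> W) k :
  k.-lipschitz_A f -> forall a b, A a -> A b -> `|f a - f b| <= k * `|a - b|.
Proof. by move=> H a b Aa Ab; exact: (H (a, b)). Qed.

Lemma nbhs_radius (R : realType) (V : normedModType R) (v : V) (A : set V) :
  nbhs v A -> exists2 q, 0 < q & forall y, `|y - v| < q -> A y.
Proof.
move=> /nbhs_normP[q /= q0 qA]; exists q => // y yv; apply: qA => /=.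
by rewrite distrC.
Qed.

Lemma within_continuous_near (R : realType) (V : normedModType R) (f : R -> V) (s e : R) :
  {within `[0, +oo[, continuous f} -> 0 < s -> 0 < e ->
  \forall s' \near s, `|f s' - f s| < e.
Proof.
move=> cf s0 e0.
have cpos : {within `]0, +oo[, continuous f}.
  by apply: continuous_subspaceW cf => y /=; rewrite !in_itv/= !andbT => /ltW.
have sI : `]0, +oo[%classic s by rewrite /= in_itv/= s0.
have := cpos; rewrite continuous_open_subspace; last exact: interval_open.
move=> /(_ s (mem_set sI)) /cvgrPdist_lt/(_ e e0); apply: filterS => s'.
by rewrite distrC.
Qed.

(** Subtract the linear part and bound the slopes along the segment from [v] to
    [v + d].  The derivative is only required relative to this segment, since the
    domain of the fields is not open. *)
Lemma taylor_quadratic (R : realType) (V : normedModType R) (n : nat)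
    (f : V -> 'rV[R]_n) (L : V -> {linear V -> 'rV[R]_n}) (v d : V) (k : R) :
  0 <= k ->
  (forall c, 0 <= c <= 1 -> forall e, 0 < e -> \forall y \near v + c *: d,
     (exists2 s, 0 <= s <= 1 & y = v + s *: d) ->
     `|f y - f (v + c *: d) - L (v + c *: d) (y - (v + c *: d))|
        <= e * `|y - (v + c *: d)|) ->
  (forall c, 0 <= c <= 1 -> `|L (v + c *: d) d - L v d| <= k * `|d| ^+ 2) ->
  `|f (v + d) - f v - L v d| <= k * `|d| ^+ 2.
Proof.
move=> k0 Hd HL; pose g s := f (v + s *: d) - s *: L v d.
suff : `|g 1 - g 0| <= k * `|d| ^+ 2.
  by rewrite /g !scale1r !scale0r addr0 subr0 addrAC.
apply: (le_forall_eps (c := `|d|)) => // e e0.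
suff : `|g 1 - g 0| <= (k * `|d| ^+ 2 + e * `|d|) * (1 - 0) by rewrite subr0 mulr1.
apply: cousin_lipschitz => // c c01.
have /nbhs_radius[q q0 qP] := Hd c c01 e e0.
exists (q / (`|d| + 1)); first by rewrite divr_gt0// ltr_wpDl.
have loc s : 0 <= s <= 1 -> `|s - c| < q / (`|d| + 1) ->
    `|f (v + s *: d) - f (v + c *: d) - (s - c) *: L v d|
      <= (k * `|d| ^+ 2 + e * `|d|) * `|s - c|.
  move=> s01; rewrite ltr_pdivlMr ?ltr_wpDl// => sc.
  have E : v + s *: d - (v + c *: d) = (s - c) *: d.
    by rewrite scalerBl addrAC opprD addrA subrr sub0r addrC.
  have := qP (v + s *: d); rewrite E normrZ.
  have sq : `|s - c| * `|d| < q.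
    by apply: le_lt_trans sc; rewrite ler_wpM2l// lerDl.
  move=> /(_ sq (ex_intro2 _ _ s s01 erefl)); rewrite linearZ => H.
  have H2 := HL c c01.
  rewrite (_ : _ - _ = (f (v + s *: d) - f (v + c *: d) - (s - c) *: L (v + c *: d) d)
    + (s - c) *: (L (v + c *: d) d - L v d)); last by rewrite scalerBr subrKA.
  apply: le_trans (ler_normD _ _) _; rewrite normrZ.
  apply: le_trans (lerD H (ler_wpM2l (normr_ge0 _) H2)) _.
  by rewrite le_eqVlt; apply/orP; left; apply/eqP; ring.
move=> a b [a0 ac cb b1] ca bc.
have fb : `|f (v + b *: d) - f (v + c *: d) - (b - c) *: L v d|
      <= (k * `|d| ^+ 2 + e * `|d|) * (b - c).
  have := loc b; rewrite b1 (le_trans a0 (le_trans ac cb)) => /(_ isT).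
  rewrite ger0_norm ?subr_ge0//; apply; lra.
have fa : `|f (v + a *: d) - f (v + c *: d) - (a - c) *: L v d|
      <= (k * `|d| ^+ 2 + e * `|d|) * (c - a).
  have := loc a; rewrite a0 (le_trans ac (le_trans cb b1)) => /(_ isT).
  rewrite distrC ger0_norm ?subr_ge0//; apply; lra.
rewrite (_ : g b - g a = (f (v + b *: d) - f (v + c *: d) - (b - c) *: L v d)
   - (f (v + a *: d) - f (v + c *: d) - (a - c) *: L v d)); last first.
  by apply/rowP => i; rewrite !mxE; ring.
apply: le_trans (ler_normB _ _) _; apply: le_trans (lerD fb fa) _.
by rewrite -mulrDr subrKA.
Qed.

Lemma linear_basis_le (R : realType) (n m : nat)
    (L : {linear ('rV[R]_n * R)%type -> 'rV[R]_m}) (K : R) :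
  (forall i, `|L (delta_mx 0 i, 0)| <= K) -> `|L (0, 1)| <= K ->
  forall h, `|L h| <= (n%:R + 1) * K * `|h|.
Proof.
move=> Li L1 [x t].
have xE : (x, t) = \sum_i x 0 i *: (delta_mx 0 i : 'rV[R]_n, 0 : R) + t *: (0, 1).
  have S1 : \sum_i x 0 i *: (delta_mx 0 i : 'rV[R]_n, 0 : R) = (x, 0).
    rewrite [in RHS](row_sum_delta x).
    rewrite (big_morph (fun y => (y, 0 : R)) (id1 := 0) (op1 := +%R))//.
      by apply: eq_bigr => i _; congr (_, _); rewrite /= scaler0.
    by move=> a b; congr (_, _); rewrite /= addr0.
  rewrite S1; congr (_, _); first by rewrite /= scaler0 addr0.
  by rewrite /= add0r; exact: (esym (mulr1 t)).
have K0 : 0 <= K by exact: le_trans (normr_ge0 _) L1.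
have xle i : `|x 0 i| <= `|(x, t)|.
  by apply: le_trans (rV_coord_le x i) (prod_norm_fst (x, t)).
rewrite {1}xE linearD linear_sum linearZ.
apply: le_trans (ler_normD _ _) _; rewrite -mulrA mulrDl mul1r; apply: lerD; last first.
  by rewrite normrZ mulrC; apply: ler_pM => //; exact: (prod_norm_snd (x, t)).
apply: le_trans (ler_norm_sum _ _ _) _.
apply: (@le_trans _ _ (\sum_(i < n) K * `|(x, t)|)).
  by apply: ler_sum => i _; rewrite linearZ normrZ mulrC; apply: ler_pM.
by rewrite sumr_const card_ord mulr_natl.
Qed.

Section LocalBounds.
Variables (R : realType) (n1 n2 : nat).
Notation X := 'rV[R]_n1.
Notation Z := 'rV[R]_n2.
Variables (S : set 'rV[R]_(n1 + n2)) (phi1 phi2 : vfield R n1 n2) (T1 T2 : R).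
Hypotheses (T10 : 0 < T1) (T20 : 0 < T2).
Hypothesis REG : regular_on S phi1 phi2 T1 T2.
Variables (x0 : X) (z0 : Z) (r1 : R).
Hypothesis r10 : 0 < r1.
Hypothesis ballS : forall x z, `|x - x0| < r1 -> `|z - z0| < r1 -> S (row_mx x z).

Let dom (x : X) (z : Z) (t s : R) := [/\ S (row_mx x z), 0 <= t & 0 <= s].
Let dom_xt := [set p : (X * R) * (Z * R) | dom p.1.1 p.2.1 p.1.2 p.2.2].
Let dom_z := [set p : Z * (X * R * R) | dom p.2.1.1 p.1 p.2.1.2 p.2.2].
Let wrt_xt (phi : vfield R n1 n2) := fun (v : X * R) (w : Z * R) => phi v.1 w.1 v.2 w.2.
Let wrt_z (phi : vfield R n1 n2) := fun (z : Z) (w : X * R * R) => phi w.1.1 z w.1.2 w.2.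

Variable Df : X * R -> Z * R -> {linear (X * R)%type -> X}.
Hypothesis Df_diff : has_derivative_wrt dom_xt (wrt_xt phi1) Df.
Hypothesis Df_lip : forall v w, dom_xt (v, w) ->
  exists (A : set (X * R)) (B : set (Z * R)) (k : R), [/\ nbhs v A, nbhs w B &
    forall w', B w' -> forall h : X * R,
      (k * `|h|).-lipschitz_(A `&` [set v' | dom_xt (v', w')]) (fun v' => Df v' w' h)].

Let pair_lt (V W : normedModType R) (a c : V) (b d : W) q :
  `|a - c| < q -> `|b - d| < q -> `|(a, b) - (c, d)| < q.
Proof. by move=> h1 h2; rewrite prod_normE/= gt_max h1 h2. Qed.

(** The radius and the constant are governed by the same parameter: decreasing [e]
    weakens the property, so that a common [e] exists over a compact set of
    times. *)
Definition regular_at (e : R) (ts : R * R) := forall x x' z z' t',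
  `|x - x0| < e -> `|x' - x0| < e -> `|z - z0| < e -> `|z' - z0| < e ->
  `|t' - ts.1| < e ->
  [/\ `|phi1 x z ts.1 ts.2| <= e^-1, `|phi2 x z ts.1 ts.2| <= e^-1,
      `|phi1 x z' ts.1 ts.2 - phi1 x z ts.1 ts.2| <= e^-1 * `|z' - z|,
      `|phi2 x z' ts.1 ts.2 - phi2 x z ts.1 ts.2| <= e^-1 * `|z' - z| &
      `|phi2 x' z t' ts.2 - phi2 x z ts.1 ts.2| <= e^-1 * `|(x' - x, t' - ts.1)| /\
      `|phi1 x' z t' ts.2 - phi1 x z ts.1 ts.2
          - Df (x, ts.1) (z, ts.2) (x' - x, t' - ts.1)|
        <= e^-1 * `|(x' - x, t' - ts.1)| ^+ 2].

Lemma phi1_taylor t s : 0 < t -> 0 < s -> exists q k, [/\ 0 < q, 0 <= k &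
  forall x x' z t1 t2 s1,
  `|x - x0| < q -> `|x' - x0| < q -> `|z - z0| < q ->
  `|t1 - t| < q -> `|t2 - t| < q -> `|s1 - s| < q ->
  `|phi1 x' z t2 s1 - phi1 x z t1 s1 - Df (x, t1) (z, s1) (x' - x, t2 - t1)|
     <= k * `|(x' - x, t2 - t1)| ^+ 2].
Proof.
move=> t0 s0; have ball00 : S (row_mx x0 z0) by apply: ballS; rewrite subrr normr0.
have [|A [B [k [/nbhs_radius[qA qA0 HA] /nbhs_radius[qB qB0 HB] HL]]]] :=
  Df_lip (v := (x0, t)) (w := (z0, s)).
  by split=> //=; exact: ltW.
pose q := Num.min (Num.min qA qB) (Num.min r1 (Num.min t s)).
have q0 : 0 < q by rewrite !lt_min qA0 qB0 r10 t0.
have [qA' qB' qr qt qs] : [/\ q <= qA, q <= qB, q <= r1, q <= t & q <= s].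
  by rewrite /q !ge_min !lexx ?orbT.
exists q, `|k|; split => // x x' z t1 t2 s1 xx xx' zz tt1 tt2 ss.
pose v := (x, t1); pose w := (z, s1); pose d : X * R := (x' - x, t2 - t1).
have Bw : B w by apply: HB; apply: lt_le_trans qB'; exact: pair_lt.
have s10 : 0 <= s1 by move: ss; rewrite ltr_distl => /andP[h _]; lra.
have inb c : 0 <= c <= 1 -> `|(v + c *: d).1 - x0| < q /\ `|(v + c *: d).2 - t| < q.
  move=> /andP[c0 c1]; split => /=.
    rewrite (_ : _ - x0 = (1 - c) *: (x - x0) + c *: (x' - x0)); last first.
      by apply/rowP => i; rewrite !mxE; ring.
    apply: le_lt_trans (ler_normD _ _) _; rewrite !normrZ !ger0_norm// ?subr_ge0//.
    have [->|cn] := eqVneq c 0; first by rewrite subr0 mul1r mul0r addr0.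
    have cp : 0 < c by rewrite lt_neqAle eq_sym cn.
    apply: (@lt_le_trans _ _ ((1 - c) * q + c * q)); last by rewrite -mulrDl subrK mul1r.
    by apply: ler_ltD; [rewrite ler_wpM2l ?subr_ge0// ltW|rewrite ltr_pM2l].
  rewrite (_ : _ - t = (1 - c) * (t1 - t) + c * (t2 - t)); last first.
    by rewrite -[c *: _]/(c * (t2 - t1)); ring.
  apply: le_lt_trans (ler_normD _ _) _; rewrite !normrM !(@ger0_norm _ c)// (@ger0_norm _ (1 - c)) ?subr_ge0//.
  have [->|cn] := eqVneq c 0; first by rewrite subr0 mul1r mul0r addr0.
  have cp : 0 < c by rewrite lt_neqAle eq_sym cn.
  apply: (@lt_le_trans _ _ ((1 - c) * q + c * q)); last by rewrite -mulrDl subrK mul1r.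
  by apply: ler_ltD; [rewrite ler_wpM2l ?subr_ge0// ltW|rewrite ltr_pM2l].
have ind c : 0 <= c <= 1 -> dom_xt (v + c *: d, w).
  move=> /inb[h1 h2]; split => //=.
    by apply: ballS; [exact: lt_le_trans h1 qr|exact: lt_le_trans zz qr].
  by move: h2; rewrite /= ltr_distl => /andP[h _]; lra.
have inA c : 0 <= c <= 1 -> (A `&` [set v' | dom_xt (v', w)]) (v + c *: d).
  move=> c01; split; last exact: ind.
  have [h1 h2] := inb c c01; apply: HA; apply: lt_le_trans qA'.
  by rewrite [v + c *: d]surjective_pairing; exact: pair_lt.
have E := @taylor_quadratic R _ n1 (fun v => wrt_xt phi1 v w) (Df ^~ w) v d `|k|
  (normr_ge0 _).
have vd : v + d = (x', t2) by congr (_, _); rewrite /= addrC subrK.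
rewrite vd in E; apply: E.
- move=> c c01 e e0; have [_ /(_ e e0)] := Df_diff (ind c c01).
  apply: filterS => y Hy [c' c'01 yE]; apply: Hy; rewrite yE /=.
  exact: ind.
- move=> c c01; have v0 : v = v + 0 *: d by rewrite scale0r addr0.
  have c00 : (0 : R) <= (0 : R) <= 1 by apply/andP; split.
  have := klipschitzP (HL w Bw d) (inA c c01) (inA 0 c00); rewrite -v0 => /le_trans; apply.
  rewrite addrAC subrr add0r normrZ.
  case/andP: c01 => c0' c1; rewrite (ger0_norm c0').
  rewrite [leLHS](_ : _ = k * c * `|d| ^+ 2); last by ring.
  rewrite ler_wpM2r ?exprn_ge0//.
  apply: (@le_trans _ _ (`|k| * c)); first by rewrite ler_wpM2r// ler_norm.
  by rewrite ler_piMr.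
Qed.

Lemma phi_z t s : 0 < t -> 0 < s -> forall phi, phi = phi1 \/ phi = phi2 ->
  exists q k, [/\ 0 < q, 0 <= k &
  forall x z z' t1 s1,
  `|x - x0| < q -> `|z - z0| < q -> `|z' - z0| < q -> `|t1 - t| < q -> `|s1 - s| < q ->
  `|phi x z' t1 s1 - phi x z t1 s1| <= k * `|z' - z|].
Proof.
move=> t0 s0 phi Hphi; have ball00 : S (row_mx x0 z0).
  by apply: ballS; rewrite subrr normr0.
have [_ [C1 C2] _ _ _] := REG.
have C : class_C0_wrt dom_z (wrt_z phi) by case: Hphi => ->.
have [|A [B [k [/nbhs_radius[qA qA0 HA] /nbhs_radius[qB qB0 HB] HL]]]] :=
  C z0 (x0, t, s).
  by split=> //=; exact: ltW.
pose q := Num.min (Num.min qA qB) (Num.min r1 (Num.min t s)).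
have q0 : 0 < q by rewrite !lt_min qA0 qB0 r10 t0.
have [qA' qB' qr qt qs] : [/\ q <= qA, q <= qB, q <= r1, q <= t & q <= s].
  by rewrite /q !ge_min !lexx ?orbT.
exists q, `|k|; split => // x z z' t1 s1 xx zz zz' tt ss.
have Bw : B (x, t1, s1).
  by apply: HB; apply: lt_le_trans qB'; apply: pair_lt => //; exact: pair_lt.
have inA y : `|y - z0| < q -> (A `&` [set v' | dom_z (v', (x, t1, s1))]) y.
  move=> yq; split; first by apply: HA; exact: lt_le_trans yq qA'.
  split=> //=.
  - by apply: ballS; [exact: lt_le_trans xx qr|exact: lt_le_trans yq qr].
  - by move: tt; rewrite ltr_distl => /andP[h _]; lra.
  - by move: ss; rewrite ltr_distl => /andP[h _]; lra.
have := klipschitzP (HL _ Bw) (inA _ zz') (inA _ zz) => /le_trans; apply.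
by rewrite ler_wpM2r// ler_norm.
Qed.

Lemma phi2_x t s : 0 < t -> 0 < s -> exists q k, [/\ 0 < q, 0 <= k &
  forall x x' z t1 t2 s1,
  `|x - x0| < q -> `|x' - x0| < q -> `|z - z0| < q ->
  `|t1 - t| < q -> `|t2 - t| < q -> `|s1 - s| < q ->
  `|phi2 x' z t2 s1 - phi2 x z t1 s1| <= k * `|(x' - x, t2 - t1)|].
Proof.
move=> t0 s0; have ball00 : S (row_mx x0 z0).
  by apply: ballS; rewrite subrr normr0.
have [[_ C] _ _ _ _] := REG.
have [|A [B [k [/nbhs_radius[qA qA0 HA] /nbhs_radius[qB qB0 HB] HL]]]] :=
  C (x0, t) (z0, s).
  by split=> //=; exact: ltW.
pose q := Num.min (Num.min qA qB) (Num.min r1 (Num.min t s)).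
have q0 : 0 < q by rewrite !lt_min qA0 qB0 r10 t0.
have [qA' qB' qr qt qs] : [/\ q <= qA, q <= qB, q <= r1, q <= t & q <= s].
  by rewrite /q !ge_min !lexx ?orbT.
exists q, `|k|; split => // x x' z t1 t2 s1 xx xx' zz tt tt' ss.
have Bw : B (z, s1).
  by apply: HB; apply: lt_le_trans qB'; exact: pair_lt.
have inA y (a : R) : `|y - x0| < q -> `|a - t| < q ->
    (A `&` [set v' | dom_xt (v', (z, s1))]) (y, a).
  move=> yq aq; split; first by apply: HA; apply: lt_le_trans qA'; exact: pair_lt.
  split=> //=.
  - by apply: ballS; [exact: lt_le_trans yq qr|exact: lt_le_trans zz qr].
  - by move: aq; rewrite ltr_distl => /andP[h _]; lra.
  - by move: ss; rewrite ltr_distl => /andP[h _]; lra.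
have := klipschitzP (HL _ Bw) (inA _ _ xx' tt') (inA _ _ xx tt) => /le_trans; apply.
by rewrite ler_wpM2r// ler_norm.
Qed.

Lemma phi_s x z (t s e : R) phi : phi = phi1 \/ phi = phi2 ->
  `|x - x0| < r1 -> `|z - z0| < r1 -> 0 <= t -> 0 < s -> 0 < e ->
  \forall s1 \near s, `|phi x z t s1 - phi x z t s| < e.
Proof.
move=> Hphi xx zz t0 s0 e0; have [_ _ C _ _] := REG.
have [C1 C2] := C x z t (ballS xx zz) t0.
by apply: within_continuous_near => //; case: Hphi => ->.
Qed.

(** The Lipschitz assumption on the derivative does not bound it by itself; the
    bound comes from the Taylor expansion, whose remainder is controlled, and from
    the continuity of [phi1] in the fast time. *)
Lemma Df_bounded (t s : R) : 0 < t -> 0 < s -> exists2 K, 0 <= K &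
  \forall s1 \near s, forall h, `|Df (x0, t) (z0, s1) h| <= K * `|h|.
Proof.
move=> t0 s0; have [q [k [q0 k0 H]]] := phi1_taylor t0 s0.
pose a := Num.min (q / 2) (r1 / 2); have a0 : 0 < a by rewrite lt_min !divr_gt0.
have aq : a < q.
  by rewrite gt_min; apply/orP; left; rewrite ltr_pdivrMr// ltr_pMr// ltr1n.
have ar : a < r1.
  by rewrite gt_min; apply/orP; right; rewrite ltr_pdivrMr// ltr_pMr// ltr1n.
(* a bound on the difference quotients in the direction [b] *)
have unit_dir (b : X * R) : `|b| <= 1 -> 0 <= b.2 -> exists2 K, 0 <= K &
    \forall s1 \near s, `|Df (x0, t) (z0, s1) b| <= K.
  move=> b1 b2.
  have ab : `|a *: b| <= a by rewrite normrZ ger0_norm ?(ltW a0)// ler_piMr// ltW.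
  have ab1 : `|x0 + (a *: b).1 - x0| < q.
    by rewrite addrC addKr (le_lt_trans (le_trans (prod_norm_fst _) ab)).
  have ab1' : `|x0 + (a *: b).1 - x0| < r1.
    by rewrite addrC addKr (le_lt_trans (le_trans (prod_norm_fst _) ab)).
  have ab2 : `|t + (a *: b).2 - t| < q.
    by rewrite addrC addKr (le_lt_trans (le_trans (prod_norm_snd _) ab)).
  have zz r : 0 < r -> `|z0 - z0| < r by rewrite subrr normr0.
  have xx r : 0 < r -> `|x0 - x0| < r by rewrite subrr normr0.
  have tb0 : 0 <= t + (a *: b).2 by rewrite addr_ge0 ?(ltW t0)//= mulr_ge0// ltW.
  pose y := x0 + (a *: b).1; pose tb := t + (a *: b).2.
  pose K := (`|phi1 y z0 tb s - phi1 x0 z0 t s| + 1 + 1 + k * a ^+ 2) / a.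
  exists K.
    by rewrite divr_ge0 ?(ltW a0)// !addr_ge0// mulr_ge0// exprn_ge0// ltW.
  have N1 := phi_s (or_introl erefl) ab1' (zz _ r10) tb0 s0 ltr01.
  have N2 := phi_s (or_introl erefl) (xx _ r10) (zz _ r10) (ltW t0) s0 ltr01.
  near=> s1.
  have S1 : `|phi1 y z0 tb s1 - phi1 y z0 tb s| < 1 by near: s1.
  have S2 : `|phi1 x0 z0 t s1 - phi1 x0 z0 t s| < 1 by near: s1.
  have ss : `|s1 - s| < q by near: s1; exact: near_dist.
  have tt : `|t - t| < q by rewrite subrr normr0.
  have := H x0 y z0 t tb s1 (xx _ q0) ab1 (zz _ q0) tt ab2 ss.
  have -> : (y - x0, tb - t) = a *: b.
    by rewrite /y /tb addrC addKr addrC addKr -surjective_pairing.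
  rewrite linearZ => HT.
  rewrite /K ler_pdivlMr// mulrC -[X in X * _](ger0_norm (ltW a0)) -normrZ.
  rewrite (_ : a *: _ = (phi1 y z0 tb s - phi1 x0 z0 t s)
    + (phi1 y z0 tb s1 - phi1 y z0 tb s) - (phi1 x0 z0 t s1 - phi1 x0 z0 t s)
    - (phi1 y z0 tb s1 - phi1 x0 z0 t s1 - a *: Df (x0, t) (z0, s1) b)); last first.
    by apply/rowP => i; rewrite !mxE; ring.
  apply: le_trans (ler_normB _ _) _; apply: lerD.
    apply: le_trans (ler_normB _ _) _; apply: lerD; last exact: ltW.
    by apply: le_trans (ler_normD _ _) _; rewrite lerD2l ltW.
  apply: (le_trans HT); rewrite ler_wpM2l// lerXn2r// nnegrE//; exact: ltW.
have [K1 K10 H1] : exists2 K, 0 <= K & \forall s1 \near s,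
    `|Df (x0, t) (z0, s1) (0, 1)| <= K.
  apply: unit_dir => //=; apply: le_trans (prod_norm_le _ _) _.
  by rewrite normr0 normr1 add0r.
have /choice[K2 H2] : forall i : 'I_n1, exists K, 0 <= K /\
    \forall s1 \near s, `|Df (x0, t) (z0, s1) (delta_mx 0 i, 0)| <= K.
  move=> i.
  have [|//|K K0 HK] := unit_dir (delta_mx 0 i, 0).
    apply: le_trans (prod_norm_le _ _) _; rewrite normr0 addr0.
    apply: rV_norm_le => // j; rewrite mxE eqxx /=.
    by case: eqP => _; rewrite ?normr1 ?normr0.
  by exists K.
pose K := K1 + \sum_i K2 i.
have S0 : 0 <= \sum_i K2 i by apply: sumr_ge0 => i _; have [] := H2 i.
exists ((n1%:R + 1) * K); first by rewrite mulr_ge0 ?addr_ge0.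
have H3 : \forall s1 \near s, forall i : 'I_n1,
    `|Df (x0, t) (z0, s1) (delta_mx 0 i, 0)| <= K2 i.
  exact: (@filter_forall _ _
    (fun i s1 => `|Df (x0, t) (z0, s1) (delta_mx 0 i, 0)| <= K2 i) (nbhs s) _
    (fun i => (H2 i).2)).
apply: filterS2 H1 H3 => s1 h1 h3; apply: linear_basis_le => [i|].
  apply: (le_trans (h3 i)); rewrite /K (bigD1 i)//= addrCA lerDl addr_ge0//.
  by apply: sumr_ge0 => j _; have [] := H2 j.
by apply: (le_trans h1); rewrite lerDl.
Unshelve. all: by end_near. Qed.

End LocalBounds.

Section Elementary.
Variable R : realType.

Lemma half_lt (q e a : R) : 0 < q -> e <= q / 2 -> a < e -> a < q.
Proof. by lra. Qed.

Lemma half_ltD (q e a b : R) : e <= q / 2 -> a < e -> b < e -> a + b < q.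
Proof. by lra. Qed.

Lemma sum_bounds (a b c d e f : R) : 0 <= a -> 0 <= b -> 0 <= c -> 0 <= d -> 0 <= e -> 0 <= f ->
  let M := a + b + c + d + e + f + 1 in
  [/\ a <= M, b <= M, c <= M & [/\ d <= M, e <= M & f <= M]].
Proof. by move=> ? ? ? ? ? ? M; split; [| | |split]; rewrite /M; lra. Qed.

End Elementary.

Section PeriodicExtension.
Variables (R : realType) (n1 n2 : nat).
Notation X := 'rV[R]_n1.
Notation Z := 'rV[R]_n2.
Variables (S : set 'rV[R]_(n1 + n2)) (phi1 phi2 : vfield R n1 n2) (T1 T2 : R).
Hypotheses (T10 : 0 < T1) (T20 : 0 < T2).
Hypothesis REG : regular_on S phi1 phi2 T1 T2.
Variables (x0 : X) (z0 : Z) (r1 : R).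
Hypothesis r10 : 0 < r1.
Hypothesis ballS : forall x z, `|x - x0| < r1 -> `|z - z0| < r1 -> S (row_mx x z).

Let dom (x : X) (z : Z) (t s : R) := [/\ S (row_mx x z), 0 <= t & 0 <= s].
Let dom_xt := [set p : (X * R) * (Z * R) | dom p.1.1 p.2.1 p.1.2 p.2.2].
Let wrt_xt (phi : vfield R n1 n2) := fun (v : X * R) (w : Z * R) => phi v.1 w.1 v.2 w.2.

Variable Df : X * R -> Z * R -> {linear (X * R)%type -> X}.
Hypothesis Df_diff : has_derivative_wrt dom_xt (wrt_xt phi1) Df.
Hypothesis Df_lip : forall v w, dom_xt (v, w) ->
  exists (A : set (X * R)) (B : set (Z * R)) (k : R), [/\ nbhs v A, nbhs w B &
    forall w', B w' -> forall h : X * R,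
      (k * `|h|).-lipschitz_(A `&` [set v' | dom_xt (v', w')]) (fun v' => Df v' w' h)].

Notation reg_at := (regular_at phi1 phi2 x0 z0 Df).

Lemma regular_at_mono e e' ts : 0 < e' -> e' <= e -> reg_at e ts -> reg_at e' ts.
Proof.
move=> e0 ee H x x' z z' t' hx hx' hz hz' ht.
have [||||| H1 H2 H3 H4 [H5 H6]] := H x x' z z' t'; try exact: lt_le_trans ee.
have ei : e^-1 <= e'^-1 by rewrite lef_pV2// posrE (lt_le_trans e0).
split.
- exact: le_trans H1 ei.
- exact: le_trans H2 ei.
- by apply: (le_trans H3); rewrite ler_wpM2r.
- by apply: (le_trans H4); rewrite ler_wpM2r.
- split; first by apply: (le_trans H5); rewrite ler_wpM2r.
  by apply: (le_trans H6); rewrite ler_wpM2r// exprn_ge0.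
Qed.

(** Move [z], then ([x], [t]), then [s]: the regularity in each group of variables
    is uniform in the others. *)
Lemma phi_bounded t s phi : 0 < t -> 0 < s -> phi = phi1 \/ phi = phi2 ->
  exists q k, [/\ 0 < q, 0 <= k & forall x z t1 s1,
  `|x - x0| < q -> `|z - z0| < q -> `|t1 - t| < q -> `|s1 - s| < q ->
  `|phi x z t1 s1| <= k].
Proof.
move=> t0 s0 Hphi.
have [q1 [k1 [q10 k10 H1]]] := phi_z REG r10 ballS t0 s0 Hphi.
have [q2 [k2 [q20 k20 H2]]] : exists q k, [/\ 0 < q, 0 <= k & forall x t1 s1,
    `|x - x0| < q -> `|t1 - t| < q -> `|s1 - s| < q ->
    `|phi x z0 t1 s1 - phi x0 z0 t s1| <= k].
  case: Hphi => ->.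
    have [q2 [k2 [q20 k20 H2]]] := phi1_taylor r10 ballS Df_diff Df_lip t0 s0.
    have [K K0 /nbhs_radius[q3 q30 H3]] := Df_bounded REG r10 ballS Df_diff Df_lip t0 s0.
    pose q := Num.min 1 (Num.min q2 q3).
    have q0 : 0 < q by rewrite !lt_min ltr01 q20.
    have [qq1 qq2 qq3] : [/\ q <= 1, q <= q2 & q <= q3] by rewrite /q !ge_min !lexx ?orbT.
    exists q, (k2 + K); split; [by []|exact: addr_ge0|] => x t1 s1 hx ht hs.
    have := H2 x0 x z0 t t1 s1; rewrite !subrr !normr0 => /(_ q20 _ q20 q20).
    move=> /(_ (lt_le_trans hx qq2) (lt_le_trans ht qq2) (lt_le_trans hs qq2)) h2.
    have h3 := H3 s1 (lt_le_trans hs qq3) (x - x0, t1 - t).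
    have n1' : `|(x - x0, t1 - t)| <= 1.
      rewrite prod_normE/= ge_max; apply/andP; split.
        by apply: ltW; exact: lt_le_trans hx qq1.
      by apply: ltW; exact: lt_le_trans ht qq1.
    rewrite -[X in `|X|](subrK (Df (x0, t) (z0, s1) (x - x0, t1 - t))).
    apply: (le_trans (ler_normD _ _)); apply: lerD.
      by apply: (le_trans h2); rewrite ler_piMr// expr_le1.
    by apply: (le_trans h3); rewrite ler_piMr.
  have [q2 [k2 [q20 k20 H2]]] := phi2_x REG r10 ballS t0 s0.
  pose q := Num.min 1 q2.
  have q0 : 0 < q by rewrite !lt_min ltr01 q20.
  have [qq1 qq2] : q <= 1 /\ q <= q2 by rewrite /q !ge_min !lexx ?orbT.
  exists q, k2; split => // x t1 s1 hx ht hs.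
  have := H2 x0 x z0 t t1 s1; rewrite !subrr !normr0 => /(_ q20 _ q20 q20).
  move=> /(_ (lt_le_trans hx qq2) (lt_le_trans ht qq2) (lt_le_trans hs qq2)) h2.
  apply: (le_trans h2); rewrite ler_piMr// prod_normE/= ge_max; apply/andP; split.
    by apply: ltW; exact: lt_le_trans hx qq1.
  by apply: ltW; exact: lt_le_trans ht qq1.
have /nbhs_radius[q3 q30 H3] :
    \forall s1 \near s, `|phi x0 z0 t s1 - phi x0 z0 t s| < 1.
  by apply: (phi_s REG ballS Hphi); rewrite ?subrr ?normr0//; exact: ltW.
pose q := Num.min (Num.min 1 q1) (Num.min q2 q3).
have q0 : 0 < q by rewrite !lt_min ltr01 q10 q20.
have [qq0 qq1 qq2 qq3] : [/\ q <= 1, q <= q1, q <= q2 & q <= q3].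
  by rewrite /q !ge_min !lexx ?orbT.
exists q, (k1 + k2 + 1 + `|phi x0 z0 t s|); split => //.
  by rewrite !addr_ge0.
move=> x z t1 s1 hx hz ht hs.
have h1 := H1 x z0 z t1 s1 (lt_le_trans hx qq1).
rewrite subrr normr0 in h1.
have {}h1 := h1 q10 (lt_le_trans hz qq1) (lt_le_trans ht qq1) (lt_le_trans hs qq1).
have h2 := H2 x t1 s1 (lt_le_trans hx qq2) (lt_le_trans ht qq2) (lt_le_trans hs qq2).
have h3 := H3 s1 (lt_le_trans hs qq3).
have hz1 : `|z - z0| <= 1 by apply: ltW; exact: lt_le_trans hz qq0.
rewrite (_ : phi x z t1 s1 = (phi x z t1 s1 - phi x z0 t1 s1)
  + (phi x z0 t1 s1 - phi x0 z0 t s1) + (phi x0 z0 t s1 - phi x0 z0 t s)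
  + phi x0 z0 t s); last by apply/rowP => i; rewrite !mxE; ring.
apply: (le_trans (ler_normD _ _)); apply: lerD => //.
apply: (le_trans (ler_normD _ _)); apply: lerD; last exact: ltW.
apply: (le_trans (ler_normD _ _)); apply: lerD => //.
by apply: (le_trans h1); rewrite ler_piMr.
Qed.

Lemma regular_at_near (t s : R) : 0 < t -> 0 < s ->
  \forall ts \near (t, s) & e \near (0 : R)^'+, reg_at e ts.
Proof.
move=> t0 s0.
have [q1 [k1 [q10 k10 H1]]] := phi_bounded t0 s0 (or_introl erefl).
have [q2 [k2 [q20 k20 H2]]] := phi_bounded t0 s0 (or_intror erefl).
have [q3 [k3 [q30 k30 H3]]] := phi_z REG r10 ballS t0 s0 (or_introl erefl).
have [q4 [k4 [q40 k40 H4]]] := phi_z REG r10 ballS t0 s0 (or_intror erefl).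
have [q5 [k5 [q50 k50 H5]]] := phi2_x REG r10 ballS t0 s0.
have [q6 [k6 [q60 k60 H6]]] := phi1_taylor r10 ballS Df_diff Df_lip t0 s0.
pose q := Num.min (Num.min q1 q2) (Num.min (Num.min q3 q4) (Num.min q5 q6)).
have q0 : 0 < q by rewrite !lt_min q10 q20 q30 q40 q50.
have [qq1 qq2 qq3] : [/\ q <= q1, q <= q2 & q <= q3] by rewrite /q !ge_min !lexx ?orbT.
have [qq4 qq5 qq6] : [/\ q <= q4, q <= q5 & q <= q6] by rewrite /q !ge_min !lexx ?orbT.
pose M := k1 + k2 + k3 + k4 + k5 + k6 + 1.
have M0 : 0 < M by rewrite ltr_wpDl// !addr_ge0.
pose e := Num.min (q / 2) M^-1.
have e0 : 0 < e by rewrite lt_min divr_gt0// invr_gt0.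
have eq2 : e <= q / 2 by rewrite ge_min lexx.
have eM : M <= e^-1 by rewrite -[leLHS]invrK lef_pV2 ?posrE ?invr_gt0// ge_min lexx orbT.
have reg ts : `|ts.1 - t| < e -> `|ts.2 - s| < e -> reg_at e ts.
  case: ts => t1 s1 /= ht hs x x' z z' t' hx hx' hz hz' ht'; simpl in ht'.
  have [hxq hxq' hzq hzq' htq] : [/\ `|x - x0| < q, `|x' - x0| < q, `|z - z0| < q,
      `|z' - z0| < q & `|t1 - t| < q] by split; exact: half_lt q0 eq2 _.
  have hsq : `|s1 - s| < q by exact: half_lt q0 eq2 _.
  have htq' : `|t' - t| < q.
    by rewrite -(subrKA t1) (le_lt_trans (ler_normD _ _))//; exact: half_ltD eq2 _ _.
  have up k : k <= M -> k <= e^-1 by move=> h; exact: le_trans h eM.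
  have [M1 M2 M3] : [/\ k1 <= e^-1, k2 <= e^-1 & k3 <= e^-1].
    by have [] := sum_bounds k10 k20 k30 k40 k50 k60; split; apply: up.
  have [M4 M5 M6] : [/\ k4 <= e^-1, k5 <= e^-1 & k6 <= e^-1].
    by have [_ _ _ []] := sum_bounds k10 k20 k30 k40 k50 k60; split; apply: up.
  split=> /=.
  - by apply: le_trans M1; apply: H1; exact: lt_le_trans qq1.
  - by apply: le_trans M2; apply: H2; exact: lt_le_trans qq2.
  - apply: (@le_trans _ _ (k3 * `|z' - z|)); last by rewrite ler_wpM2r.
    by apply: H3; exact: lt_le_trans qq3.
  - apply: (@le_trans _ _ (k4 * `|z' - z|)); last by rewrite ler_wpM2r.
    by apply: H4; exact: lt_le_trans qq4.
  - split.
      apply: (@le_trans _ _ (k5 * `|(x' - x, t' - t1)|)); last by rewrite ler_wpM2r.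
      by apply: H5; exact: lt_le_trans qq5.
    apply: (@le_trans _ _ (k6 * `|(x' - x, t' - t1)| ^+ 2)); last first.
      by rewrite ler_wpM2r// exprn_ge0.
    by apply: H6; exact: lt_le_trans qq6.
exists ([set ts | `|ts.1 - t| < e /\ `|ts.2 - s| < e], [set e' | 0 < e' /\ e' <= e]).
  split => /=.
    exists ([set a | `|a - t| < e], [set b | `|b - s| < e]); last by move=> ? [].
    by split => /=; exact: near_dist.
  near=> e'; split.
    by near: e'; exact: nbhs_right_gt.
  by near: e'; exact: nbhs_right_le.
move=> [ts e'] /= [[h1 h2] [e'0 e'e]].
exact: regular_at_mono e'0 e'e (reg _ h1 h2).
Unshelve. all: by end_near. Qed.

(** The times only matter modulo the periods, so that they can be kept in the
    compact box [T1, 2 T1] x [T2, 2 T2], which lies away from the boundary of the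
    domain of the fields. *)
Lemma regular_at_box : exists2 e, 0 < e &
  forall t s, T1 <= t <= 2 * T1 -> T2 <= s <= 2 * T2 -> reg_at e (t, s).
Proof.
have cK : compact (`[T1, 2 * T1]%classic `*` `[T2, 2 * T2]%classic).
  by apply: compact_setX; exact: segment_compact.
have H : \forall e \near (0 : R)^'+, `[T1, 2 * T1]%classic `*` `[T2, 2 * T2]%classic
    `<=` reg_at e.
  have := (compact_near_coveringP _).1 cK R (0 : R)^'+ (fun e ts => reg_at e ts) _.
  apply => -[t s] [/=].
  rewrite !in_itv/= => /andP[t1 _] /andP[s1 _].
  by apply: regular_at_near; [exact: lt_le_trans t1|exact: lt_le_trans s1].
near (0 : R)^'+ => e; exists e; first by near: e; exact: nbhs_right_gt.
move=> t s ht hs; have He : `[T1, 2 * T1]%classic `*` `[T2, 2 * T2]%classic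
    `<=` reg_at e by near: e.
by apply: He; split; rewrite /= in_itv.
Unshelve. all: by end_near. Qed.

Let per (phi : vfield R n1 n2) x z t s := phi x z (wrap T1 t) (wrap T2 s).

Let perE phi : phi = phi1 \/ phi = phi2 -> forall x z t s, S (row_mx x z) ->
  0 <= t -> 0 <= s -> per phi x z t s = phi x z t s.
Proof.
move=> Hphi x z t s Sxz t0 s0; rewrite /per; have [_ _ _ P _] := REG.
have /andP[w0 _] := wrap_itv t T10.
rewrite (@wrap_periodic _ _ (phi x z (wrap T1 t)) T2 s T20 _ s0).
  apply: (@wrap_periodic _ _ (fun t => phi x z t s) T1 t T10 _ t0) => a a0.
  by have [//|P1 _ P3 _] := P x z a s; case: Hphi => ->.
by move=> a a0; have [//|_ P2 _ P4] := P x z (wrap T1 t) a; case: Hphi => ->.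
Qed.

(* Times near [t] are sent near [wrap T t + T], without a jump. *)
Let wrapT (T t t' : R) : 0 < T -> wrap T t' = wrap T (wrap T t + T + (t' - t)).
Proof.
move=> T0; rewrite -(wrap_shift t' (- Num.floor (t / T) + 1) T0); congr (wrap T _).
by rewrite /wrap intrD mulrDr mulr1 intrN mulrN; ring.
Qed.

Let per_shift phi : phi = phi1 \/ phi = phi2 -> forall x z t s t' s', S (row_mx x z) ->
  `|t' - t| < T1 -> `|s' - s| < T2 ->
  per phi x z t' s' = phi x z (wrap T1 t + T1 + (t' - t)) (wrap T2 s + T2 + (s' - s)).
Proof.
move=> Hphi x z t s t' s' Sxz ht hs.
have := wrap_itv t T10; have := wrap_itv s T20; move: ht hs; rewrite !ltr_norml.
move=> /andP[ht _] /andP[hs _] /andP[ws _] /andP[wt _].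
rewrite -[in RHS](perE Hphi) //; [|lra|lra].
by rewrite /per [wrap T1 t'](wrapT t)// [wrap T2 s'](wrapT s).
Qed.

(** Replacing the times by their representatives in the box extends the fields to
    all times and transfers the uniform bounds found on the box. *)
Lemma regular_field_exists : exists r k (p1 p2 : X -> Z -> R -> R -> X) D,
  [/\ regular_field x0 z0 r k T1 T2 p1 p2 D, 0 < r,
      forall x z t s, `|x - x0| < r -> `|z - z0| < r -> 0 <= t -> 0 <= s ->
        phi1 x z t s = p1 x z t s &
      forall x z t s, `|x - x0| < r -> `|z - z0| < r -> 0 <= t -> 0 <= s ->
        phi2 x z t s = p2 x z t s].
Proof.
have [e e0 He] := regular_at_box.
pose r := Num.min (Num.min e r1) (Num.min T1 T2).
have r0 : 0 < r by rewrite !lt_min e0 r10 T10.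
have [re rr rT1 rT2] : [/\ r <= e, r <= r1, r <= T1 & r <= T2].
  by rewrite /r !ge_min !lexx ?orbT.
have inS x z : `|x - x0| < r -> `|z - z0| < r -> S (row_mx x z).
  by move=> hx hz; apply: ballS; [exact: lt_le_trans hx rr|exact: lt_le_trans hz rr].
have box (T t : R) : 0 < T -> T <= wrap T t + T <= 2 * T.
  by move=> T0; have /andP[a b] := wrap_itv t T0; apply/andP; split; lra.
have tt (T t : R) : 0 < T -> `|t - t| < T by rewrite subrr normr0.
have sh1 phi (H : phi = phi1 \/ phi = phi2) x z t s t' : S (row_mx x z) -> `|t' - t| < r ->
    per phi x z t' s = phi x z (wrap T1 t + T1 + (t' - t)) (wrap T2 s + T2).
  move=> Sx ht; rewrite (@per_shift _ H x z t s t' s Sx (lt_le_trans ht rT1) (tt _ _ T20)).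
  by rewrite subrr addr0.
have sh0 phi (H : phi = phi1 \/ phi = phi2) x z t s : S (row_mx x z) ->
    per phi x z t s = phi x z (wrap T1 t + T1) (wrap T2 s + T2).
  by move=> Sx; rewrite (@sh1 _ H x z t s t Sx) ?tt// subrr addr0.
pose D x z t s := Df (x, wrap T1 t + T1) (z, wrap T2 s + T2).
have reg x x' z z' t t' s : `|x - x0| < r -> `|x' - x0| < r -> `|z - z0| < r ->
    `|z' - z0| < r -> `|t' - t| < r ->
  [/\ `|per phi1 x z t s| <= e^-1, `|per phi2 x z t s| <= e^-1,
      `|per phi1 x z' t s - per phi1 x z t s| <= e^-1 * `|z' - z|,
      `|per phi2 x z' t s - per phi2 x z t s| <= e^-1 * `|z' - z| &
      `|per phi2 x' z t' s - per phi2 x z t s| <= e^-1 * `|(x' - x, t' - t)| /\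
      `|per phi1 x' z t' s - per phi1 x z t s - D x z t s (x' - x, t' - t)|
        <= e^-1 * `|(x' - x, t' - t)| ^+ 2].
  move=> hx hx' hz hz' ht.
  have := He _ _ (box T1 t T10) (box T2 s T20) x x' z z' (wrap T1 t + T1 + (t' - t))
    (lt_le_trans hx re) (lt_le_trans hx' re) (lt_le_trans hz re) (lt_le_trans hz' re).
  rewrite /= addrAC subrr add0r => /(_ (lt_le_trans ht re)).
  rewrite -!(sh0 _ (or_introl erefl)) -?(sh0 _ (or_intror erefl)); try exact: inS.
  by rewrite -(sh1 _ (or_introl erefl)) -?(sh1 _ (or_intror erefl)) //; exact: inS.
have xx : `|x0 - x0| < r by rewrite subrr normr0.
have zz : `|z0 - z0| < r by rewrite subrr normr0.
have tr (t : R) : `|t - t| < r by exact: tt.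
have cper phi (H : phi = phi1 \/ phi = phi2) x z t : `|x - x0| < r -> `|z - z0| < r ->
    continuous (per phi x z t).
  move=> hx hz s; apply/cvgrPdist_lt => d d0; rewrite near_simpl.
  have /andP[wt0 _] := wrap_itv t T10; have /andP[ws0 _] := wrap_itv s T20.
  have := phi_s REG ballS H (lt_le_trans hx rr) (lt_le_trans hz rr)
    (addr_ge0 wt0 (ltW T10)) (ltr_wpDl ws0 T20) d0.
  move=> /nbhs_radius[q q0 Hq]; near=> s'.
  have hs : `|s' - s| < Num.min q T2.
    by near: s'; apply: near_dist; rewrite lt_min q0.
  move: hs; rewrite lt_min => /andP[h1 h2].
  have hS := inS _ _ hx hz.
  rewrite (sh0 _ H _ _ _ _ hS) (per_shift H hS (tt _ t T10) h2) distrC.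
  by rewrite [X in _ + _ + X]subrr addr0; apply: Hq; rewrite addrAC subrr add0r.
exists r, e^-1, (per phi1), (per phi2), D; split => //.
- split => //.
  + by rewrite invr_ge0 ltW.
  + by move=> x z t s hx hz; have [] := reg x x z z t t s hx hx hz hz (tr t).
  + by move=> x z t s hx hz; have [] := reg x x z z t t s hx hx hz hz (tr t).
  + by move=> x z z' t s hx hz hz'; have [] := reg x x z z' t t s hx hx hz hz' (tr t).
  + by move=> x z z' t s hx hz hz'; have [] := reg x x z z' t t s hx hx hz hz' (tr t).
  + by move=> x x' z t t' s hx hx' hz ht; have [_ _ _ _ []] := reg x x' z z t t' s hx hx' hz hz ht.
  + by move=> x x' z t t' s hx hx' hz ht; have [_ _ _ _ []] := reg x x' z z t t' s hx hx' hz hz ht.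
  + by move=> x z t; apply: cper; left.
  + by move=> x z t; apply: cper; right.
  + by move=> x z t s; rewrite /per wrapD.
  + by move=> x z t s; rewrite /per wrapD.
  + by move=> x z t s; rewrite /per wrapD.
  + by move=> x z t s; rewrite /per wrapD.
  + move=> x z t hx hz; have [_ _ _ _ Hm] := REG.
    have /andP[wt _] := wrap_itv t T10.
    rewrite -(Hm x z (wrap T1 t) 0); last by split => //; exact: inS.
    apply: eq_vint => s /andP[s0 _]; rewrite /per.
    apply: (@wrap_periodic _ _ (phi1 x z (wrap T1 t)) T2 s T20 _ s0) => a a0.
    have [_ _ _ P _] := REG; have [|//] := P x z (wrap T1 t) a.
    by split => //; exact: inS.
- by move=> x z t s hx hz t0 s0; rewrite (perE (or_introl erefl))//; exact: inS.
- by move=> x z t s hx hz t0 s0; rewrite (perE (or_intror erefl))//; exact: inS.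
Unshelve. all: by end_near. Qed.

End PeriodicExtension.

(** * Limits along an ultrafilter *)

Lemma ultra_free : exists2 U : set_system nat, UltraFilter U & \oo `<=` U.
Proof. by have [U [h1 h2]] := @ultraFilterLemma nat \oo _; exists U. Qed.

Section Ultralimits.
Variable R : realType.

Lemma closed_ball_compact n (M : R) : compact [set x : 'rV[R]_n | `|x| <= M].
Proof.
apply: bounded_closed_compact.
  by exists M; split; [exact: num_real|move=> r Mr x /= /le_trans; apply; exact: ltW].
apply: (@closed_comp _ _ (fun x : 'rV[R]_n => `|x| : R) [set r | r <= M]).
  by move=> x _; exact: (@norm_continuous _ _ x).
exact: closed_le.
Qed.

Variable U : set_system nat.
Hypothesis UU : UltraFilter U.

Lemma ultra_case (A : set nat) : (\forall i \near U, A i) \/ (\forall i \near U, ~ A i).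
Proof. exact: in_ultra_setVsetC. Qed.

Lemma compact_ultralimit (T : topologicalType) (K : set T) (u : nat -> T) :
  compact K -> (\forall i \near U, K (u i)) -> exists l : T, u @ U --> l.
Proof.
move=> cK uK; have [l [_ ul]] := cK (u @ U) _ uK.
exists l => A nA; have [//|nuA] := ultra_case (u @^-1` A).
by have [x [nAx Ax]] := ul (~` A) A nuA nA; case: (nAx Ax).
Qed.

Lemma bounded_ultralimit n (u : nat -> 'rV[R]_n) (M : R) :
  (\forall i \near U, `|u i| <= M) -> exists l : 'rV[R]_n, u @ U --> l.
Proof. by move=> uM; exact: compact_ultralimit (@closed_ball_compact n M) uM. Qed.

Lemma ultra_nat_constant (u : nat -> nat) N : (\forall i \near U, (u i <= N)%N) ->
  exists k, \forall i \near U, u i = k.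
Proof.
elim: N => [|N IH] H; first by exists 0%N; apply: filterS H => i; rewrite leqn0 => /eqP.
have [E|E] := ultra_case [set i | u i = N.+1]; first by exists N.+1.
apply: IH; apply: filterS2 H E => i; rewrite leq_eqVlt => /orP[/eqP //|//].
Qed.

End Ultralimits.

Section FilterLimits.
Variables (R : realType) (F : set_system nat).
Context {FF : ProperFilter F}.

Lemma near_cvg_norm (V : normedModType R) (u : nat -> V) l :
  (u @ F --> l) <-> forall e, 0 < e -> \forall i \near F, `|u i - l| < e.
Proof.
split=> [/cvgrPdist_lt H e e0|H]; first by apply: filterS (H e e0) => i; rewrite distrC.
by apply/cvgrPdist_lt => e e0; apply: filterS (H e e0) => i; rewrite distrC.
Qed.

Lemma cvg_dist_le (V : normedModType R) (u : nat -> V) l x (c : R) :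
  u @ F --> l -> (forall e, 0 < e -> \forall i \near F, `|u i - x| <= c + e) ->
  `|l - x| <= c.
Proof.
move=> /near_cvg_norm ul uc; apply/ler_addgt0Pr => e e0.
have e2 : 0 < e / 2 by rewrite divr_gt0.
have [i [h1 h2]] := filter_ex (filterI (ul _ e2) (uc _ e2)).
rewrite -(subrKA (u i)) (le_trans (ler_normD _ _))// distrC.
by move: h1 h2; rewrite /=; lra.
Qed.

Lemma osc_at_filter (p m : nat) (M : 'rV[R]_p -> set 'rV[R]_m) z
    (zs : nat -> 'rV[R]_p) (ss : nat -> 'rV[R]_m) s :
  osc_at M z -> zs @ F --> z -> ss @ F --> s ->
  (\forall i \near F, M (zs i) (ss i)) -> M z s.
Proof.
move=> osc /near_cvg_norm cz /near_cvg_norm cs H.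
have /choice[f Hf] : forall k : nat, exists i, [/\ `|zs i - z| < k.+1%:R^-1,
    `|ss i - s| < k.+1%:R^-1 & M (zs i) (ss i)].
  move=> k; have k0 : 0 < k.+1%:R^-1 :> R by rewrite invr_gt0.
  have [i [[h1 h2] h3]] := filter_ex (filterI (filterI (cz _ k0) (cs _ k0)) H).
  by exists i.
have to_seq (V : normedModType R) (u : nat -> V) l :
    (forall k, `|u k - l| < k.+1%:R^-1) -> u @ \oo --> l.
  move=> ul; apply/cvgrPdist_lt => e e0.
  have := @near_infty_natSinv_lt R (PosNum e0); apply: filterS => k /=.
  by rewrite distrC; exact: lt_trans.
apply: (osc (zs \o f) (ss \o f)).
- by apply: to_seq => k; have [] := Hf k.
- by apply: to_seq => k; have [] := Hf k.
- by move=> i; have [] := Hf i.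
Qed.

End FilterLimits.

Lemma ultra_cvg_near (R : realType) (U : set_system nat) (UU : UltraFilter U)
    (V : normedModType R) (u : nat -> V) l e : u @ U --> l -> 0 < e ->
  \forall i \near U, `|u i - l| < e.
Proof. by move=> /near_cvg_norm; exact. Qed.

(** Otherwise values at points tending to [z], away from [M z], would accumulate by
    boundedness at a value that outer semicontinuity puts in [M z]. *)
Lemma osc_usc (R : realType) (p m : nat) (M : 'rV[R]_p -> set 'rV[R]_m) K z (e : R) :
  osc_at M z -> bounded_set (\bigcup_(y in K) M y) -> 0 < e ->
  exists2 d, 0 < d & forall y v, K y -> `|y - z| <= d -> M y v ->
    exists2 w, M z w & `|v - w| <= e.
Proof.
move=> osc [B [_ HB]] e0; apply: contrapT => Hn.
have /choice[f Hf] : forall k : nat, exists yv : 'rV[R]_p * 'rV[R]_m,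
    [/\ K yv.1, `|yv.1 - z| <= k.+1%:R^-1, M yv.1 yv.2 &
        forall w, M z w -> ~ `|yv.2 - w| <= e].
  move=> k; apply: contrapT => Hk; apply: Hn; exists (k.+1%:R^-1) => // y v Ky yz Myv.
  apply: contrapT => Hw; apply: Hk; exists (y, v); split => // w Mw vw.
  by apply: Hw; exists w.
have [U UU Uoo] := ultra_free.
have [l cl] : exists l : 'rV[R]_m, (fun k => (f k).2) @ U --> l.
  apply: (@bounded_ultralimit _ U _ _ _ (B + 1)).
  apply: (@filterS _ _ _ setT) => [k _|]; last exact: filterT.
  apply: (HB (B + 1)); first by rewrite ltrDl.
  by have [h1 _ h2 _] := Hf k; exists (f k).1.
have cz : (fun k => (f k).1) @ U --> z.
  apply/near_cvg_norm => d d0; apply: Uoo.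
  have := @near_infty_natSinv_lt R (PosNum d0); apply: filterS => k /=.
  by have [_ h _ _] := Hf k; exact: le_lt_trans.
have Ml : M z l.
  apply: (osc_at_filter osc cz cl).
  by apply: (@filterS _ _ _ setT) => [k _|]; [have [] := Hf k|exact: filterT].
have [k Hk] := filter_ex ((near_cvg_norm _ _).1 cl e e0).
by have [_ _ _ /(_ l Ml)] := Hf k; apply; exact: ltW.
Qed.

(** * Increments along the flows of the perturbed system *)

Section Blocks.
Variable R : realType.

Lemma lsubmx_norm_le m n (y : 'rV[R]_(m + n)) : `|lsubmx y| <= `|y|.
Proof. by apply: rV_norm_le => // i; rewrite mxE; exact: rV_coord_le. Qed.

Lemma rsubmx_norm_le m n (y : 'rV[R]_(m + n)) : `|rsubmx y| <= `|y|.
Proof. by apply: rV_norm_le => // i; rewrite mxE; exact: rV_coord_le. Qed.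

Lemma row_mx_norm_le m n (y : 'rV[R]_(m + n)) c : 0 <= c ->
  `|lsubmx y| <= c -> `|rsubmx y| <= c -> `|y| <= c.
Proof.
move=> c0 hl hr; apply: rV_norm_le => // i; case: (split_ordP i) => k ->.
  by have := le_trans (rV_coord_le (lsubmx y) k) hl; rewrite mxE.
by have := le_trans (rV_coord_le (rsubmx y) k) hr; rewrite mxE.
Qed.

Lemma euclidean_norm_le n (v : 'rV[R]_n) : euclidean_norm v <= (n%:R + 1) * `|v|.
Proof.
have n1 : 0 <= (n%:R + 1) * `|v| by rewrite mulr_ge0 ?addr_ge0.
rewrite /euclidean_norm -[leRHS](ger0_norm n1) -sqrtr_sqr ler_sqrt ?exprn_ge0//.
apply: (@le_trans _ _ (\sum_(i < n) `|v| ^+ 2)).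
  apply: ler_sum => i _; rewrite -[leLHS]real_normK ?num_real//.
  by rewrite lerXn2r ?nnegrE//; exact: rV_coord_le.
rewrite sumr_const card_ord -(mulr_natl (`|v| ^+ 2)) exprMn; apply: ler_wpM2r; first exact: exprn_ge0.
by have := ler0n R n; nra.
Qed.

Lemma derivable_apd (V : normedModType R) (y : R -> V) t :
  derivable y t 1 -> apd y t ('D_1 y t) 0.
Proof.
move=> dy e e0; rewrite add0r.
have /eqaddoP/(_ e e0)/nbhs_ballP[q /= q0 Hq] := derivable_nbhs dy.
have := near_dist t q0; apply: filterS => s st.
have := Hq (s - t); rewrite /ball/= sub0r normrN => /(_ st).
rewrite !fctE /= [(s - t) *: 1]mulr1 subrK opprD addrA => H.
exact: H.
Qed.

Lemma apd_linear (V W : normedModType R) (T : V -> W) (y : R -> V) t v :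
  (forall a b, T (a - b) = T a - T b) -> (forall c a, T (c *: a) = c *: T a) ->
  (forall a, `|T a| <= `|a|) -> apd y t v 0 -> apd (fun s => T (y s)) t (T v) 0.
Proof.
move=> TB TZ Tle Hy e e0; apply: filterS (Hy e e0) => s; apply: le_trans.
by rewrite -TZ -!TB; exact: Tle.
Qed.

End Blocks.

Section FlowPieces.
Variables (R : realType) (n1 n2 : nat).
Notation X := 'rV[R]_n1.
Notation Z := 'rV[R]_n2.

Definition flow_piece m (H : hybrid_system R m) (a b : R) (y : R -> 'rV[R]_m) : Prop :=
  [/\ forall s, a <= s <= b -> flow_set H (y s), abs_continuous_on y a b &
      {ae (@lebesgue_measure R), forall s, a < s < b ->
        derivable y s 1 /\ flow_map H (y s) ('D_1 y s)}].

Lemma flow_piece_sub m (H : hybrid_system R m) a b a' b' y :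
  a <= a' -> b' <= b -> flow_piece H a b y -> flow_piece H a' b' y.
Proof.
move=> aa bb [h1 h2 h3]; split.
- by move=> s /andP[s1 s2]; apply: h1; rewrite (le_trans aa)// (le_trans s2).
- move=> e /h2[d d0 Hd]; exists d => // N u v Huv; apply: Hd => k.
  by have [k1 [k2 k3]] := Huv k; rewrite (le_trans aa)// (le_trans k3).
- apply: ae_imply h3 => s hs /andP[s1 s2]; apply: hs.
  by rewrite (le_lt_trans aa)// (lt_le_trans s2).
Qed.

Variables (C D : set 'rV[R]_(n1 + n2)) (phi1 phi2 : vfield R n1 n2).
Variables (Phi : Z -> set Z) (G : 'rV[R]_(n1 + n2) -> set 'rV[R]_(n1 + n2)).
Variables (T1 T2 : R).
Hypotheses (T10 : 0 < T1) (T20 : 0 < T2).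
Hypothesis BA : basic_assumption C D Phi G.
Hypothesis RA : regularity_assumption C phi1 phi2 T1 T2.

(** A ball of the sup norm around a point of [C] is contained in the inflation of
    [C], whose radius is Euclidean. *)
Lemma local_regular_field th0 : C th0 ->
  exists r k (p1 p2 : X -> Z -> R -> R -> X) Df,
  [/\ regular_field (xpart th0) (zpart th0) r k T1 T2 p1 p2 Df, 0 < r,
      forall x z t s, `|x - xpart th0| < r -> `|z - zpart th0| < r -> 0 <= t -> 0 <= s ->
        phi1 x z t s = p1 x z t s &
      forall x z t s, `|x - xpart th0| < r -> `|z - zpart th0| < r -> 0 <= t -> 0 <= s ->
        phi2 x z t s = p2 x z t s].
Proof.
move=> Cth; have [dlt d0 Hd] := RA.
have REG : regular_on (inflation C dlt) phi1 phi2 T1 T2.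
  by apply: Hd; rewrite lexx ltW.
have [[[Df [dD lD]] _] _ _ _ _] := REG.
have nn : 0 < (n1 + n2)%:R + 1 :> R by rewrite ltr_wpDl.
have r10 : 0 < dlt / ((n1 + n2)%:R + 1) by rewrite divr_gt0.
apply: (regular_field_exists T10 T20 REG r10 _ dD lD) => x z hx hz.
exists th0 => //; apply: (le_trans (euclidean_norm_le _)).
rewrite mulrC -ler_pdivlMr//; apply: row_mx_norm_le; first exact: ltW.
  by rewrite linearB/= row_mxKl -normrN opprB ltW.
by rewrite linearB/= row_mxKr -normrN opprB ltW.
Qed.

Let Phi_osc th : C th -> osc_at (fun th => Phi (zpart th)) th.
Proof. by move=> Cth; have [_ [[h _] _] _ _ _] := BA; exact: h. Qed.

Lemma Phi_bound : exists2 M, 0 <= M & forall th v, C th -> Phi (zpart th) v -> `|v| <= M.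
Proof.
have [_ [[_ [B [_ HB]]] _] _ _ _] := BA; exists (`|B| + 1); first by rewrite addr_ge0.
move=> th v Cth Pv; apply: HB; last by exists th.
by rewrite (le_lt_trans (ler_norm _))// ltrDl.
Qed.

Lemma Phi_convex th : C th -> convex_in (Phi (zpart th)).
Proof.
move=> Cth p q s t Pp Pq s0 t0 st; have [_ [_ /(_ th Cth) cv] _ _ _] := BA.
have s1 : s <= 1 by rewrite -st lerDl.
have := cv p q (Itv01 s0 s1) (mem_set Pp) (mem_set Pq).
have -> : t = 1 - s by rewrite -st addrAC subrr add0r.
by rewrite inE.
Qed.

Notation F_ave := (flow_map (H_ave C D phi1 phi2 Phi G T1 T2)).

(** The x component is the averaging estimate.  For the z component, the derivative
    is close to the convex set [Phi (zpart th0)] by upper semicontinuity, and the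
    mean value inequality averages it. *)
Lemma window th0 eta : C th0 -> 0 < eta -> exists d c eps0,
  [/\ 0 < d, 0 <= c, 0 < eps0 & forall eps, 0 < eps -> eps <= eps0 ->
   forall a b y, a <= b -> flow_piece (H_eps C D phi1 phi2 Phi G eps) a b y ->
   (forall s, a <= s <= b -> `|theta_part (y s) - th0| <= d) ->
   exists2 v, F_ave th0 v &
     `|theta_part (y b) - theta_part (y a) - (b - a) *: v| <= eta * (b - a) + c * eps].
Proof.
move=> Cth eta0.
have [r [k [p1 [p2 [Df [RF r0 E1 E2]]]]]] := local_regular_field Cth.
have [Mz Mz0 HMz] := Phi_bound.
have e4 : 0 < eta / 4 by rewrite divr_gt0.
have [d1 [c [eps0 [d10 c0 eps00 W]]]] := averaged_window RF Mz0 eta0.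
have [_ [[_ Pb] _] _ Pn _] := BA.
have [d2 d20 usc] := osc_usc (Phi_osc Cth) Pb e4.
pose d := Num.min (Num.min d1 d2) (r / 2).
have d0 : 0 < d by rewrite !lt_min d10 d20 divr_gt0.
have dd1 : d <= d1 by rewrite !ge_min lexx.
have dd2 : d <= d2 by rewrite !ge_min lexx orbT.
have dr : d < r by apply: (@le_lt_trans _ _ (r / 2)); [rewrite ge_min lexx orbT|lra].
exists d, (c + 1), eps0; split => //; first by rewrite addr_ge0.
move=> eps ep0 epe a b y ab [yC yac yae] yd.
have Hx s : a <= s <= b -> `|xpart (theta_part (y s)) - xpart th0| <= d.
  move=> hs; apply: le_trans (yd s hs); rewrite /xpart -linearB; exact: lsubmx_norm_le.
have Hz s : a <= s <= b -> `|zpart (theta_part (y s)) - zpart th0| <= d.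
  move=> hs; apply: le_trans (yd s hs); rewrite /zpart -linearB; exact: rsubmx_norm_le.
pose tau i (w : 'rV[R]_(n1 + n2 + 2)) := rsubmx w 0 i : R.
have tauB i : forall v w, tau i (v - w) = tau i v - tau i w by move=> v w; rewrite /tau !mxE.
have tau_le i : forall v, `|tau i v| <= `|v|.
  by move=> v; apply: le_trans (rV_coord_le _ i) (rsubmx_norm_le _).
have xB : forall v w : 'rV[R]_(n1 + n2 + 2), xpart (theta_part (v - w))
    = xpart (theta_part v) - xpart (theta_part w).
  by move=> v w; rewrite /xpart /theta_part !linearB.
have zB : forall v w : 'rV[R]_(n1 + n2 + 2), zpart (theta_part (v - w))
    = zpart (theta_part v) - zpart (theta_part w).
  by move=> v w; rewrite /zpart /theta_part !linearB.
have x_le : forall v : 'rV[R]_(n1 + n2 + 2), `|xpart (theta_part v)| <= `|v|.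
  by move=> v; exact: le_trans (lsubmx_norm_le _) (lsubmx_norm_le _).
have z_le : forall v : 'rV[R]_(n1 + n2 + 2), `|zpart (theta_part v)| <= `|v|.
  by move=> v; exact: le_trans (rsubmx_norm_le _) (lsubmx_norm_le _).
have inc q q' : [/\ `|xpart (theta_part (y q')) - xpart (theta_part (y q))| <= `|y q' - y q|,
    `|zpart (theta_part (y q')) - zpart (theta_part (y q))| <= `|y q' - y q|,
    `|tau1_part (y q') - tau1_part (y q)| <= `|y q' - y q| &
    `|tau2_part (y q') - tau2_part (y q)| <= `|y q' - y q|].
  split; [by rewrite -xB; exact: x_le|by rewrite -zB; exact: z_le| |].
    by have := tau_le 0 (y q' - y q); rewrite tauB.
  by have := tau_le 1 (y q' - y q); rewrite tauB.
have AE : {ae (@lebesgue_measure R), forall q, a < q < b ->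
    [/\ apd (fun q => xpart (theta_part (y q))) q
          (f_eps phi1 phi2 eps (xpart (theta_part (y q))) (zpart (theta_part (y q)))
            (tau1_part (y q)) (tau2_part (y q))) 0,
        exists2 vz, Phi (zpart (theta_part (y q))) vz &
          apd (fun q => zpart (theta_part (y q))) q vz 0,
        apd (fun q => tau1_part (y q)) q eps^-1 0 &
        apd (fun q => tau2_part (y q)) q (eps ^- 2) 0]}.
  apply: ae_imply yae => q Hq /Hq[/derivable_apd dy [vx vz v1 v2]]; split.
  - rewrite -vx.
    apply: (apd_linear (T := fun w => xpart (theta_part w)) xB _ x_le dy).
    by move=> l w; rewrite /xpart /theta_part !linearZ.
  - eexists; first exact: vz.
    apply: (apd_linear (T := fun w => zpart (theta_part w)) zB _ z_le dy).
    by move=> l w; rewrite /zpart /theta_part !linearZ.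
  - rewrite -v1; apply: (apd_linear (T := tau 0) (tauB 0) _ (tau_le 0) dy).
    by move=> l w; rewrite /tau !mxE.
  - rewrite -v2; apply: (apd_linear (T := tau 1) (tauB 1) _ (tau_le 1) dy).
    by move=> l w; rewrite /tau !mxE.
have HX : `|xpart (theta_part (y b)) - xpart (theta_part (y a))
    - (b - a) *: f_bar phi1 phi2 T1 T2 th0| <= eta * (b - a) + c * eps.
  have zz : `|zpart th0 - zpart th0| < r by rewrite subrr normr0.
  have xx : `|xpart th0 - xpart th0| < r by rewrite subrr normr0.
  rewrite (@avg_f_bar _ _ _ _ _ _ _ _ _ _ _ _ RF phi1 phi2 _ _ th0 erefl erefl); last 2 first.
  - by move=> x t s hx; exact: E1.
  - by move=> t s; exact: E2.
  apply: (W eps ep0 epe _ y (fun q => xpart (theta_part (y q)))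
    (fun q => zpart (theta_part (y q))) (fun q => tau1_part (y q))
    (fun q => tau2_part (y q)) a b ab yac inc).
    move=> q hq; have [_ t0 s0] := yC q hq; split => //.
      exact: le_trans (Hx q hq) dd1.
    exact: le_trans (Hz q hq) dd1.
  apply: ae_imply AE => q Hq hq; have [h1 [vz h2 h3] h4 h5] := Hq hq.
  have hq' : a <= q <= b by case/andP: hq => /ltW -> /ltW ->.
  have [Cq t0 s0] := yC q hq'; exists vz; first exact: HMz Cq h2.
  split => //; rewrite -E1 -?E2//; try exact: le_lt_trans (Hx q hq') dr.
  + exact: le_lt_trans (Hz q hq') dr.
  + exact: le_lt_trans (Hz q hq') dr.
have [q Pq Hq] : exists2 q, Phi (zpart th0) q &
    `|zpart (theta_part (y b)) - zpart (theta_part (y a)) - (b - a) *: q|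
      <= eta / 2 * (b - a) + eps.
  apply: (mean_value_convex (f := fun s => zpart (theta_part (y s)))) => //.
  - by rewrite divr_ge0// ltW.
  - apply: (abs_continuous_comp (rho := 1) (C := 1)) yac _ => // s t _ _ _.
    by rewrite mul1r; have [] := inc s t.
  - exact: Pn.
  - exact: Phi_convex.
  apply: ae_imply AE => s Hs hs; have [_ [vz h2 h3] _ _] := Hs hs.
  have hs' : a <= s <= b by case/andP: hs => /ltW -> /ltW ->.
  have [Cs _ _] := yC s hs'.
  have [w Pw vw] := usc _ _ Cs (le_trans (yd s hs') dd2) h2.
  exists w => //; apply: filterS (apd_slope w e4 h3) => s' h; apply: (le_trans h).
  by rewrite ler_wpM2r//; lra.
exists (row_mx (f_bar phi1 phi2 T1 T2 th0) q).
  by split; [exact: row_mxKl|rewrite /zpart row_mxKr].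
have ba : 0 <= b - a by rewrite subr_ge0.
have eb : 0 <= eta * (b - a) by rewrite mulr_ge0// ltW.
have ce : 0 <= c * eps by rewrite mulr_ge0// ltW.
apply: row_mx_norm_le.
- by rewrite addr_ge0// mulr_ge0 ?addr_ge0// ltW.
- rewrite !linearB linearZ/= row_mxKl; apply: (le_trans HX).
  by rewrite lerD2l mulrDl lerDl mul1r ltW.
- rewrite !linearB linearZ/= row_mxKr; apply: (le_trans Hq).
  by rewrite mulrDl mul1r; nra.
Qed.

End FlowPieces.

(** * Limits of approximate flows *)

Lemma abs_continuous_dist (R : realType) (V : normedModType R) (f : R -> V) (a b e : R) :
  abs_continuous_on f a b -> 0 < e -> exists2 d, 0 < d & forall s t,
    a <= s <= b -> a <= t <= b -> `|t - s| < d -> `|f t - f s| < e.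
Proof.
move=> acf e0; have [d d0 Hd] := acf e e0; exists d => // s t.
wlog st : s t / s <= t => [H hs ht|].
  have [st|/ltW ts] := leP s t; first exact: H.
  by rewrite distrC [in X in _ -> X]distrC; exact: H.
move=> /andP[s1 s2] /andP[t1 t2]; rewrite ger0_norm ?subr_ge0// => std.
have := Hd 1%N (fun=> s) (fun=> t); rewrite !big_ord1; apply => //.
by move=> i j _ _ _; rewrite (ord1 i) (ord1 j).
Qed.

(** Leaving the large ball takes a positive time from any point of the smaller one,
    uniformly since the trajectory is uniformly continuous. *)
Lemma no_exit (R : realType) (V : normedModType R) (f : R -> V) (a b d d' : R) th :
  d' < d -> abs_continuous_on f a b -> `|f a - th| <= d' ->
  (forall s, a <= s <= b -> (forall q, a <= q <= s -> `|f q - th| <= d) ->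
     `|f s - th| <= d') ->
  forall s, a <= s <= b -> `|f s - th| <= d.
Proof.
move=> dd acf fa H s0 /andP[as0 s0b].
suff /(_ s0) : forall q, a <= q <= s0 -> `|f q - th| <= d by apply; rewrite as0 lexx.
have [r r0 Hr] := abs_continuous_dist acf (e := d - d') ltac:(by rewrite subr_gt0).
apply: (@cousin_induction _ a s0 (fun t => forall q, a <= q <= t -> `|f q - th| <= d)) => //.
  by move=> q qa; rewrite (le_anti qa) in fa *; apply: le_trans fa _; exact: ltW.
move=> c /andP[ac cs0]; exists (r / 2); first by rewrite divr_gt0.
move=> u v [au uc cv vs0] cu vc Pu q /andP[aq qv].
have [qu|uq] := leP q u; first by apply: Pu; rewrite aq.
have ub : u <= b by rewrite (le_trans uc)// (le_trans cs0).
have fu : `|f u - th| <= d' by apply: H => //; rewrite au.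
rewrite -(subrKA (f u)); apply: (le_trans (ler_normD _ _)).
have : `|f q - f u| < d - d'.
  apply: Hr; rewrite ?au ?aq//= ?(le_trans qv (le_trans vs0 s0b))//.
  by rewrite ger0_norm ?subr_ge0 ?(ltW uq)//; lra.
by lra.
Qed.

(** A family of sets [P e] of trajectories that approximate, for small [e], the
    flows of the inclusion with map [F] on [C]: their increments are close to
    displacements along [F], frozen at a point near which they stay. *)
Record approximate_flow (R : realType) (n : nat) (C : set 'rV[R]_n)
    (F : 'rV[R]_n -> set 'rV[R]_n) (P : R -> R -> R -> (R -> 'rV[R]_n) -> Prop) : Prop :=
    ApproximateFlow {
  af_closed : closed C ;
  af_map_bounded : forall th, C th -> exists M, forall v, F th v -> `|v| <= M ;
  af_map_closed : forall th, C th -> closed (F th) ;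
  af_in : forall e a b f, P e a b f -> forall s, a <= s <= b -> C (f s) ;
  af_ac : forall e a b f, P e a b f -> abs_continuous_on f a b ;
  af_sub : forall e a b a' b' f, a <= a' -> b' <= b -> P e a b f -> P e a' b' f ;
  af_window : forall th0 eta, C th0 -> 0 < eta -> exists d c eps0,
    [/\ 0 < d, 0 <= c, 0 < eps0 & forall eps, 0 < eps -> eps <= eps0 ->
     forall a b f, a <= b -> P eps a b f ->
     (forall s, a <= s <= b -> `|f s - th0| <= d) ->
     exists2 v, F th0 v & `|f b - f a - (b - a) *: v| <= eta * (b - a) + c * eps]
}.

Section Limits.
Variables (R : realType) (n : nat).
Notation V := 'rV[R]_n.
Variables (C : set V) (F : V -> set V) (P : R -> R -> R -> (R -> V) -> Prop).
Hypothesis AF : approximate_flow C F P.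

Let C_closed := af_closed AF.
Let F_bounded := af_map_bounded AF.
Let F_closed := af_map_closed AF.
Let P_C := af_in AF.
Let P_ac := af_ac AF.
Let P_sub := af_sub AF.
Let P_window := af_window AF.

Let speed_at (L : R) (th : V) := C th -> forall e, 0 < e -> e <= L^-1 ->
  forall a b f, a <= b -> b - a <= L^-1 -> P e a b f -> f a = th ->
  `|f b - f a| <= L * (b - a + e).

(** Close to [th0] the window estimate bounds the speed, and the trajectory has no
    time to leave the window when its duration is at most [L^-1]. *)
Lemma local_speed th0 : C th0 -> \forall th \near th0 & L \near +oo, speed_at L th.
Proof.
move=> Cth; have [d [c [eps0 [d0 c0 eps00 W]]]] := P_window Cth ltr01.
have [M0 HM0] := F_bounded Cth; pose S := `|M0| + 1 + c.
have S0 : 0 < S by rewrite ltr_wpDr// ltr_wpDl.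
exists ([set th | `|th - th0| < d / 2], [set L | [/\ 0 < L, eps0^-1 <= L, S <= L & 8 * S / d <= L]]).
  split => /=.
    by apply/(@nbhs_normP _ V th0); exists (d / 2) => /=; [rewrite divr_gt0|move=> y /=; rewrite distrC].
  near=> L; split; near: L;
    [apply: nbhs_pinfty_gt|apply: nbhs_pinfty_ge|apply: nbhs_pinfty_ge|
     apply: nbhs_pinfty_ge]; exact: num_real.
move=> [th L] /= [th_d [L0 Le LS Ld]] Cth' e e0 eL a b f ab baL Pf fa.
have inc s : a <= s <= b -> (forall q, a <= q <= s -> `|f q - th0| <= d) ->
    `|f s - f a| <= S * (s - a + e).
  move=> /andP[as_ sb] Hq.
  have ee : e <= eps0.
    by apply: (le_trans eL); rewrite -[leRHS]invrK lef_pV2// posrE invr_gt0.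
  have [v Fv Hv] := W e e0 ee a s f as_ (P_sub (lexx a) sb Pf) Hq.
  have vM : `|v| <= `|M0| by apply: le_trans (HM0 v Fv) (ler_norm _).
  rewrite -[X in `|X|](subrK ((s - a) *: v)); apply: (le_trans (ler_normD _ _)).
  apply: (le_trans (lerD Hv (lexx _))); rewrite normrZ ger0_norm ?subr_ge0//.
  have h1 : (s - a) * `|v| <= (s - a) * `|M0| by rewrite ler_wpM2l// subr_ge0.
  rewrite /S; have : 0 <= c * (s - a) by rewrite mulr_ge0// subr_ge0.
  have : 0 <= `|M0| * e by rewrite mulr_ge0// ltW.
  by nra.
have small s : a <= s <= b -> S * (s - a + e) <= d / 4.
  move=> /andP[as_ sb]; apply: (@le_trans _ _ (S * (2 * L^-1))).
    by rewrite ler_pM2l//; lra.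
  rewrite mulrA ler_pdivrMr//; move: Ld; rewrite ler_pdivrMr//; lra.
have stay : forall s, a <= s <= b -> `|f s - th0| <= d.
  apply: (@no_exit _ _ f a b d (3 / 4 * d) th0) => //.
  - by lra.
  - exact: P_ac Pf.
  - by rewrite fa; apply: ltW; apply: (lt_le_trans th_d); lra.
  - move=> s hs Hq; rewrite -(subrKA (f a)); apply: (le_trans (ler_normD _ _)).
    have := le_trans (inc s hs Hq) (small s hs); move: th_d; rewrite -fa; lra.
have bb : a <= b <= b by rewrite ab lexx.
apply: (le_trans (inc b bb stay)); rewrite ler_wpM2r//.
by rewrite addr_ge0 ?subr_ge0// ltW.
Unshelve. all: by end_near. Qed.

(** By compactness the local bounds hold with a common constant; for long durations
    the increment is bounded by the diameter of the ball. *)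
Lemma speed M : exists2 L, 0 < L & forall e, 0 < e -> e <= L^-1 ->
  forall a b f, a <= b -> P e a b f -> (forall s, a <= s <= b -> `|f s| <= M) ->
  `|f b - f a| <= L * (b - a + e).
Proof.
have cK : compact (C `&` [set x : V | `|x| <= M]).
  apply: (subclosed_compact _ (@closed_ball_compact R n M)); last by move=> x [].
  apply: closedI => //; exact: compact_closed (@norm_hausdorff _ _) (@closed_ball_compact R n M).
have H : \forall L \near +oo, C `&` [set x : V | `|x| <= M] `<=` speed_at L.
  have := (compact_near_coveringP _).1 cK R +oo speed_at _.
  by apply => th [Cth _]; exact: local_speed.
near (+oo : set_system R) => L.
have L0 : 0 < L by near: L; exact: nbhs_pinfty_gt.
have HL : C `&` [set x : V | `|x| <= M] `<=` speed_at L by near: L.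
exists (Num.max L (2 * `|M| * L)); first by rewrite lt_max L0.
set L' := Num.max _ _ => e e0 eL a b f ab Pf fM.
have LL : L <= L' by rewrite le_max lexx.
have L'0 : 0 < L' by exact: lt_le_trans LL.
have ba : 0 <= b - a by rewrite subr_ge0.
have fa : a <= a <= b by rewrite lexx.
have fb : a <= b <= b by rewrite lexx ab.
have [short|long] := leP (b - a) L^-1.
  apply: (@le_trans _ _ (L * (b - a + e))); last by rewrite ler_wpM2r// addr_ge0// ltW.
  apply: (HL (f a) _ _ e e0 _ a b f) => //.
  - by split; [exact: P_C Pf _ fa|exact: fM].
  - exact: P_C Pf _ fa.
  - by apply: (le_trans eL); rewrite lef_pV2.
apply: (@le_trans _ _ (L' * (b - a))); last by rewrite ler_pM2l// lerDl ltW.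
apply: (@le_trans _ _ (2 * `|M|)).
  apply: (le_trans (ler_normB _ _)); have := fM a fa; have := fM b fb.
  by have := ler_norm M; lra.
apply: (@le_trans _ _ (2 * `|M| * L * (b - a))); last first.
  by rewrite ler_wpM2r// le_max lexx orbT.
rewrite -mulrA ler_peMr ?mulr_ge0//; apply: ltW.
by move: long; rewrite -div1r ltr_pdivrMr// mulrC.
Unshelve. all: by end_near. Qed.

End Limits.

(** Extends trajectories by constants, so that they have a common domain although
    their intervals vary. *)
Definition clamp (R : realType) (a b s : R) := Num.max a (Num.min s b).

Section Clamp.
Variable R : realType.
Implicit Types a b s t : R.

Lemma clamp_itv a b s : a <= b -> a <= clamp a b s <= b.
Proof. by move=> ab; rewrite /clamp le_max lexx/= ge_max ab ge_min lexx orbT. Qed.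

Lemma clamp_id a b s : a <= s <= b -> clamp a b s = s.
Proof. by move=> /andP[as_ sb]; rewrite /clamp min_l// max_r. Qed.

Lemma clamp_lip a b s t : `|clamp a b s - clamp a b t| <= `|s - t|.
Proof.
rewrite /clamp; case: (leP s b) => sb; case: (leP t b) => tb;
  case: (leP a s) => h1; case: (leP a t) => h2; case: (leP a b) => h3;
  rewrite ?subrr ?normr0// ler_norml; apply/andP; split;
  have := ler_norm (s - t); have := ler_norm (t - s); rewrite [`|t - s|]distrC; lra.
Qed.

End Clamp.

Section LimitPiece.
Variables (R : realType) (n : nat).
Notation V := 'rV[R]_n.
Variables (C : set V) (F : V -> set V) (P : R -> R -> R -> (R -> V) -> Prop).
Hypothesis AF : approximate_flow C F P.

Let C_closed := af_closed AF.
Let F_bounded := af_map_bounded AF.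
Let F_closed := af_map_closed AF.
Let P_C := af_in AF.
Let P_ac := af_ac AF.
Let P_sub := af_sub AF.
Let P_window := af_window AF.

Variable U : set_system nat.
Hypothesis UU : UltraFilter U.
Variables (e a b : nat -> R) (f : nat -> R -> V) (M a0 b0 : R).
Hypothesis e_gt0 : forall i, 0 < e i.
Hypothesis e_cvg : e @ U --> 0.
Hypothesis a_cvg : a @ U --> a0.
Hypothesis b_cvg : b @ U --> b0.
Hypothesis f_piece : \forall i \near U, [/\ a i <= b i, a i < b i -> P (e i) (a i) (b i) (f i) &
  forall s, a i <= s <= b i -> `|f i s| <= M].

Let speed_bound : exists2 L, 0 < L & \forall i \near U, forall s t,
  a i <= s <= b i -> a i <= t <= b i -> `|f i t - f i s| <= L * (`|t - s| + e i).
Proof.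
have [L L0 HL] := speed AF M.
exists L => //.
have Li : 0 < L^-1 by rewrite invr_gt0.
have e1 : \forall i \near U, `|e i - 0| < L^-1 by exact: ultra_cvg_near.
apply: filterS2 e1 f_piece => i; rewrite subr0 ger0_norm ?(ltW (e_gt0 i))// => ei [ab Pi fM] s t.
wlog st : s t / s <= t => [H hs ht|].
  have [st|/ltW ts] := leP s t; first exact: H.
  by rewrite distrC [`|t - s|]distrC; exact: H.
move=> /andP[s1 s2] /andP[t1 t2]; rewrite ger0_norm ?subr_ge0//.
have [->|stn] := eqVneq s t.
  by rewrite !subrr normr0 add0r mulr_ge0// ltW.
have {stn} st' : s < t by rewrite lt_neqAle stn.
apply: HL => //; first exact: ltW.
  by apply: (P_sub s1 t2); apply: Pi; exact: le_lt_trans s1 (lt_le_trans st' t2).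
move=> q /andP[q1 q2]; apply: fM; rewrite (le_trans s1)//=; exact: le_trans t2.
Qed.

(** The speed bound makes the pointwise limit Lipschitz, hence differentiable almost
    everywhere.  Its increments over a short interval are limits of increments,
    which the window estimate compares with displacements along [F]; so its
    derivative is adherent to the closed set of values of [F]. *)
Lemma limit_piece : exists2 g : R -> V,
  (forall (s : nat -> R) s0, (\forall i \near U, a i <= s i <= b i) -> s @ U --> s0 ->
     (fun i => f i (s i)) @ U --> g s0) &
  (a0 < b0 -> [/\ forall s, a0 <= s <= b0 -> C (g s), abs_continuous_on g a0 b0 &
     {ae (@lebesgue_measure R), forall s, a0 < s < b0 ->
       derivable g s 1 /\ F (g s) ('D_1 g s)}]).
Proof.
have [L L0 HL] := speed_bound.
have ab : \forall i \near U, a i <= b i by apply: filterS f_piece => i [].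
have /choice[g Hg] : forall s, exists l : V, (fun i => f i (clamp (a i) (b i) s)) @ U --> l.
  move=> s; apply: (bounded_ultralimit UU (M := M)); apply: filterS f_piece => i [h1 _].
  by apply; exact: clamp_itv.
have lim_s (s : nat -> R) s0 : (\forall i \near U, a i <= s i <= b i) -> s @ U --> s0 ->
     (fun i => f i (s i)) @ U --> g s0.
  move=> sab cs; apply/near_cvg_norm => d d0.
  have d4 : 0 < d / 4 by rewrite divr_gt0.
  have dL : 0 < d / 4 / L by rewrite divr_gt0.
  have h1 := ultra_cvg_near UU (Hg s0) d4.
  have h2 := ultra_cvg_near UU e_cvg dL.
  have h3 := ultra_cvg_near UU cs dL.
  near=> i; rewrite -(subrKA (f i (clamp (a i) (b i) s0))).
  apply: (le_lt_trans (ler_normD _ _)).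
  have hi1 : `|f i (clamp (a i) (b i) s0) - g s0| < d / 4 by near: i.
  have hi2 : `|e i - 0| < d / 4 / L by near: i.
  have hi3 : `|s i - s0| < d / 4 / L by near: i.
  have hab : a i <= b i by near: i.
  have hs : a i <= s i <= b i by near: i.
  have HLi : forall s t, a i <= s <= b i -> a i <= t <= b i ->
    `|f i t - f i s| <= L * (`|t - s| + e i) by near: i.
  have := HLi (clamp (a i) (b i) s0) (s i) (clamp_itv s0 hab) hs.
  rewrite -{2}(clamp_id hs) => /le_trans/(_ (ler_wpM2l (ltW L0)
    (lerD (clamp_lip (a i) (b i) (s i) s0) (lexx _)))) H.
  have : L * (`|s i - s0| + e i) < d / 2.
    rewrite mulrC -ltr_pdivlMr//; move: hi2; rewrite subr0 ger0_norm ?(ltW (e_gt0 i))// => hi2.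
    by move: hi3 hi2; lra.
  by move: H hi1; lra.
have g_lip s t : `|g s - g t| <= L * `|s - t|.
  apply: (cvg_dist_le (Hg s)) => d d0.
  have d2 : 0 < d / 2 by rewrite divr_gt0.
  have dL : 0 < d / 2 / L by rewrite divr_gt0.
  have h1 := ultra_cvg_near UU (Hg t) d2.
  have h2 := ultra_cvg_near UU e_cvg dL.
  near=> i; rewrite -(subrKA (f i (clamp (a i) (b i) t))).
  apply: (le_trans (ler_normD _ _)).
  have hi1 : `|f i (clamp (a i) (b i) t) - g t| < d / 2 by near: i.
  have hi2 : `|e i - 0| < d / 2 / L by near: i.
  have hab : a i <= b i by near: i.
  have HLi : forall s t, a i <= s <= b i -> a i <= t <= b i ->
    `|f i t - f i s| <= L * (`|t - s| + e i) by near: i.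
  have := HLi _ _ (clamp_itv t hab) (clamp_itv s hab).
  move=> /le_trans/(_ (ler_wpM2l (ltW L0)
    (lerD (clamp_lip (a i) (b i) s t) (lexx _)))) H.
  have : L * e i < d / 2.
    by rewrite mulrC -ltr_pdivlMr//; move: hi2; rewrite subr0 ger0_norm ?(ltW (e_gt0 i)).
  by move: H hi1; rewrite mulrDr; lra.
exists g => // a0b0.
have gC s : a0 <= s <= b0 -> C (g s).
  move=> /andP[s1 s2].
  pose si i := clamp (a i) (b i) s.
  have si_s : si @ U --> s.
    apply/near_cvg_norm => d d0.
    have h1 := ultra_cvg_near UU a_cvg d0.
    have h2 := ultra_cvg_near UU b_cvg d0.
    near=> i.
    have hi1 : `|a i - a0| < d by near: i.
    have hi2 : `|b i - b0| < d by near: i.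
    have hab : a i <= b i by near: i.
    move: hi1 hi2; rewrite /si /clamp !ltr_norml => /andP[x1 x2] /andP[x3 x4].
    by case: (leP s (b i)) => sb; case: (leP (a i) _) => h; apply/andP; split; lra.
  have ab2 : 0 < (b0 - a0) / 2 by rewrite divr_gt0 ?subr_gt0.
  have N1 := ultra_cvg_near UU a_cvg ab2.
  have N2 := ultra_cvg_near UU b_cvg ab2.
  apply: (closed_cvg _ C_closed) (Hg s).
  near=> i.
  have hab : a i <= b i by near: i.
  have [_ Pi _] : [/\ a i <= b i, a i < b i -> P (e i) (a i) (b i) (f i) &
    forall s, a i <= s <= b i -> `|f i s| <= M] by near: i.
  have lt_ab : a i < b i.
    have hi1 : `|a i - a0| < (b0 - a0) / 2.
      by near: i.
    have hi2 : `|b i - b0| < (b0 - a0) / 2.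
      by near: i.
    by move: hi1 hi2; rewrite !ltr_norml => /andP[x1 x2] /andP[x3 x4]; lra.
  by apply: (P_C (Pi lt_ab)); exact: clamp_itv.
split=> //.
- move=> d d0; exists (d / L); first exact: divr_gt0.
  move=> N u v uv _ Hsum; apply: (@le_lt_trans _ _ (L * \sum_(k < N) (v k - u k))).
    rewrite mulr_sumr; apply: ler_sum => k _; apply: (le_trans (g_lip _ _)).
    by have [_ [h _]] := uv k; rewrite ger0_norm ?subr_ge0.
  by rewrite mulrC -ltr_pdivlMr.
have ae_d : {ae (@lebesgue_measure R), forall s, forall j : 'I_n, a0 < s < b0 ->
    derivable (fun q => g q 0 j) s 1}.
  apply: (@filter_forall _ _ (fun (j : 'I_n) s => a0 < s < b0 ->
    derivable (fun q => g q 0 j) s 1)) => [|j].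
    exact: (ae_filter_ringOfSetsType (@lebesgue_measure R)).
  apply: (@lipschitz_ae_derivable _ _ L) => s t; apply: le_trans (g_lip s t).
  by have := rV_coord_le (g s - g t) j; rewrite !mxE.
apply: ae_imply ae_d => s Hs s_in.
have ds : derivable g s 1.
  by apply/derivable_mxP => i j; rewrite (ord1 i); exact: Hs.
split => //.
have /andP[s1 s2] := s_in.
have Cs : C (g s) by apply: gC; rewrite !ltW.
set Dg := 'D_1 g s.
suff dense : forall eta, 0 < eta -> exists2 v, F (g s) v & `|v - Dg| < eta.
  apply: (F_closed Cs) => B /nbhs_radius[q q0 HB].
  by have [v Fv vD] := dense q q0; exists v; split => //; exact: HB.
move=> eta eta0; have e4 : 0 < eta / 4 by rewrite divr_gt0.
have [d [c [eps0 [d0 c0 eps00 W]]]] := P_window Cs e4.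
have /nbhs_radius[q q0 Hq] := derivable_apd ds e4.
(* A step short enough for the derivative of [g], for the interval and for the
   window. *)
pose h := Num.min (q / 2) (Num.min ((b0 - s) / 2) (d / 4 / L)).
have bs : 0 < b0 - s by rewrite subr_gt0.
have dL : 0 < d / 4 / L by rewrite !divr_gt0.
have h0 : 0 < h by rewrite !lt_min !divr_gt0.
have [hq hb hd] : [/\ h <= q / 2, h <= (b0 - s) / 2 & h <= d / 4 / L].
  by rewrite /h !ge_min !lexx ?orbT.
pose kappa := eta * h / 16.
have kappa0 : 0 < kappa by rewrite divr_gt0// mulr_gt0.
have c1 : 0 < c + 1 by rewrite ltr_wpDl.
have kc : 0 < kappa / (c + 1) by rewrite divr_gt0.
have d4 : 0 < d / 4 by rewrite divr_gt0.
have as0 : 0 < s - a0 by rewrite subr_gt0.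
have bs2 : 0 < (b0 - s) / 2 by rewrite divr_gt0.
have N1 := ultra_cvg_near UU a_cvg as0.
have N2 := ultra_cvg_near UU b_cvg bs2.
have E (x : R) : 0 < x -> \forall i \near U, e i < x.
  move=> x0; apply: filterS (ultra_cvg_near UU e_cvg x0) => k.
  by rewrite subr0 ger0_norm// ltW.
have N3 := E _ eps00; have N4 := E _ kc; have N5 := E _ dL.
have N6 := ultra_cvg_near UU (Hg s) kappa0.
have N7 := ultra_cvg_near UU (Hg s) d4.
have N8 := ultra_cvg_near UU (Hg (s + h)) kappa0.
near U => i.
have [hab Pi _] : [/\ a i <= b i, a i < b i -> P (e i) (a i) (b i) (f i) &
    forall s, a i <= s <= b i -> `|f i s| <= M] by near: i.
have HLi : forall s t, a i <= s <= b i -> a i <= t <= b i ->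
    `|f i t - f i s| <= L * (`|t - s| + e i) by near: i.
have ai : a i < s.
  have : `|a i - a0| < s - a0 by near: i.
  by rewrite ltr_norml => /andP[_]; lra.
have bi : s + h < b i.
  have : `|b i - b0| < (b0 - s) / 2 by near: i.
  by rewrite ltr_norml => /andP[]; lra.
have si : a i <= s <= b i by rewrite (ltW ai)/=; apply: ltW; apply: le_lt_trans bi; lra.
have shi : a i <= s + h <= b i by rewrite (ltW bi) andbT; apply: ltW; apply: lt_le_trans ai _; lra.
have ei : e i < eps0 /\ e i < kappa / (c + 1) /\ e i < d / 4 / L.
  by split; [|split]; near: i.
have [ei1 [ei2 ei3]] := ei.
have f1 : `|f i s - g s| < kappa.
  by rewrite -{1}(clamp_id si); near: i.
have f2 : `|f i s - g s| < d / 4.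
  by rewrite -{1}(clamp_id si); near: i.
have f3 : `|f i (s + h) - g (s + h)| < kappa.
  by rewrite -{1}(clamp_id shi); near: i.
have ssh : s <= s + h by rewrite lerDl ltW.
have Pis : P (e i) s (s + h) (f i).
  apply: (P_sub (ltW ai) (ltW bi)); apply: Pi.
  by apply: (lt_trans ai); apply: le_lt_trans bi.
have stay t : s <= t <= s + h -> `|f i t - g s| <= d.
  move=> /andP[t1 t2].
  have ti : a i <= t <= b i.
    by rewrite (le_trans (ltW ai) t1)/= (le_trans t2)// ltW.
  rewrite -(subrKA (f i s)); apply: (le_trans (ler_normD _ _)).
  have := HLi s t si ti; rewrite (ger0_norm (x := t - s)) ?subr_ge0// => Ht.
  have : L * (t - s + e i) <= d / 2.
    rewrite mulrC -ler_pdivlMr//.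
    have -> : d / 2 / L = d / 4 / L + d / 4 / L by field; rewrite lt0r_neq0.
    by apply: lerD; [lra|exact: ltW].
  by move: Ht f2; lra.
have [v Fv Hv] := W _ (e_gt0 i) (ltW ei1) s (s + h) (f i) ssh Pis stay.
exists v => //.
have := Hq (s + h); rewrite addrAC subrr add0r (ger0_norm (ltW h0)) => /(_ _) HD.
have {}HD : `|g (s + h) - g s - h *: Dg| <= eta / 4 * h.
  have := HD ltac:(by lra); by rewrite add0r.
have {}Hv : `|f i (s + h) - f i s - h *: v| <= eta / 4 * h + kappa.
  move: Hv; rewrite (_ : s + h - s = h); last by rewrite addrAC subrr add0r.
  move=> /le_trans; apply; rewrite lerD2l.
  apply: (@le_trans _ _ (c * (kappa / (c + 1)))); first by rewrite ler_wpM2l// ltW.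
  by rewrite mulrCA ler_piMr ?(ltW kappa0)// ler_pdivrMr// mul1r lerDl.
have key : h * `|v - Dg| < eta * h.
  rewrite -[X in X * _](ger0_norm (ltW h0)) -normrZ.
  rewrite (_ : h *: (v - Dg) = (g (s + h) - g s - h *: Dg)
    - (f i (s + h) - f i s - h *: v)
    + (f i (s + h) - g (s + h)) - (f i s - g s)); last first.
    by apply/rowP => j; rewrite !mxE; ring.
  apply: (le_lt_trans (ler_normB _ _)).
  apply: (@le_lt_trans _ _ (eta / 4 * h + (eta / 4 * h + kappa) + kappa + kappa)).
    apply: lerD; last exact: ltW.
    apply: (le_trans (ler_normD _ _)); apply: lerD; last exact: ltW.
    by apply: (le_trans (ler_normB _ _)); exact: lerD.
  have : 0 < eta * h by rewrite mulr_gt0.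
  by rewrite /kappa; lra.
by move: key; rewrite [ltRHS]mulrC ltr_pM2l.
Unshelve. all: by end_near. Qed.

End LimitPiece.

(** * Hybrid trajectories as finite sequences of flows *)

Lemma ae_neq (R : realType) (c : R) : {ae (@lebesgue_measure R), forall x, x <> c}.
Proof.
exists [set c]; split; [exact: measurable_set1|exact: lebesgue_measure_set1|].
by move=> x /= /contrapT.
Qed.

Lemma ae_imply3 (R : realType) (P1 P2 P3 Q : R -> Prop) :
  {ae (@lebesgue_measure R), forall x, P1 x} ->
  {ae (@lebesgue_measure R), forall x, P2 x} ->
  {ae (@lebesgue_measure R), forall x, P3 x} ->
  (forall x, P1 x -> P2 x -> P3 x -> Q x) ->
  {ae (@lebesgue_measure R), forall x, Q x}.
Proof.
move=> h1 h2 h3 H.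
have FF := ae_filter_ringOfSetsType (@lebesgue_measure R).
by apply: (@filterS3 _ _ FF _ _ _ _ H).
Qed.

Section Runs.
Variables (R : realType) (m : nat).
Notation V := 'rV[R]_m.

(** An interval between two jumps may be reduced to a point, as it happens for
    consecutive jumps: then [P] is not required, and [f j] only matters at this
    point. *)
Definition is_run (P : R -> R -> (R -> V) -> Prop) (S D : set V) (G : V -> set V)
    (J : nat) (t : nat -> R) (f : nat -> R -> V) : Prop :=
  [/\ t 0%N = 0, forall j, (j <= J)%N -> t j <= t j.+1,
      forall j, (j <= J)%N -> t j < t j.+1 -> P (t j) (t j.+1) (f j),
      forall j, (j < J)%N -> D (f j (t j.+1)) /\ G (f j (t j.+1)) (f j.+1 (t j.+1)) &
      S (f 0%N 0)].

Lemma run_time_le (J : nat) (t : nat -> R) :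
  (forall j, (j <= J)%N -> t j <= t j.+1) ->
  forall i j, (i <= j)%N -> (j <= J.+1)%N -> t i <= t j.
Proof.
move=> tmono i j; elim: j => [|j IH]; first by rewrite leqn0 => /eqP->.
rewrite leq_eqVlt => /orP[/eqP->//|ij] jJ.
by apply: le_trans (IH ij (ltnW jJ)) (tmono _ _).
Qed.

Variable H : hybrid_system R m.

Lemma solution_run E y : hybrid_solution H E y -> forall T J, E (T, J) ->
  exists2 t, is_run (flow_piece H) (flow_set H `|` jump_set H) (jump_set H) (jump_map H)
    J t (fun j s => y s j) & t J.+1 = T.
Proof.
move=> [[[E0 htd] ac] [_ Y0] flow jump] T J ET.
have [J' [t [t0 tmono EE]]] := htd T J ET.
have T0 : 0 <= T := E0 _ ET.
have inE s j : (j < J')%N -> t j <= s <= t j.+1 -> E (s, j) /\ s <= T.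
  move=> jJ' hs; have : [set p : R * nat | (p.2 < J')%N /\ t p.2 <= p.1 <= t p.2.+1] (s, j).
    by [].
  by rewrite -EE => -[Es /= [/andP[_ sT] _]].
have : (E `&` [set p | 0 <= p.1 <= T /\ (p.2 <= J)%N]) (T, J) by rewrite /= T0 !lexx leqnn.
rewrite EE => -[/= JJ' /andP[tJ Tt]].
have lt_J' j : (j <= J)%N -> (j < J')%N by move=> jJ; exact: leq_ltn_trans JJ'.
exists t; last first.
  apply/le_anti; rewrite Tt andbT.
  by have [] := inE (t J.+1) J JJ' _; rewrite ?lexx ?andbT// tmono.
split => //.
- by move=> j jJ; apply: tmono; exact: lt_J'.
- move=> j jJ tj; have sub : `[t j, t j.+1]%classic `<=` time_slice E j.
    by move=> s /=; rewrite in_itv/= => hs; have [] := inE s j (lt_J' _ jJ) hs.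
  have int : (time_slice E j)° !=set0.
    exists ((t j + t j.+1) / 2).
    have mid : (t j + t j.+1) / 2 \in `]t j, t j.+1[.
      by rewrite in_itv/=; apply/andP; split; lra.
    apply: filterS (near_in_itvoo mid) => s; rewrite in_itv/= => /andP[/ltW h1 /ltW h2].
    by apply: sub; rewrite /= in_itv/= h1.
  have [h1 h2] := flow j int; split.
  + by move=> s hs; apply: h1; apply: sub; rewrite /= in_itv.
  + exact: (ac j int _ _ sub).
  + apply: ae_imply h2 => s Hs /andP[/ltW s1 /ltW s2]; apply: Hs; apply: sub.
    by rewrite /= in_itv/= s1.
- move=> j jJ; apply: jump.
    by have [] := inE (t j.+1) j (lt_J' _ (ltnW jJ)) _; rewrite ?lexx ?andbT// tmono// lt_J'// ltnW.
  by have [] := inE (t j.+1) j.+1 (lt_J' _ jJ) _; rewrite ?lexx//= tmono// lt_J'.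
Qed.

Lemma run_solution J t f :
  is_run (flow_piece H) (flow_set H `|` jump_set H) (jump_set H) (jump_map H) J t f ->
  hybrid_solution H [set p | (p.2 <= J)%N /\ t p.2 <= p.1 <= t p.2.+1] (fun s j => f j s).
Proof.
move=> [t0 tmono piece jump init]; set E := [set p | _].
have tle := run_time_le tmono.
have tj0 j : (j <= J.+1)%N -> 0 <= t j by move=> jJ; rewrite -t0; exact: tle.
have int_lt j : (time_slice E j)° !=set0 -> (j <= J)%N /\ t j < t j.+1.
  move=> [x /nbhs_radius[q q0 Hq]].
  have q2 : 0 < q / 2 by rewrite divr_gt0.
  have [jJ /andP[x1 x2]] : E (x + q / 2, j).
    by apply: Hq; rewrite addrAC subrr add0r ger0_norm; lra.
  have [_ /andP[x3 x4]] : E (x - q / 2, j).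
    by apply: Hq; rewrite addrAC subrr add0r normrN ger0_norm; lra.
  by split => //; move: x1 x2 x3 x4 => /=; lra.
split.
- split; last first.
    move=> j /int_lt[jJ tj] a b ab; have [_ ac _] := piece j jJ tj.
    move=> e /ac[d d0 Hd]; exists d => // N u v uv; apply: Hd => k.
    have [k1 [k2 k3]] := uv k.
    have [_ /andP[/= h1 _]] : time_slice E j a.
      by apply: ab; rewrite /= in_itv/= lexx (le_trans k1)// (le_trans k2).
    have [_ /andP[/= _ h2]] : time_slice E j b.
      by apply: ab; rewrite /= in_itv/= lexx andbT (le_trans k1)// (le_trans k2).
    by split; [exact: le_trans h1 k1|split => //; exact: le_trans k3 h2].
  split; first by move=> [s j] [/= jJ /andP[h _]]; apply: le_trans h; apply: tj0; exact: leqW.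
  move=> T K [/= KJ /andP[tK KT]].
  exists K.+1, (fun j => if (j <= K)%N then t j else T); split.
  + by rewrite leq0n.
  + move=> j; rewrite ltnS => jK; rewrite jK; case: ltnP => jK1.
      by apply: tmono; exact: leq_trans KJ.
    by have -> : j = K by apply/eqP; rewrite eqn_leq jK.
  + apply/seteqP; split => -[s j] /=.
      move=> [[jJ /andP[h1 h2]] [/andP[_ sT] jK]]; split; first by rewrite ltnS.
      by rewrite jK h1; case: ltnP.
    move=> [jK]; rewrite ltnS in jK; rewrite jK => /andP[h1].
    case: ltnP => [jK1 h2|Kj h2].
      split; first by split; [exact: leq_trans KJ|rewrite h1].
      split => //; rewrite (le_trans (tj0 j _) h1)/=; last by rewrite leqW// (leq_trans jK).
      by rewrite (le_trans h2)// (le_trans _ tK)//; apply: tle => //; exact: leqW.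
    have jE : j = K by apply/eqP; rewrite eqn_leq jK.
    rewrite jE in h1 *; split; first by split => //; rewrite h1 (le_trans h2).
    by split => //; rewrite h2 andbT (le_trans (tj0 K _) h1)// leqW.
- split; last by [].
  by rewrite /E /= t0 lexx; split => //; rewrite tj0.
- move=> j /int_lt[jJ tj]; have [h1 _ h3] := piece j jJ tj; split.
    by move=> s [_ hs]; exact: h1.
  apply: (@ae_imply3 _ _ (fun s => s <> t j) (fun s => s <> t j.+1) _ h3
    (@ae_neq _ _) (@ae_neq _ _)) => s Hs n1 n2 [_ /andP[/= s1 s2]].
  by apply: Hs; rewrite !lt_neqAle s1 s2 !andbT; apply/andP; split; apply/eqP => // /esym.
- move=> s j [/= jJ /andP[s1 s2]] [/= jJ' /andP[s3 s4]].
  have -> : s = t j.+1 by apply/le_anti; rewrite s2 s3.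
  exact: jump.
Qed.

End Runs.

(** * Limits of hybrid trajectories *)

Section LimitRun.
Variables (R : realType) (n : nat) (H : hybrid_system R n).
Notation V := 'rV[R]_n.
Notation C := (flow_set H).
Notation D := (jump_set H).
Variable P : R -> R -> R -> (R -> V) -> Prop.
Hypothesis AF : approximate_flow C (flow_map H) P.
Hypothesis D_closed : closed D.
Hypothesis G_osc : forall th, D th -> osc_at (jump_map H) th.

Variable U : set_system nat.
Hypothesis UU : UltraFilter U.
Variables (e : nat -> R) (J : nat -> nat) (t : nat -> nat -> R) (f : nat -> nat -> R -> V).
Variables (M T : R) (N : nat).
Hypothesis e_gt0 : forall i, 0 < e i.
Hypothesis e_cvg : e @ U --> 0.
Hypothesis runs : forall i, is_run (P (e i)) (C `|` D) D (jump_map H) (J i) (t i) (f i).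
Hypothesis T_bound : forall i, t i (J i).+1 <= T.
Hypothesis J_bound : forall i, (J i <= N)%N.
Hypothesis f_bound : forall i j s, (j <= J i)%N -> t i j <= s <= t i j.+1 ->
  `|f i j s| <= M.

(** The number of jumps takes finitely many values, so that it is constant along the
    ultrafilter; jump times, flows and jumps then converge separately. *)
Lemma limit_run : exists Jo to fo,
  [/\ is_run (flow_piece H) (C `|` D) D (jump_map H) Jo to fo,
      \forall i \near U, J i = Jo,
      forall j, (j <= Jo.+1)%N -> (fun i => t i j) @ U --> to j &
      forall j, (j <= Jo)%N -> forall (s : nat -> R) s0,
        (\forall i \near U, t i j <= s i <= t i j.+1) -> s @ U --> s0 ->
        (fun i => f i j (s i)) @ U --> fo j s0].
Proof.
have [Jo HJ] : exists Jo, \forall i \near U, J i = Jo.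
  apply: (@ultra_nat_constant U UU J N).
  by apply: (@filterS _ _ _ setT) => [i _ //|]; exact: filterT.
have tmono i j : (j <= J i)%N -> t i j <= t i j.+1.
  by have [_ h _ _ _] := runs i; exact: h.
have /choice[to Hto] : forall j, exists l : R, (j <= Jo.+1)%N -> (fun i => t i j) @ U --> l.
  move=> j; have [jJ|jJ] := leqP j Jo.+1; last by exists 0.
  have [|l Hl] := @compact_ultralimit U UU _ `[0, T]%classic (fun i => t i j)
    (@segment_compact _ _ _); last by exists l.
  apply: filterS HJ => i Ji; rewrite /= in_itv/=; have tle := run_time_le (@tmono i).
  have [ti0 _ _ _ _] := runs i; rewrite -{1}ti0 tle// ?Ji//=.
  by apply: le_trans (T_bound i); apply: tle; rewrite Ji.
have piece j : (j <= Jo)%N -> exists2 g : R -> V,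
  (forall (s : nat -> R) s0, (\forall i \near U, t i j <= s i <= t i j.+1) -> s @ U --> s0 ->
     (fun i => f i j (s i)) @ U --> g s0) &
  (to j < to j.+1 -> flow_piece H (to j) (to j.+1) g).
  move=> jJ.
  have fp : \forall i \near U, [/\ t i j <= t i j.+1,
      t i j < t i j.+1 -> P (e i) (t i j) (t i j.+1) (f i j) &
      forall s, t i j <= s <= t i j.+1 -> `|f i j s| <= M].
    apply: filterS HJ => i Ji; have [_ h1 h2 _ _] := runs i; split.
    - by apply: h1; rewrite Ji.
    - by apply: h2; rewrite Ji.
    - by move=> s; apply: f_bound; rewrite Ji.
  have [g h1 h2] := @limit_piece R n C (flow_map H) P AF U UU e _ _ _ M _ _ e_gt0 e_cvg (Hto j (leqW jJ)) (Hto j.+1 jJ) fp.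
  by exists g.
have /choice[fo Hfo] : forall j, exists g : R -> V, (j <= Jo)%N ->
  (forall (s : nat -> R) s0, (\forall i \near U, t i j <= s i <= t i j.+1) -> s @ U --> s0 ->
     (fun i => f i j (s i)) @ U --> g s0) /\
  (to j < to j.+1 -> flow_piece H (to j) (to j.+1) g).
  move=> j; have [jJ|jJ] := leqP j Jo; last by exists (fun=> 0).
  by have [g h1 h2] := piece j jJ; exists g.
have near_J (A : nat -> Prop) : (forall i, J i = Jo -> A i) -> \forall i \near U, A i.
  by move=> HA; apply: filterS HJ.
have pt_end j : (j <= Jo)%N -> (fun i => f i j (t i j.+1)) @ U --> fo j (to j.+1).
  move=> jJ; apply: (Hfo j jJ).1; last exact: Hto.
  by apply: near_J => i Ji; rewrite lexx andbT tmono// Ji.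
have pt_start j : (j <= Jo)%N -> (fun i => f i j (t i j)) @ U --> fo j (to j).
  move=> jJ; apply: (Hfo j jJ).1; last by apply: Hto; exact: leqW.
  by apply: near_J => i Ji; rewrite lexx tmono// Ji.
have to0 : to 0%N = 0.
  apply/eqP; rewrite -subr_eq0 -normr_le0; apply: (@cvg_dist_le _ U _ _ _ _ _ _ (Hto 0%N isT)).
  move=> d d0; apply: near_J => i _; have [-> _ _ _ _] := runs i.
  by rewrite subrr normr0 add0r ltW.
exists Jo, to, fo; split => //; last by move=> j /Hfo[].
split => //.
- move=> j jJ; apply: (ler_cvg_to (Hto j (leqW jJ)) (Hto j.+1 jJ)).
  by apply: near_J => i Ji; apply: tmono; rewrite Ji.
- by move=> j jJ; have [_ h] := Hfo j jJ.
- move=> j jJ.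
  have jumpi : \forall i \near U, D (f i j (t i j.+1)) /\
      jump_map H (f i j (t i j.+1)) (f i j.+1 (t i j.+1)).
    by apply: near_J => i Ji; have [_ _ _ h _] := runs i; apply: h; rewrite Ji.
  have Dj : D (fo j (to j.+1)).
    apply: (closed_cvg _ D_closed) (pt_end j (ltnW jJ)).
    by apply: filterS jumpi => i [].
  split => //; apply: (osc_at_filter (G_osc Dj) (pt_end j (ltnW jJ)) (pt_start j.+1 jJ)).
  by apply: filterS jumpi => i [].
- have cS : closed (C `|` D) by apply: closedU => //; exact: af_closed AF.
  have := pt_start 0%N isT; rewrite to0; apply: (closed_cvg _ cS).
  by apply: near_J => i _; have [-> _ _ _] := runs i.
Qed.

End LimitRun.

(** * First violation of an estimate *)

Section FirstViolation.
Variables (R : realType) (m : nat).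
Notation V := 'rV[R]_m.
Variables (P : R -> R -> (R -> V) -> Prop) (S D : set V) (G : V -> set V).
Hypothesis P_ac : forall a b f, P a b f -> abs_continuous_on f a b.
Hypothesis P_sub : forall a b a' b' f, a <= a' -> b' <= b -> P a b f -> P a' b' f.

Lemma run_truncate J t f j s : is_run P S D G J t f -> (j <= J)%N ->
  t j <= s <= t j.+1 -> is_run P S D G j (fun k => if (k <= j)%N then t k else s) f.
Proof.
move=> [t0 tmono piece jump init] jJ /andP[tj js]; split => //.
- move=> k kj; rewrite kj; case: ltnP => kj1; first by apply: tmono; exact: leq_trans jJ.
  by have -> : k = j by apply/eqP; rewrite eqn_leq kj.
- move=> k kj; rewrite kj; case: ltnP => kj1; first by apply: piece; exact: leq_trans jJ.
  have -> : k = j by apply/eqP; rewrite eqn_leq kj.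
  by move=> ts; apply: (P_sub (lexx _) js); apply: piece => //; exact: lt_le_trans js.
- by move=> k kj; rewrite kj; apply: jump; exact: leq_trans jJ.
Qed.

(** Trajectories are only known to be bounded as long as the estimate holds.  Stopping
    at an early violation keeps them in a fixed ball, where limits can be taken:
    a violation due to a jump happens in the bounded image of [G], and during a flow
    there are violations so early that the trajectory has moved by at most [1] since
    the estimate held. *)
Lemma first_violation (bad : nat -> R -> Prop) (M : R) J t f :
  is_run P S D G J t f ->
  (forall j s, (j <= J)%N -> t j <= s <= t j.+1 -> ~ bad j s -> `|f j s| <= M) ->
  (forall th v, D th -> G th v -> `|v| <= M) -> `|f 0%N 0| <= M ->
  bad J (t J.+1) ->
  exists j s, [/\ (j <= J)%N, t j <= s <= t j.+1, bad j s &
    forall k q, (k <= j)%N -> t k <= q <= (if (k < j)%N then t k.+1 else s) ->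
      `|f k q| <= M + 1].
Proof.
move=> [t0 tmono piece jump init] good GM f0 badJ.
have /asboolP exj : exists j s, [/\ (j <= J)%N, t j <= s <= t j.+1 & bad j s].
  by exists J, (t J.+1); rewrite leqnn lexx tmono.
pose p j := `[< exists s, [/\ (j <= J)%N, t j <= s <= t j.+1 & bad j s] >].
have exp : exists j, p j by move/asboolP: exj => [j Hj]; exists j; apply/asboolP.
case: (ex_minnP exp) => j /asboolP[s1 [jJ s1j bad1]] jmin.
have Mle (x : R) : x <= M -> x <= M + 1 by lra.
have before k q : (k < j)%N -> t k <= q <= t k.+1 -> `|f k q| <= M + 1.
  move=> kj hq; apply: Mle; have kJ : (k <= J)%N by exact: leq_trans (ltnW kj) jJ.
  apply: good => // bk; have : p k by apply/asboolP; exists q.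
  by move=> /jmin; rewrite leqNgt kj.
have [bj|nbj] := pselect (bad j (t j)).
  exists j, (t j); split => //; first by rewrite lexx tmono.
  move=> k q kj; case: ltnP => kj1; first exact: before.
  have {kj1}-> : k = j by apply/eqP; rewrite eqn_leq kj.
  move=> /le_anti <-; apply: Mle; case: j jJ {s1j bad1 jmin before bj kj} => [_|j jJ].
    by rewrite t0.
  by have [h1 h2] := jump j jJ; exact: GM h2.
apply: contrapT => Hn.
have Hb s : t j <= s <= t j.+1 -> bad j s ->
    exists2 q, t j <= q <= s & ~ `|f j q| <= M + 1.
  move=> hs bs; apply: contrapT => Hq; apply: Hn; exists j, s; split => // k q kj.
  case: ltnP => kj1; first exact: before.
  have {kj1}-> : k = j by apply/eqP; rewrite eqn_leq kj.
  by move=> hq; apply: contrapT => nq; apply: Hq; exists q.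
have tj : t j < t j.+1.
  rewrite lt_neqAle tmono// andbT; apply/eqP => E; apply: nbj.
  by move: s1j bad1; rewrite -E => /le_anti ->.
have [d d0 Hd] := abs_continuous_dist (P_ac (piece j jJ tj)) (@ltr01 R).
suff /(_ s1) : forall q, t j <= q <= t j.+1 -> ~ bad j q by apply.
apply: (@cousin_induction _ (t j) (t j.+1) (fun s => forall q, t j <= q <= s -> ~ bad j q)).
- exact: ltW.
- by move=> q /le_anti <-.
move=> c /andP[jc cj]; exists (d / 2); first by rewrite divr_gt0.
move=> u v [ju uc cv vj] cu vc Qu q /andP[q1 q2] bq.
have [q' /andP[q'1 q'2] q'M] := Hb q (introT andP (conj q1 (le_trans q2 vj))) bq.
have uj : t j <= u <= t j.+1 by rewrite ju (le_trans uc).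
have fu : `|f j u| <= M by apply: good => //; apply: Qu; rewrite ju lexx.
have [q'u|uq'] := leP q' u.
  by apply: q'M; apply: Mle; apply: good => //; [rewrite q'1 (le_trans q'u)// (le_trans uc)|
    apply: Qu; rewrite q'1].
apply: q'M; rewrite -[f j q'](subrK (f j u)); apply: (le_trans (ler_normD _ _)).
rewrite addrC lerD//; apply: ltW; apply: Hd => //.
  by rewrite q'1 (le_trans q'2)// (le_trans q2).
rewrite ger0_norm ?subr_ge0 ?(ltW uq')//.
have := le_trans q'2 q2; lra.
Qed.

End FirstViolation.

(** * Sublevel sets of proper indicators *)

Section Indicator.
Variables (R : realType) (n : nat) (A B : set 'rV[R]_n) (omega : 'rV[R]_n -> R).
Hypothesis B_open : open B.
Hypothesis omega_proper : proper_indicator A B omega.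

Lemma omega_ultralimit (U : set_system nat) (UU : UltraFilter U) (u : nat -> 'rV[R]_n) l :
  B l -> u @ U --> l -> (fun i => omega (u i)) @ U --> omega l.
Proof.
move=> Bl ul; have [_ cw _ _] := omega_proper.
move: cw; rewrite continuous_open_subspace// => cw.
exact: cvg_comp ul (cw l (mem_set Bl)).
Qed.

Lemma omega_bounded K : compact K -> K `<=` B -> exists c, forall x, K x -> omega x <= c.
Proof.
move=> cK KB; apply: contrapT => Hn.
have /choice[u Hu] : forall i : nat, exists x, K x /\ i%:R < omega x.
  move=> i; apply: contrapT => Hi; apply: Hn; exists i%:R => x Kx.
  by rewrite leNgt; apply/negP => h; apply: Hi; exists x.
have [U UU Uoo] := ultra_free.
have uK : \forall i \near U, K (u i).
  by apply: (@filterS _ _ _ setT) => [i _|]; [have [] := Hu i|exact: filterT].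
have [l ul] := compact_ultralimit UU cK uK.
have Kl : K l by exact: (closed_cvg _ (compact_closed (@norm_hausdorff _ _) cK)) ul.
have H1 := ultra_cvg_near UU (omega_ultralimit UU (KB _ Kl) ul) (@ltr01 R).
have H2 : \forall i \near U, omega l + 1 <= i%:R by apply: Uoo; exact: nbhs_infty_ger.
have [i [h1 h2]] := filter_ex (filterI H1 H2).
have [_ h3] := Hu i; move: h1; rewrite /= ltr_norml => /andP[_]; move: h2 => /=; lra.
Qed.

(** A sequence in the sublevel set can neither be unbounded nor approach the boundary
    of [B], since [omega] is bounded along it. *)
Lemma sublevel_compact c : compact [set x | B x /\ omega x <= c].
Proof.
have [w0 _ _ wb] := omega_proper.
have nb (u : nat -> 'rV[R]_n) : (forall i, B (u i) /\ omega (u i) <= c) ->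
    approaches_boundary B u \/ ~ bounded_set (range u) -> False.
  move=> Hu /(wb u (fun i => (Hu i).1)); apply; exists c; split; first exact: num_real.
  move=> M cM y [i _ <-] /=; have [Bu uc] := Hu i.
  by rewrite ger0_norm ?w0// (le_trans uc)// ltW.
apply: bounded_closed_compact.
  apply: contrapT => Hn.
  have /choice[u Hu] : forall i : nat, exists x, (B x /\ omega x <= c) /\ i%:R < `|x|.
    move=> i; apply: contrapT => Hi; apply: Hn; exists i%:R; split; first exact: num_real.
    move=> M iM x Hx /=; apply: (le_trans _ (ltW iM)); rewrite leNgt; apply/negP => h.
    by apply: Hi; exists x.
  apply: (nb u (fun i => (Hu i).1)); right => -[M [_ HM]].
  have [i _ Hi] := @nbhs_infty_ger R (M + 1).
  have := HM (M + 1); rewrite ltrDl ltr01 => /(_ isT (u i)).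
  have h : range u (u i) by exists i.
  move=> /(_ h) /=; have [_] := Hu i; have := Hi i (leqnn i) => /=; lra.
move=> x clx.
have /choice[u Hu] : forall i : nat, exists y, (B y /\ omega y <= c) /\ `|y - x| < i.+1%:R^-1.
  move=> i; have i0 : 0 < i.+1%:R^-1 :> R by rewrite invr_gt0.
  have [y [Hy yx]] := clx _ (nbhsx_ballx x _ i0); exists y; split => //.
  by move: yx; rewrite -ball_normE /ball_/= distrC.
have ux : u @ \oo --> x.
  apply/near_cvg_norm => e e0; have := @near_infty_natSinv_lt R (PosNum e0).
  by apply: filterS => k /=; have [_] := Hu k; exact: lt_trans.
have [Bx|nBx] := pselect (B x).
  split => //; have [U UU Uoo] := ultra_free.
  have uU : u @ U --> x by move=> N /ux /Uoo.
  apply: (cvgr_to_le (omega_ultralimit UU Bx uU)).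
  by apply: (@filterS _ _ _ setT) => [i _|]; [have [[]] := Hu i|exact: filterT].
exfalso; apply: (nb u (fun i => (Hu i).1)); left => e e0.
move/near_cvg_norm: ux => /(_ e e0); apply: filterS => i h; exists x => //.
split; last by move: B_open; rewrite openE => _ /interior_subset.
by apply: (closureS _ clx) => y [].
Qed.

End Indicator.

(** * Stability over a bounded horizon *)

Section ClassKL.
Variables (R : realType) (beta : R -> R -> R).
Hypothesis KL : class_KL beta.

Lemma KL_zero s : 0 <= s -> beta 0 s = 0.
Proof.
move=> s0; have [b0 bmono _ blim _] := KL; apply/eqP; rewrite eq_le b0// andbT.
apply/ler_addgt0Pr => e e0; rewrite add0r.
have /cvgrPdist_lt/(_ e e0) := blim s s0 => H; near (0 : R)^'+ => r.
have r0 : 0 < r by near: r; exact: nbhs_right_gt.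
have : `|0 - beta r s| < e by near: r.
rewrite sub0r normrN (ger0_norm (b0 _ _ (ltW r0) s0)).
move=> /ltW; apply: le_trans; apply: bmono => //; exact: ltW.
Unshelve. all: by end_near. Qed.

(** The estimate [beta] is not assumed to be continuous; doubling the radius and
    delaying the time leave room for passing to the limit. *)
Definition relaxed r s := beta (2 * r) (Num.max (s - 1) 0).

Lemma relaxed_KL : class_KL relaxed.
Proof.
have [b0 bmono banti blim0 blimoo] := KL; have m0 (s : R) : 0 <= Num.max (s - 1) 0.
  by rewrite le_max lexx orbT.
rewrite /relaxed; split.
- by move=> r s r0 s0; apply: b0 => //; rewrite mulr_ge0.
- by move=> r r' s r0 rr s0; apply: bmono => //; rewrite ?mulr_ge0// ler_pM2l.
- move=> r s s' r0 s0 ss; apply: banti; rewrite ?mulr_ge0//.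
  by rewrite ge_max !le_max lexx orbT andbT lerD2r ss.
- move=> s s0; apply/cvgrPdist_lt => e e0.
  have /cvgrPdist_lt/(_ e e0) := blim0 _ (m0 s).
  move=> /nbhs_ballP[q /= q0 Hq]; near=> r.
  have r0 : 0 < r by near: r; exact: nbhs_right_gt.
  have rq : r < q / 2 by near: r; apply: nbhs_right_lt; rewrite divr_gt0.
  apply: Hq; last by rewrite mulr_gt0.
  by rewrite /ball/= sub0r normrN ger0_norm; lra.
- move=> r r0; apply/cvgrPdist_lt => e e0.
  have r20 : 0 <= 2 * r by rewrite mulr_ge0.
  have /cvgrPdist_lt/(_ e e0) := blimoo _ r20.
  move=> [S [_ HS]]; exists (S + 1); split; first exact: num_real.
  by move=> s sS; apply: HS; rewrite lt_max; apply/orP; left; lra.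
Unshelve. all: by end_near. Qed.

End ClassKL.

Section FiniteHorizon.
Variables (R : realType) (n : nat) (H : hybrid_system R n).
Notation V := 'rV[R]_n.
Notation C := (flow_set H).
Notation D := (jump_set H).
Variable P : R -> R -> R -> (R -> V) -> Prop.
Hypothesis AF : approximate_flow C (flow_map H) P.
Hypothesis D_closed : closed D.
Hypothesis G_osc : forall th, D th -> osc_at (jump_map H) th.
Hypothesis G_bounded : exists M, forall th v, D th -> jump_map H th v -> `|v| <= M.
Variables (A B : set V) (omega : V -> R) (beta : R -> R -> R).
Hypothesis B_open : open B.
Hypothesis omega_proper : proper_indicator A B omega.
Hypothesis KL : class_KL beta.
Hypothesis stable : forall J t f,
  is_run (flow_piece H) (C `|` D) D (jump_map H) J t f -> B (f 0%N 0) ->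
  B (f J (t J.+1)) /\ omega (f J (t J.+1)) <= beta (omega (f 0%N 0)) (t J.+1 + J%:R).

Notation run e := (is_run (P e) (C `|` D) D (jump_map H)).
Notation bound := (relaxed beta).

Let omega0 x : B x -> 0 <= omega x. Proof. by case: omega_proper => h _ _ _; exact: h. Qed.

Lemma compact_norm_bound (K : set V) : compact K -> exists M, forall x, K x -> `|x| <= M.
Proof.
move=> /compact_bounded[M [_ HM]]; exists (M + 1) => x Kx.
by apply: (HM (M + 1)) => //; rewrite ltrDl.
Qed.

(** This is what the doubling and the delay in [relaxed] are for: radii and lengths
    only converge to those of the limit. *)
Lemma limit_within_bound (U : set_system nat) (UU : UltraFilter U)
    (w l : nat -> R) (w0 l0 nu : R) (we : nat -> R) we0 :
  (forall i, 0 <= w i) -> 0 <= w0 -> 0 <= l0 -> 0 < nu ->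
  w @ U --> w0 -> l @ U --> l0 -> we @ U --> we0 -> we0 <= beta w0 l0 ->
  \forall i \near U, we i <= bound (w i) (l i) + nu.
Proof.
move=> wi w00 l00 nu0 cw cl cwe wel; have [b0 bmono banti _ _] := KL.
have N1 := ultra_cvg_near UU cwe nu0.
have N2 := ultra_cvg_near UU cl (@ltr01 R).
have key : \forall i \near U, beta w0 l0 <= bound (w i) (l i).
  have m0 (s : R) : 0 <= Num.max (s - 1) 0 by rewrite le_max lexx orbT.
  have [w0E|w0n] := eqVneq w0 0.
    apply: (@filterS _ _ _ setT) => [i _|]; last exact: filterT.
    by rewrite w0E (KL_zero KL)// b0// mulr_ge0.
  have w0p : 0 < w0 / 2 by rewrite divr_gt0// lt_neqAle eq_sym w0n.
  apply: filterS2 N2 (ultra_cvg_near UU cw w0p) => i h1 h2.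
  have h3 : w0 <= 2 * w i by move: h2; rewrite ltr_norml => /andP[]; lra.
  have h4 : Num.max (l i - 1) 0 <= l0.
    by rewrite ge_max l00 andbT; move: h1; rewrite ltr_norml => /andP[_]; lra.
  apply: le_trans (bmono _ _ _ w00 h3 l00) _; apply: banti => //.
  by rewrite mulr_ge0.
apply: filterS2 N1 key => i; rewrite ltr_norml => /andP[_ h1] h2.
by move: wel h1 h2; lra.
Qed.

(** Trajectories violating the estimate for parameters tending to [0], stopped at an
    early violation, have a limit which is a trajectory of the average system. *)
Lemma finite_horizon K nu T : compact K -> K `<=` B -> 0 < nu ->
  exists2 es, 0 < es & forall e, 0 < e -> e <= es -> forall J t f, run e J t f ->
    K (f 0%N 0) -> t J.+1 + J%:R <= T ->
    B (f J (t J.+1)) /\ omega (f J (t J.+1)) <= bound (omega (f 0%N 0)) (t J.+1 + J%:R) + nu.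
Proof.
move=> cK KB nu0; have [b0 bmono banti _ _] := relaxed_KL KL.
apply: contrapT => Hn.
have [c1 Hc1] := omega_bounded B_open omega_proper cK KB.
pose cK' := Num.max c1 0; pose Mb := bound cK' 0 + nu.
have [M1 HM1] := compact_norm_bound (@sublevel_compact _ _ A B omega B_open omega_proper Mb).
have [M2 HM2] := G_bounded; have [M3 HM3] := compact_norm_bound cK.
pose M := Num.max M1 (Num.max M2 M3).
have [MM1 MM2 MM3] : [/\ M1 <= M, M2 <= M & M3 <= M] by rewrite /M !le_max !lexx ?orbT.
pose viol (e : R) (J : nat) (t : nat -> R) (f : nat -> R -> V) := [/\ run e J t f, K (f 0%N 0), t J.+1 + J%:R <= T,
  (forall j s, (j <= J)%N -> t j <= s <= t j.+1 -> `|f j s| <= M + 1) &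
  ~ (B (f J (t J.+1)) /\
     omega (f J (t J.+1)) <= bound (omega (f 0%N 0)) (t J.+1 + J%:R) + nu)].
have /choice[x Hx] : forall i : nat, exists x : R * nat * (nat -> R) * (nat -> R -> V),
    [/\ 0 < x.1.1.1, x.1.1.1 <= i.+1%:R^-1 & viol x.1.1.1 x.1.1.2 x.1.2 x.2].
  move=> i; apply: contrapT => Hi; apply: Hn; exists (i.+1%:R^-1); first by rewrite invr_gt0.
  move=> e e0 ei J t f r Kf lT; apply: contrapT => bad; apply: Hi.
  have [t0 tmono _ _ _] := r; have tle := run_time_le tmono.
  have w0 : 0 <= omega (f 0%N 0) by apply: omega0; exact: KB.
  have [j [s [jJ hs bs bnd]]] := @first_violation R n (P e) (C `|` D) D (jump_map H)
    (@af_ac _ _ _ _ _ AF e) (fun j s => ~ (B (f j s) /\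
      omega (f j s) <= bound (omega (f 0%N 0)) (s + j%:R) + nu)) M J t f r
    ltac:(move=> j s jJ /andP[hs _] /contrapT[Bf wf]; apply: le_trans MM1; apply: HM1;
      split => //; apply: (le_trans wf); rewrite lerD2r;
      have sj : 0 <= s + j%:R by [rewrite addr_ge0// (le_trans _ hs)// -t0 tle// leqW];
      apply: (@le_trans _ _ (bound (omega (f 0%N 0)) 0)); [exact: banti|];
      apply: bmono => //; rewrite le_max Hc1//)
    ltac:(by move=> th v Dth Gv; exact: le_trans (HM2 _ _ Dth Gv) MM2)
    (le_trans (HM3 _ Kf) MM3) bad.
  exists (e, j, (fun k => if (k <= j)%N then t k else s), f) => /=; split => //.
  have ltjj : (j < j)%N = false by rewrite ltnn.
  split; rewrite /= ?ltjj//.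
  - exact: (run_truncate (@af_sub _ _ _ _ _ AF e) r jJ hs).
  - apply: le_trans lT; apply: lerD; last by rewrite ler_nat.
    by case/andP: hs => _ /le_trans; apply; exact: tle.
  - by move=> k q kj; rewrite kj => hq; exact: bnd.
pose e i := (x i).1.1.1; pose J i := (x i).1.1.2; pose t i := (x i).1.2; pose f i := (x i).2.
have e_gt0 i : 0 < e i by have [] := Hx i.
have V_ i : viol (e i) (J i) (t i) (f i) by have [] := Hx i.
have [U UU Uoo] := ultra_free.
have e_cvg : e @ U --> 0.
  apply/near_cvg_norm => d d0; apply: Uoo.
  have := @near_infty_natSinv_lt R (PosNum d0); apply: filterS => k /=.
  rewrite subr0 ger0_norm ?(ltW (e_gt0 k))//; have [_ h _] := Hx k; exact: le_lt_trans.
have rn i : run (e i) (J i) (t i) (f i) by have [] := V_ i.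
have tb i : t i (J i).+1 <= T.
  by have [_ _ h _ _] := V_ i; apply: le_trans h; rewrite lerDl.
have [N HN] : exists N, forall i, (J i <= N)%N.
  exists (Num.Def.archi_bound T) => i; have [_ _ h _ _] := V_ i.
  have [t0 tmono _ _ _] := rn i.
  have ti0 : 0 <= t i (J i).+1 by rewrite -t0 (run_time_le tmono).
  have JT : (J i)%:R <= T by apply: le_trans h; rewrite lerDr.
  have T0 : 0 <= T by apply: le_trans JT.
  by rewrite -(ler_nat R); apply: ltW; exact: le_lt_trans JT (archi_boundP T0).
have fb i j s : (j <= J i)%N -> t i j <= s <= t i j.+1 -> `|f i j s| <= M + 1.
  by have [_ _ _ h _] := V_ i; exact: h.
have [Jo [to [fo [rfo HJ Hto Hfo]]]] := limit_run AF D_closed G_osc UU e_gt0 e_cvg rn tb HN fb.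
have [to0 tomono _ _ _] := rfo.
have start : (fun i => f i 0%N 0) @ U --> fo 0%N 0.
  apply: (Hfo 0%N isT (fun=> 0)); last exact: cvg_cst.
  apply: (@filterS _ _ _ setT) => [i _|]; last exact: filterT.
  have [t0 tm _ _ _] := rn i; rewrite -t0 lexx /=; exact: tm.
have fin : (fun i => f i Jo (t i Jo.+1)) @ U --> fo Jo (to Jo.+1).
  apply: (Hfo Jo (leqnn Jo)); last exact: Hto.
  apply: filterS HJ => i Ji; rewrite lexx andbT.
  by have [_ tm _ _ _] := rn i; apply: tm; rewrite Ji.
have Kfo : K (fo 0%N 0).
  apply: (closed_cvg _ (compact_closed (@norm_hausdorff _ _) cK)) start.
  by apply: (@filterS _ _ _ setT) => [i _|]; [have [] := V_ i|exact: filterT].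
have [Bend wend] := stable rfo (KB _ Kfo).
have wc := omega_ultralimit B_open omega_proper UU (KB _ Kfo) start.
have wec := omega_ultralimit B_open omega_proper UU Bend fin.
have lc : (fun i => t i Jo.+1 + Jo%:R) @ U --> to Jo.+1 + Jo%:R.
  by apply: cvgD; [exact: Hto|exact: cvg_cst].
have NB : \forall i \near U, B (f i Jo (t i Jo.+1)).
  by apply: fin; exact: open_nbhs_nbhs.
have wi0 i : 0 <= omega (f i 0%N 0) by apply: omega0; apply: KB; have [] := V_ i.
have l00 : 0 <= to Jo.+1 + Jo%:R by rewrite addr_ge0// -to0 (run_time_le tomono).
have NW := limit_within_bound UU wi0 (omega0 (KB _ Kfo)) l00 nu0 wc lc wec wend.
have [i [[h1 h2] h3]] := filter_ex (filterI (filterI NB NW) HJ).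
by have [_ _ _ _] := V_ i; apply; rewrite h3.
Qed.

End FiniteHorizon.

(** * Stability over an unbounded horizon *)

Section SplitRun.
Variables (R : realType) (m : nat).
Notation V := 'rV[R]_m.
Variables (P : R -> R -> (R -> V) -> Prop) (C D : set V) (G : V -> set V).
Hypothesis P_C : forall a b f, P a b f -> forall s, a <= s <= b -> C (f s).
Hypothesis P_sub : forall a b a' b' f, a <= a' -> b' <= b -> P a b f -> P a' b' f.
Hypothesis P_shift : forall a b c f, P a b f -> P (a - c) (b - c) (fun s => f (s + c)).

(** Times are counted with the jumps; a jump adds [1], whence the window of
    length [1]. *)
Lemma split_time J (t : nat -> R) sigma : t 0%N = 0 ->
  (forall j, (j <= J)%N -> t j <= t j.+1) -> 0 <= sigma -> sigma <= t J.+1 + J%:R ->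
  exists k s, [/\ (k <= J)%N, t k <= s <= t k.+1 & sigma <= s + k%:R < sigma + 1].
Proof.
move=> t0 tmono s0 sJ.
have exk : exists k, (k <= J)%N && (sigma <= t k.+1 + k%:R) by exists J; rewrite leqnn.
case: (ex_minnP exk) => k /andP[kJ sk] kmin.
exists k, (Num.max (t k) (sigma - k%:R)); split => //.
  by rewrite le_max lexx/= ge_max tmono//= lerBlDr.
have lt_k : t k + k%:R < sigma + 1.
  case: k kJ {sk} kmin => [_ _|k kJ kmin]; first by rewrite t0 addr0 ltr_wpDl.
  have : ~~ (sigma <= t k.+1 + k%:R).
    by apply/negP => h; have := kmin k; rewrite (ltnW kJ) h ltnn => /(_ isT).
  by rewrite -ltNge -natr1; lra.
by case: (leP (t k) (sigma - k%:R)) => h; apply/andP; split; lra.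
Qed.

Lemma run_tail J t f k s : is_run P (C `|` D) D G J t f -> (k <= J)%N ->
  t k <= s <= t k.+1 -> s + k%:R < t J.+1 + J%:R ->
  is_run P (C `|` D) D G (J - k) (fun j => if j is 0%N then 0 else t (k + j)%N - s)
    (fun j q => f (k + j)%N (q + s)).
Proof.
move=> [t0 tmono piece jump init] kJ /andP[ks sk] slt.
have tE j : (if j.+1 is 0%N then 0 else t (k + j.+1)%N - s) = t (k + j).+1 - s.
  by rewrite addnS.
have kj j : (j <= J - k)%N -> (k + j <= J)%N by move=> jJ; rewrite -leq_subRL.
split => //.
- case=> [_|j jJ]; first by rewrite addn1 subr_ge0.
  by rewrite lerD2r [(k + j.+2)%N]addnS; apply: tmono; exact: kj.
- case=> [_|j jJ].
    rewrite addn1 addn0 -(subrr s) => h; apply: P_shift; apply: (P_sub ks (lexx _)).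
    by apply: piece => //; apply: (le_lt_trans ks); move: h; rewrite ltrD2r.
  rewrite [(k + j.+2)%N]addnS ltrD2r => h; apply: P_shift; apply: piece => //; exact: kj.
- move=> j jJ; rewrite addnS subrK; apply: jump.
  by rewrite -addnS; apply: kj.
- rewrite add0r addn0.
  have [tk|tk] := ltP (t k) (t k.+1).
    by left; apply: (P_C (piece k kJ tk)); rewrite ks.
  have sE : s = t k.+1 by apply/le_anti; rewrite sk (le_trans tk).
  right; rewrite sE; apply: (jump k _).1; rewrite ltn_neqAle kJ andbT.
  by apply/eqP => kE; move: slt; rewrite -kE sE ltxx.
Qed.

End SplitRun.

Section InfiniteHorizon.
Variables (R : realType) (m : nat).
Notation V := 'rV[R]_m.
Variables (P : R -> R -> R -> (R -> V) -> Prop) (C D : set V) (G : V -> set V).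
Variable F : V -> set V.
Hypothesis AF : approximate_flow C F P.
Hypothesis P_shift : forall e a b c f, P e a b f -> P e (a - c) (b - c) (fun s => f (s + c)).
Variables (A B : set V) (omega : V -> R) (bound : R -> R -> R).
Hypothesis B_open : open B.
Hypothesis omega_proper : proper_indicator A B omega.
Hypothesis KL : class_KL bound.
Notation run e := (is_run (P e) (C `|` D) D G).
Hypothesis finite : forall (K : set V) nu T, compact K -> K `<=` B -> 0 < nu ->
  exists2 es, 0 < es & forall e, 0 < e -> e <= es -> forall J t f, run e J t f ->
    K (f 0%N 0) -> t J.+1 + J%:R <= T ->
    B (f J (t J.+1)) /\ omega (f J (t J.+1)) <= bound (omega (f 0%N 0)) (t J.+1 + J%:R) + nu.

(** After a long enough time the trajectory has entered a small sublevel set, so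
    that a bound over a bounded horizon can be restarted and holds forever. *)
Lemma infinite_horizon (K : set V) nu : compact K -> K `<=` B -> 0 < nu ->
  exists2 es, 0 < es & forall e, 0 < e -> e <= es -> forall J t f, run e J t f ->
    K (f 0%N 0) ->
    B (f J (t J.+1)) /\ omega (f J (t J.+1)) <= bound (omega (f 0%N 0)) (t J.+1 + J%:R) + nu.
Proof.
move=> cK KB nu0; have [b0 bmono banti _ blim] := KL.
have w0 x : B x -> 0 <= omega x by have [h _ _ _] := omega_proper; exact: h.
have [c1 Hc1] := omega_bounded B_open omega_proper cK KB.
(* [nu1 <= 1 <= r]: a point reached with [omega] at most [nu1] is again an admissible
   initial point. *)
pose r := Num.max c1 1; pose nu1 := Num.min nu 1.
have r0 : 0 <= r by rewrite le_max ler01 orbT.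
have nu10 : 0 < nu1 by rewrite lt_min nu0 ltr01.
have nu12 : 0 < nu1 / 2 by rewrite divr_gt0.
have [nu1r nu1nu] : nu1 <= r /\ nu1 <= nu.
  by rewrite /nu1 /r le_max !ge_min !lexx !orbT.
pose K' := [set x | B x /\ omega x <= r].
have cK' : compact K' := @sublevel_compact _ _ A B omega B_open omega_proper r.
have K'B : K' `<=` B by move=> x [].
have KK' x : K x -> K' x by move=> Kx; split; [exact: KB|rewrite le_max Hc1].
have [T T1 HT] : exists2 T, 1 <= T & bound r T <= nu1 / 2.
  have /cvgrPdist_lt/(_ _ nu12)[S [_ HS]] := blim r r0.
  exists (Num.max 1 (S + 1)); first by rewrite le_max lexx.
  have := HS (Num.max 1 (S + 1)); rewrite lt_max ltrDl ltr01 orbT => /(_ isT).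
  rewrite sub0r normrN => /ltW; apply: le_trans; exact: ler_norm.
have T0 : 0 <= T by exact: le_trans ler01 T1.
have [es es0 FH] := finite (2 * T + 3) cK' K'B nu12.
exists es => // e e0 ees.
have long N : forall J t f, run e J t f -> K' (f 0%N 0) -> T <= t J.+1 + J%:R ->
    t J.+1 + J%:R <= N%:R -> B (f J (t J.+1)) /\ omega (f J (t J.+1)) <= nu1.
  have short J t f : run e J t f -> K' (f 0%N 0) -> T <= t J.+1 + J%:R ->
      t J.+1 + J%:R <= 2 * T + 3 -> B (f J (t J.+1)) /\ omega (f J (t J.+1)) <= nu1.
    move=> rn K'f lT lT2; have [Bf wf] := FH e e0 ees J t f rn K'f lT2; split => //.
    apply: (le_trans wf); have [Bf0 wf0] := K'f.
    have : bound (omega (f 0%N 0)) (t J.+1 + J%:R) <= bound r T.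
      apply: le_trans (bmono _ _ _ (w0 _ Bf0) wf0 _) (banti _ _ _ r0 T0 lT).
      exact: le_trans T0 lT.
    by move: HT; lra.
  elim: N => [|N IH] J t f rn K'f lT lN; first by apply: (short J t f rn K'f lT); apply: (le_trans lN); lra.
  have [lT2|lT2] := leP (t J.+1 + J%:R) (2 * T + 3); first exact: (short J t f rn K'f lT).
  set l := t J.+1 + J%:R in lT lN lT2; have [t0 tmono _ _ _] := rn.
  (* Both parts last at least [T], and the second one at most [T + 1]. *)
  have sg0 : 0 <= l - T - 1 by lra.
  have sgl : l - T - 1 <= t J.+1 + J%:R by rewrite -/l; lra.
  have [k [s [kJ hs /andP[l1 l2]]]] := split_time t0 tmono sg0 sgl.
  have slt : s + k%:R < t J.+1 + J%:R by rewrite -/l; lra.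
  have ltkk : (k < k)%N = false by rewrite ltnn.
  have [Bm wm] : B (f k s) /\ omega (f k s) <= nu1.
    have := IH k _ f (run_truncate (@af_sub _ _ _ _ _ AF e) rn kJ hs).
    rewrite ltkk /= => H; apply: H => //; first by lra.
    by move: lN; rewrite -natr1; lra.
  have := short (J - k)%N _ _ (run_tail (@af_in _ _ _ _ _ AF e) (@af_sub _ _ _ _ _ AF e) (@P_shift e) rn kJ hs slt).
  rewrite add0r addn0 addnS subnKC// subrK => H; apply: H.
  - by split => //; exact: le_trans nu1r.
  - by rewrite natrB// addrACA -/l; move: l1 l2; rewrite /l; lra.
  - by rewrite natrB// addrACA -/l; move: l1 l2; rewrite /l; lra.
move=> J t f rn Kf; have [t0 tmono _ _ _] := rn.
have l0 : 0 <= t J.+1 + J%:R by rewrite addr_ge0// -t0 (run_time_le tmono).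
have wf0 : 0 <= omega (f 0%N 0) by apply: w0; exact: KB.
have [lT|lT] := leP (t J.+1 + J%:R) (2 * T + 3).
  have [Bf wf] := FH e e0 ees J t f rn (KK' _ Kf) lT; split => //.
  by apply: (le_trans wf); rewrite lerD2l; lra.
have [Bf wf] : B (f J (t J.+1)) /\ omega (f J (t J.+1)) <= nu1.
  apply: (long (Num.Def.archi_bound (t J.+1 + J%:R)) J t f rn (KK' _ Kf)).
    by move: lT; lra.
  by apply: ltW; exact: archi_boundP.
split => //; apply: (le_trans wf); apply: (le_trans nu1nu).
by rewrite lerDr b0.
Qed.

End InfiniteHorizon.

(** * Averaging *)

Section MainTheorem.
Variables (R : realType) (n1 n2 : nat).
Notation V := 'rV[R]_(n1 + n2).
Variables (C D : set V) (phi1 phi2 : vfield R n1 n2).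
Variables (Phi : 'rV[R]_n2 -> set 'rV[R]_n2) (G : V -> set V).
Variables (T1 T2 : R).
Hypotheses (T10 : 0 < T1) (T20 : 0 < T2).
Hypothesis BA : basic_assumption C D Phi G.
Hypothesis RA : regularity_assumption C phi1 phi2 T1 T2.

Notation H_e := (H_eps C D phi1 phi2 Phi G).
Notation H_a := (H_ave C D phi1 phi2 Phi G T1 T2).

(** The theta component of a flow of the perturbed system, up to a time shift:
    the shift makes this notion stable under a change of the initial time. *)
Definition theta_flow (e a b : R) (f : R -> V) : Prop := exists c y,
  flow_piece (H_e e) (a + c) (b + c) y /\ forall s, f s = theta_part (y (s + c)).

Lemma theta_flow_C e a b f : theta_flow e a b f -> forall s, a <= s <= b -> C (f s).
Proof.
move=> [c [y [[yC _ _] fy]]] s /andP[as_ sb]; rewrite fy.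
by have [|] := yC (s + c); rewrite ?lerD2r ?as_.
Qed.

Lemma theta_flow_ac e a b f : theta_flow e a b f -> abs_continuous_on f a b.
Proof.
move=> [c [y [[_ yac _] fy]]] d /yac[q q0 Hq]; exists q => // N u v uv tI Hs.
apply: (le_lt_trans _ (Hq N (fun k => u k + c) (fun k => v k + c) _ _ _)) => [|k||].
- apply: ler_sum => k _; rewrite !fy /theta_part -linearB; exact: lsubmx_norm_le.
- by rewrite !lerD2r; exact: uv.
- move=> i j _ _ [x [/=]]; rewrite !in_itv/= => /andP[x1 x2] /andP[x3 x4].
  apply: tI => //; exists (x - c); rewrite /= !in_itv/=; split; apply/andP; split; lra.
- by apply: le_lt_trans Hs; apply: ler_sum => k _; lra.
Qed.

Lemma theta_flow_sub e a b a' b' f : a <= a' -> b' <= b ->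
  theta_flow e a b f -> theta_flow e a' b' f.
Proof.
move=> aa bb [c [y [yf fy]]]; exists c, y; split => //.
by apply: flow_piece_sub yf; rewrite lerD2r.
Qed.

Lemma theta_flow_shift e a b c f : theta_flow e a b f ->
  theta_flow e (a - c) (b - c) (fun s => f (s + c)).
Proof.
move=> [c' [y [yf fy]]]; exists (c + c'), y; split; last by move=> s; rewrite fy addrA.
by rewrite !addrA !subrK.
Qed.

Lemma theta_flow_window th0 eta : C th0 -> 0 < eta -> exists d c eps0,
  [/\ 0 < d, 0 <= c, 0 < eps0 & forall eps, 0 < eps -> eps <= eps0 ->
   forall a b f, a <= b -> theta_flow eps a b f ->
   (forall s, a <= s <= b -> `|f s - th0| <= d) ->
   exists2 v, flow_map H_a th0 v & `|f b - f a - (b - a) *: v| <= eta * (b - a) + c * eps].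
Proof.
move=> Cth eta0; have [d [c [eps0 [d0 c0 e0 W]]]] := window T10 T20 BA RA Cth eta0.
exists d, c, eps0; split => // eps ep0 epe a b f ab [c' [y [yf fy]]] fd.
have [||v Fv Hv] := W eps ep0 epe (a + c') (b + c') y _ yf.
- by rewrite lerD2r.
- move=> s /andP[s1 s2]; have := fd (s - c').
  by rewrite fy subrK; apply; rewrite lerBrDr s1 lerBlDr s2.
- exists v => //; rewrite !fy; move: Hv.
  by rewrite (_ : b + c' - (a + c') = b - a)//; ring.
Qed.

Lemma ave_map_bounded th : C th -> exists M, forall v, flow_map H_a th v -> `|v| <= M.
Proof.
move=> Cth; have [M M0 HM] := Phi_bound BA.
exists (`|f_bar phi1 phi2 T1 T2 th| + M) => v [vx vz].
apply: row_mx_norm_le; first by rewrite addr_ge0.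
  by rewrite -[lsubmx v]/(xpart v) vx lerDl.
by apply: le_trans (HM th _ Cth vz) _; rewrite lerDr.
Qed.

Lemma ave_map_closed th : C th -> closed (flow_map H_a th).
Proof.
move=> Cth v clv.
have /choice[u Hu] : forall i : nat, exists w, flow_map H_a th w /\ `|w - v| < i.+1%:R^-1.
  move=> i; have i0 : 0 < i.+1%:R^-1 :> R by rewrite invr_gt0.
  have [w [Fw wv]] := clv _ (nbhsx_ballx v _ i0); exists w; split => //.
  by move: wv; rewrite -ball_normE /ball_/= distrC.
split.
- apply/eqP; rewrite -subr_eq0 -normr_le0; apply/ler_addgt0Pr => e e0; rewrite add0r.
  have [i _ Hi] := @near_infty_natSinv_lt R (PosNum e0).
  have [[<- _] uv] := Hu i; rewrite /xpart -linearB; apply: (le_trans (lsubmx_norm_le _)).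
  by rewrite distrC; apply: ltW; apply: (lt_trans uv); apply: Hi => /=.
- have [_ [[osc _] _] _ _ _] := BA.
  apply: (osc th Cth (fun=> th) (fun i => zpart (u i))); first exact: cvg_cst.
    apply/near_cvg_norm => e e0; have := @near_infty_natSinv_lt R (PosNum e0).
    apply: filterS => i; apply: le_lt_trans; apply: le_trans (ltW (Hu i).2).
    by rewrite /zpart -linearB; exact: rsubmx_norm_le.
  by move=> i; have [[]] := Hu i.
Qed.

Lemma UAS_run (B : set V) (omega : V -> R) (beta : R -> R -> R) :
  (forall (E : set (R * nat)) (y : R -> nat -> V), hybrid_solution H_a E y -> B (y 0 0%N) ->
     forall t j, E (t, j) ->
       B (y t j) /\ omega (y t j) <= beta (omega (y 0 0%N)) (t + j%:R)) ->
  forall J t f, is_run (flow_piece H_a) (C `|` D) D G J t f -> B (f 0%N 0) ->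
  B (f J (t J.+1)) /\ omega (f J (t J.+1)) <= beta (omega (f 0%N 0)) (t J.+1 + J%:R).
Proof.
move=> st J t f rn Bf; apply: (st _ _ (run_solution rn) Bf).
by have [_ tm _ _ _] := rn; rewrite /= leqnn lexx tm.
Qed.

Lemma theta_run e E y : hybrid_solution (H_e e) E y -> forall T J, E (T, J) ->
  exists2 t, is_run (theta_flow e) (C `|` D) D G J t (fun j s => theta_part (y s j)) &
    t J.+1 = T.
Proof.
move=> sol T J ET; have [t [t0 tmono piece jump init] tT] := solution_run sol ET.
exists t => //; split => //.
- move=> j jJ tj; exists 0, (fun s => y s j); split; last by move=> s; rewrite addr0.
  by rewrite !addr0; exact: piece.
- by move=> j jJ; have [[h1 _ _] [h2 _ _]] := jump j jJ.
- by case: init => -[h _ _]; [left|right].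
Qed.

Lemma averaging A B : UAS H_a A B -> SGPAS H_e A B.
Proof.
move=> [_ B_open _ uas] omega om; have [beta KL st] := uas omega om.
exists (relaxed beta); first exact: relaxed_KL.
move=> K nu cK KB nu0.
have [[C_closed D_closed] _ [G_osc [MG [_ HMG]]] _ _] := BA.
have Gb : exists M, forall th v, D th -> G th v -> `|v| <= M.
  exists (MG + 1) => th v Dth Gv; apply: (HMG (MG + 1)); first by rewrite ltrDl.
  by exists th.
have AF : approximate_flow C (flow_map H_a) theta_flow.
  split; [exact: C_closed|exact: ave_map_bounded|exact: ave_map_closed|exact: theta_flow_C|
    exact: theta_flow_ac|exact: theta_flow_sub|exact: theta_flow_window].
have stab := UAS_run st.
have fin := @finite_horizon R _ H_a theta_flow AF D_closed G_osc Gb A B omega beta B_open om KL stab.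
have [es es0 Hes] := infinite_horizon AF theta_flow_shift B_open om (relaxed_KL KL) fin cK KB nu0.
exists es => // e /andP[e0 ees] E y sol Ky t j Etj.
have [tt rn ttE] := theta_run sol Etj.
by have := Hes e e0 ees j tt _ rn Ky; rewrite ttE.
Qed.

End MainTheorem.

Theorem theorem2 (R : realType) (n1 n2 : nat)
    (C D : set 'rV[R]_(n1 + n2)) (phi1 phi2 : vfield R n1 n2)
    (Phi : 'rV[R]_n2 -> set 'rV[R]_n2)
    (G : 'rV[R]_(n1 + n2) -> set 'rV[R]_(n1 + n2))
    (T1 T2 : R) (A B : set 'rV[R]_(n1 + n2)) :
  (forall eps : R, 0 < eps ->
     {within tau_nonneg C, continuous (fun y : 'rV[R]_(n1 + n2 + 2) =>
        f_eps phi1 phi2 eps (xpart (theta_part y)) (zpart (theta_part y))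
          (tau1_part y) (tau2_part y))}) ->
  basic_assumption C D Phi G ->
  0 < T1 -> 0 < T2 ->
  regularity_assumption C phi1 phi2 T1 T2 ->
  compact A ->
  UAS (H_ave C D phi1 phi2 Phi G T1 T2) A B ->
  SGPAS (H_eps C D phi1 phi2 Phi G) A B.
Proof. by move=> _ BA T10 T20 RA _; exact: averaging. Qed.
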